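(* Let $I(x)$ be a smooth function whose domain is open and connected, and set $\widetilde M_I=\mathbb{R}_+\times M_I\times\mathbb{R}$ with coordinates $t$ on $\mathbb{R}_+$ and $\rho$ on the last factor $\mathbb{R}$. Then the following hold. (1) The generic $2$-plane field $D_I$ on the $5$-manifold $M_I$ is given by $$D_I=\left\langle \partial_q,\ \partial_x+p\,\partial_y+q\,\partial_p-\tfrac12\left[q^2+\tfrac{10}{3}Ip^2+(1+I^2-I'')y^2\right]\partial_z\right\rangle,$$ and the Nurowski conformal structure $c_I$ it defines contains the representative $$g_I=-3I(\omega^1)^2+3\,\omega^1\omega^4-10Ip\,\omega^1\omega^5-3\,\omega^2\omega^5-2(\omega^3)^2 .$$ (2) The metric $$\widetilde g_I=2\rho\,dt^2+2t\,dt\,d\rho+t^2\left(g_I-\tfrac23\rho I\,dx^2\right)$$ on $\widetilde M_I$ is a Ricci-flat ambient metric for $c_I$. (3) The $3$-form $\widetilde\Phi_I\in\Gamma(\Lambda^3T^*\widetilde M_I)$ defined by $$\begin{aligned}\widetilde\Phi_I=C\big[&-9t^2\,dt\wedge\omega^1\wedge\omega^2-2t^2\,dt\wedge\omega^3\wedge d\rho-3t^3\,\omega^1\wedge\omega^3\wedge\omega^4+10t^3Ip\,\omega^1\wedge\omega^3\wedge\omega^5\\&-t^3I\,\omega^1\wedge\omega^5\wedge d\rho+3t^3\,\omega^2\wedge\omega^3\wedge\omega^5+t^3\,\omega^4\wedge\omega^5\wedge d\rho\\&+\left(-3t^2I\,dt\wedge\omega^1\wedge\omega^5+t^2\,dt\wedge\omega^4\wedge\omega^5\right)\rho\,\big],\qquad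 C=2^{-5/6}3^{-1/3},\end{aligned}$$ is parallel with respect to the Levi-Civita connection of $\widetilde g_I$ and satisfies $H(\widetilde\Phi_I)=\widetilde g_I$. In particular, $\widetilde\Phi_I$ is split-generic. (4) The parallel tractor $3$-form associated to $D_I$ is $\Phi_I:=\widetilde\Phi_I|_{\mathcal G}$, and the trivialization with respect to $g_I$ of the normal conformal Killing form $\phi=\Pi_0(\Phi_I)\in\Gamma(\Lambda^2T^*M_I[3])$ is $$\phi_I=-9C\,\omega^1\wedge\omega^2 .$$
   Context: $M_I=\{(x,y,p,q,z)\in\mathbb{R}^5:x\in\mathrm{dom}\,I\}$; $I$ is identified with its pullback $I(x)$, and pullbacks along $\widetilde M_I\to M_I$ are suppressed. With $F_I=-\tfrac12[q^2+\tfrac{10}{3}Ip^2+(1+I^2-I'')y^2]$, $$\omega^1=dy-p\,dx,\quad\omega^2=dz-F_I\,dx-(\partial_qF_I)(dp-q\,dx),\quad\omega^3=dp-q\,dx,\quad\omega^4=dq,\quad\omega^5=dx,$$ and $D_I=\ker\{\omega^1,\omega^2,\omega^3\}$. A $2$-plane field $D$ on a $5$-manifold $M$ is generic if $[D,[D,D]]=TM$. Symmetric products: $\omega^i\omega^j=\tfrac12(\omega^i\otimes\omega^j+\omega^j\otimes\omega^i)$. Split-generic forms and $H$. A $3$-form on a $7$-dimensional real vector space $V$ is split-generic if in some basis $(e^a)$ of $V^*$ it equals $$\tfrac1{\sqrt6}\left(-\sqrt2\,e^1\wedge e^5\wedge e^6-e^2\wedge e^4\wedge e^5-e^3\wedge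 e^4\wedge e^6+e^1\wedge e^4\wedge e^7-\sqrt2\,e^2\wedge e^3\wedge e^7\right).$$ A $3$-form $\varphi$ on $V$ induces the symmetric $\Lambda^7V^*$-valued bilinear form $(X,Y)\mapsto(X\lrcorner\varphi)\wedge(Y\lrcorner\varphi)\wedge\varphi$; $\varphi$ is called generic when this form is nondegenerate (split-generic forms are generic). Its determinant is then a nonzero element $\det\in\otimes^9\Lambda^7V^*$ (if the form is $b_{ij}\,\varepsilon$ in a basis with $\varepsilon=e^1\wedge\cdots\wedge e^7$, then $\det=\det(b_{ij})\,\varepsilon^{\otimes 9}$), and $\mathrm{vol}\in\Lambda^7V^*$ denotes the unique element with $\mathrm{vol}^{\otimes9}=\det$. The symmetric bilinear form $H(\varphi)$ is defined by $$H(\varphi)(X,Y)\,\mathrm{vol}:=\sqrt6\,(X\lrcorner\varphi)\wedge(Y\lrcorner\varphi)\wedge\varphi,$$ the factor $\sqrt6$ being chosen with the intention that $\mathrm{vol}$ coincide with the volume form induced by the bilinear form for the orientation that $\mathrm{vol}$ determines. These notions are applied fiberwise to differential forms and to sections of $\Lambda^3$ of rank-$7$ bundles. Ambient metric. For a conformal manifold $(M,c)$ of odd dimension at least $3$ the metric bundle $\mathcal G$ is the ray bundle of inner products $g_u$, $g\in c$; a choice $g\in c$ identifies $t^2g_u$ with $(t,u)\in\mathbb{R}_+\times M$; $\mathbf g_0=t^2g$; $\mathcal G=\{\rho=0\}\subset\mathbb{R}_+\times M\times\mathbb{R}$; dilations $\delta_s(t,u,\rho)=(st,u,\rho)$ with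 infinitesimal generator $\mathbb T=t\partial_t$. An ambient metric is a metric $\widetilde g$ on a dilation-invariant open neighborhood of $\mathcal G$ whose pullback to $\mathcal G$ is $\mathbf g_0$, with $\delta_s^*\widetilde g=s^2\widetilde g$, with all curves $s\mapsto\delta_s(p)$ geodesics, and with Ricci curvature vanishing to infinite order along $\rho=0$; here the metric is in fact Ricci-flat. Tractors. The tractor bundle $\mathcal T\to M$ has as sections the vector fields $\xi$ of $\widetilde M$ along $\mathcal G$ with $T\delta_s\cdot\xi=s\xi$; $\widetilde g$ restricts to the tractor metric $g^{\mathcal T}$, and the Levi-Civita connection of $\widetilde g$ induces the tractor connection $\nabla^{\mathcal T}$ (differentiate along dilation-invariant lifts to $\mathcal G$). The projection $\Pi_0:\Gamma(\Lambda^3\mathcal T^* )\to\Gamma(\Lambda^2T^*M[3])$ is $(X,Y)\mapsto\Phi(\mathbb T,\bar X,\bar Y)$ with $\bar X,\bar Y$ dilation-invariant lifts of $X,Y$ to $\mathcal G$; its trivialization with respect to $g$ is obtained by evaluating at the points $t=1$ of $\mathcal G$. Here $[w]$ denotes tensoring with the density bundle of weight $w$ (functions on $\mathcal G$ homogeneous of degree $w$). Nurowski conformal structure. A generic $2$-plane field $D$ on an oriented $5$-manifold induces a canonical conformal structure $c_D$ of signature $(2,3)$. It can be characterized as the conformal structure admitting a $\nabla^{\mathcal T}$-parallel tractor $3$-form $\Phi$ with $H(\Phi)=g^{\mathcal T}$ such that $\ker\Pi_0(\Phi)=[D,D]$; this $\Phi$ is the parallel tractor $3$-form associated to $D$, and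 $\Pi_0(\Phi)$ is its normal conformal Killing $2$-form. One writes $c_I=c_{D_I}$.
   Formalization: H is defined without the factor √6: with the stated C and vol one has (X⌟Φ̃)∧(Y⌟Φ̃)∧Φ̃ = 54C³t⁶ g̃(X,Y) and vol = 54C³t⁶, so the literal H(Φ̃_I) would be √6 g̃_I, while without √6 vol is the induced volume form as intended. *)

(* Defs.v *)
(* MathComp / MathComp-Analysis. *)
From HB Require Import structures.
From mathcomp Require Import all_boot all_order all_algebra perm.
From mathcomp Require Import all_classical all_reals all_analysis.

Set Implicit Arguments.
Unset Strict Implicit.
Unset Printing Implicit Defensive.

Import Order.TTheory GRing.Theory Num.Theory.
Import numFieldNormedType.Exports.

Local Open Scope classical_set_scope.
Local Open Scope ring_scope.

(** * Calculus on open subsets of R^n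

    Every manifold involved is an open subset of some R^n, carried by row
    vectors.  Functions and tensor fields are total; only their values on the
    relevant open set matter.  Tangent vectors are row vectors, a symmetric
    bilinear form is its Gram matrix in the coordinate frame, and a linear map
    is a matrix [f] acting by [v |-> v *m f]. *)

Section Calculus.
Variables (R : realType) (n : nat).
Implicit Types (U : set 'rV[R]_n) (f : 'rV[R]_n -> R) (X : 'rV[R]_n -> 'rV[R]_n).

Definition partial (i : 'I_n) f : 'rV[R]_n -> R :=
  fun x => 'D_(delta_mx 0 i) f x.

Definition iter_partial (s : seq 'I_n) f : 'rV[R]_n -> R := foldr partial f s.

Definition smooth_on U f : Prop :=
  forall (s : seq 'I_n) (x : 'rV[R]_n), U x ->
    {for x, continuous (iter_partial s f)} /\
    forall i, derivable (iter_partial s f) x (delta_mx 0 i).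

Definition smooth_vector_field U X : Prop :=
  forall i, smooth_on U (fun x => X x 0 i).

Definition lie_bracket (X Y : 'rV[R]_n -> 'rV[R]_n) : 'rV[R]_n -> 'rV[R]_n := fun x =>
  \row_i ('D_(X x) (fun y => Y y 0 i) x - 'D_(Y x) (fun y => X y 0 i) x).

End Calculus.

Definition smooth_function (R : realType) (J : set R) (f : R -> R) : Prop :=
  forall (k : nat) (x : R), J x -> derivable (derive1n k f) x 1.

(** * Plane fields *)

Section PlaneFields.
Variables (R : realType) (n : nat).
Implicit Types (U : set 'rV[R]_n) (D E : 'rV[R]_n -> set 'rV[R]_n).
Implicit Types (X Y : 'rV[R]_n -> 'rV[R]_n).

Definition section_of U D X : Prop :=
  smooth_vector_field U X /\ forall x, U x -> D x (X x).

Definition plane_span X Y : 'rV[R]_n -> set 'rV[R]_n :=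
  fun x => [set v | (v <= col_mx (X x) (Y x))%MS].

Definition plane_field U D : Prop :=
  forall x, U x -> exists V X Y,
    [/\ open V, V x, V `<=` U, smooth_vector_field V X /\ smooth_vector_field V Y
      & forall y, V y ->
          row_free (col_mx (X y) (Y y)) /\ D y = plane_span X Y y].

(* [D, E]: pointwise linear span of the values of brackets of sections.  By
   the Leibniz rule, [D, D] contains D and [D, [D, D]] contains [D, D]. *)
Definition bracket_of U D E : 'rV[R]_n -> set 'rV[R]_n := fun x =>
  [set v | exists (k : nat) (A : 'M[R]_(k, n)),
     (forall i, exists X Y,
        [/\ section_of U D X, section_of U E Y & row i A = lie_bracket X Y x])
     /\ (v <= A)%MS].

Definition generic_plane_field U D : Prop :=
  plane_field U D /\
  forall x, U x -> bracket_of U D (bracket_of U D D) x = setT.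

End PlaneFields.

(** * Alternating forms

    A [k]-form at a point is a function of [k] tangent vectors; [altform] says
    that it is multilinear and alternating. *)

Definition form (R : realType) (k n : nat) : Type := ('I_k -> 'rV[R]_n) -> R.

Section Forms.
Variables (R : realType) (n : nat).

Definition altform k (a : form R k n) : Prop :=
  (forall v i c x y, a [eta v with i |-> c *: x + y] =
     c * a [eta v with i |-> x] + a [eta v with i |-> y]) /\
  (forall v i j, i != j -> v i = v j -> a v = 0).

Definition differential_form k (U : set 'rV[R]_n) (a : 'rV[R]_n -> form R k n) :=
  (forall x, U x -> altform (a x)) /\ (forall v, smooth_on U (fun x => a x v)).

(* Normalised so that dx_1 /\ ... /\ dx_n takes the value 1 on the standard
   frame. *)
Definition wedge k l (a : form R k n) (b : form R l n) : form R (k + l) n :=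
  fun v => (k`! * l`!)%:R^-1 *
    \sum_(s : 'S_(k + l)) (-1) ^+ s * a (fun i => v (s (lshift l i)))
                                    * b (fun j => v (s (rshift k j))).

Definition interior k (X : 'rV[R]_n) (a : form R k.+1 n) : form R k n :=
  fun v => a (fun i => if unlift ord0 i is Some j then v j else X).

Definition dcoord (i : 'I_n) : form R 1 n := fun v => v ord0 0 i.

(* Symmetric product (1/2)(a (x) b + b (x) a), as a Gram matrix. *)
Definition sym_prod (a b : form R 1 n) : 'M[R]_n :=
  \matrix_(i, j) (2^-1 *
    (a (fun=> delta_mx 0 i) * b (fun=> delta_mx 0 j) +
     b (fun=> delta_mx 0 i) * a (fun=> delta_mx 0 j))).

End Forms.

Notation "a \wedge b" := (wedge a b) (at level 39, left associativity).

Section Pullback.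
Variables (R : realType) (m n : nat) (f : 'M[R]_(m, n)).

Definition pull_form k (a : 'rV[R]_n -> form R k n) : 'rV[R]_m -> form R k m :=
  fun x v => a (x *m f) (fun i => v i *m f).

Definition pull_metric (g : 'rV[R]_n -> 'M[R]_n) : 'rV[R]_m -> 'M[R]_m :=
  fun x => f *m g (x *m f) *m f^T.

End Pullback.

(** * Pseudo-Riemannian metrics *)

Section Metrics.
Variables (R : realType) (n : nat).
Implicit Types (U : set 'rV[R]_n) (g : 'rV[R]_n -> 'M[R]_n).

Definition metric_on U g : Prop :=
  (forall i j, smooth_on U (fun x => g x i j)) /\
  (forall x, U x -> (g x)^T = g x /\ g x \in unitmx).

Definition has_signature (p q : nat) (b : 'M[R]_n) : Prop :=
  (p + q)%N = n /\ exists2 A : 'M[R]_n, A \in unitmx &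
    A *m b *m A^T = diag_mx (\row_i (if (i < p)%N then 1 else -1)).

Definition conformal_class U g : set ('rV[R]_n -> 'M[R]_n) :=
  [set h | exists2 f : 'rV[R]_n -> R, smooth_on U f &
     forall x, U x -> 0 < f x /\ h x = f x *: g x].

Definition conformal_structure (p q : nat) U (c : set ('rV[R]_n -> 'M[R]_n)) :=
  exists g, [/\ metric_on U g, forall x, U x -> has_signature p q (g x)
              & c = conformal_class U g].

(* Christoffel symbol with upper index [k]. *)
Definition christoffel g (k i j : 'I_n) : 'rV[R]_n -> R := fun x =>
  2^-1 * \sum_l invmx (g x) k l *
    (partial i (fun y => g y j l) x + partial j (fun y => g y i l) x
     - partial l (fun y => g y i j) x).

(* Levi-Civita derivative, in the direction [v], of the field with constant
   coordinates [w]. *)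
Definition levi_civita g (x v w : 'rV[R]_n) : 'rV[R]_n :=
  \row_k \sum_i \sum_j christoffel g k i j x * v 0 i * w 0 j.

Definition cov_deriv g k (a : 'rV[R]_n -> form R k n) (x v : 'rV[R]_n) :
    form R k n := fun w =>
  'D_v (fun y => a y w) x
  - \sum_i a x [eta w with i |-> levi_civita g x v (w i)].

Definition parallel_form g U k (a : 'rV[R]_n -> form R k n) : Prop :=
  forall x v w, U x -> cov_deriv g a x v w = 0.

(* [riemann g l i j k] is the [l]-component of R(d_i, d_j) d_k. *)
Definition riemann g (l i j k : 'I_n) : 'rV[R]_n -> R := fun x =>
  partial i (christoffel g l j k) x - partial j (christoffel g l i k) x
  + \sum_m (christoffel g l i m x * christoffel g m j k x
            - christoffel g l j m x * christoffel g m i k x).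

Definition ricci g : 'rV[R]_n -> 'M[R]_n := fun x =>
  \matrix_(j, k) \sum_i riemann g i i j k x.

Definition ricci_flat g U : Prop := forall x, U x -> ricci g x = 0.

Definition geodesic g (S : set R) (c : R -> 'rV[R]_n) : Prop :=
  forall s k, S s ->
    let c' := \row_i derive1 (fun r => c r 0 i) s in
    derive1n 2 (fun r => c r 0 k) s + levi_civita g (c s) c' c' 0 k = 0.

End Metrics.

(** * Ambient metrics

    A representative metric identifies the metric bundle of a conformal
    structure on [U] with R_+ x U, an open subset of ['rV_(1 + n)] with
    coordinates (t, u); the ambient coordinates (t, u, rho) live in
    ['rV_(1 + n + 1)]. *)

Section Ambient.
Variables (R : realType) (n : nat).
Implicit Types (U : set 'rV[R]_n) (y : 'rV[R]_(1 + n)) (P : 'rV[R]_(1 + n + 1)).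

Definition metric_bundle U : set 'rV[R]_(1 + n) :=
  [set y | 0 < lsubmx y 0 0 /\ U (rsubmx y)].

Definition ambient_space U : set 'rV[R]_(1 + n + 1) :=
  [set P | metric_bundle U (lsubmx P)].

Definition bundle_incl : 'M[R]_(1 + n, 1 + n + 1) := row_mx 1%:M 0.
Definition bundle_proj : 'M[R]_(1 + n, n) := col_mx 0 1%:M.
Definition ambient_proj : 'M[R]_(1 + n + 1, n) := col_mx bundle_proj 0.

Definition bundle_dil (s : R) : 'M[R]_(1 + n) := block_mx s%:M 0 0 1%:M.
Definition ambient_dil (s : R) : 'M[R]_(1 + n + 1) :=
  block_mx (bundle_dil s) 0 0 1%:M.

Definition t_coord P : R := lsubmx (lsubmx P) 0 0.
Definition rho_coord P : R := rsubmx P 0 0.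

Definition t_index : 'I_(1 + n + 1) := lshift 1 (lshift n ord0).
Definition rho_index : 'I_(1 + n + 1) := rshift (1 + n) ord0.

(* [gt], defined on [W], is an ambient metric for [c], in the coordinates
   given by the representative [g]. *)
Definition ambient_metric U (c : set ('rV[R]_n -> 'M[R]_n))
    (g : 'rV[R]_n -> 'M[R]_n) (W : set 'rV[R]_(1 + n + 1))
    (gt : 'rV[R]_(1 + n + 1) -> 'M[R]_(1 + n + 1)) : Prop :=
  c g /\
  [/\ open W, W `<=` ambient_space U,
      forall y, metric_bundle U y -> W (y *m bundle_incl)
    & forall s P, 0 < s -> W P -> W (P *m ambient_dil s)] /\
  [/\ metric_on W gt,
      forall y, metric_bundle U y -> pull_metric bundle_incl gt y =
        (lsubmx y 0 0) ^+ 2 *: pull_metric bundle_proj g y,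
      forall s P, 0 < s -> W P ->
        pull_metric (ambient_dil s) gt P = s ^+ 2 *: gt P,
      forall P, W P -> geodesic gt [set s | 0 < s] (fun s => P *m ambient_dil s)
    & forall y i j l, metric_bundle U y ->
        iter_partial l (fun P => ricci gt P i j) (y *m bundle_incl) = 0].

End Ambient.

(** * Tractor forms

    A tractor [k]-form is a field over the metric bundle of alternating
    [k]-forms on the ambient tangent spaces.  Tractor sections are the fields
    [xi] with T delta_s . xi = s xi, whence the weight in [tractor_form]. *)

Section Tractors.
Variables (R : realType) (n : nat).
Implicit Types (U : set 'rV[R]_n) (y : 'rV[R]_(1 + n)).
Implicit Types (gt : 'rV[R]_(1 + n + 1) -> 'M[R]_(1 + n + 1)).

Definition tractor_form U k (Phi : 'rV[R]_(1 + n) -> form R k (1 + n + 1)) :=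
  [/\ forall y, metric_bundle U y -> altform (Phi y),
      forall v, smooth_on (metric_bundle U) (fun y => Phi y v)
    & forall s y v, 0 < s -> metric_bundle U y ->
        Phi (y *m bundle_dil n s) (fun i => v i *m ambient_dil n s) =
        s ^+ k * Phi y v].

Definition dilation_invariant_lift U (X : 'rV[R]_n -> 'rV[R]_n)
    (Xbar : 'rV[R]_(1 + n) -> 'rV[R]_(1 + n)) : Prop :=
  [/\ smooth_vector_field (metric_bundle U) Xbar,
      forall y, metric_bundle U y -> rsubmx (Xbar y) = X (rsubmx y)
    & forall s y, 0 < s -> metric_bundle U y ->
        Xbar (y *m bundle_dil n s) = Xbar y *m bundle_dil n s].

(* Levi-Civita derivative of [gt] acting on forms along the metric bundle, in
   a direction [v] tangent to it. *)
Definition tractor_deriv gt k (Phi : 'rV[R]_(1 + n) -> form R k (1 + n + 1))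
    (y v : 'rV[R]_(1 + n)) : form R k (1 + n + 1) := fun w =>
  'D_v (fun z => Phi z w) y
  - \sum_i Phi y [eta w with i |->
      levi_civita gt (y *m bundle_incl R n) (v *m bundle_incl R n) (w i)].

Definition tractor_parallel U gt k
    (Phi : 'rV[R]_(1 + n) -> form R k (1 + n + 1)) : Prop :=
  forall X Xbar, smooth_vector_field U X -> dilation_invariant_lift U X Xbar ->
  forall y w, metric_bundle U y -> tractor_deriv gt Phi y (Xbar y) w = 0.

(* The generator T = t d_t of the dilations. *)
Definition euler y : 'rV[R]_(1 + n + 1) := row_mx (row_mx (lsubmx y) 0) 0.

(* (X, Y) |-> Phi (T, Xbar, Ybar), computed with the lifts that have no
   t-component; other lifts differ by multiples of T. *)
Definition Pi0 (Phi : 'rV[R]_(1 + n) -> form R 3 (1 + n + 1)) :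
    'rV[R]_(1 + n) -> form R 2 n := fun y v =>
  interior (euler y) (Phi y) (fun i => row_mx 0 (v i) *m bundle_incl R n).

(* Evaluation at t = 1. *)
Definition trivialization k (a : 'rV[R]_(1 + n) -> form R k n) :
    'rV[R]_n -> form R k n := fun u => a (row_mx 1%:M u).

Definition form_ker (a : form R 2 n) : set 'rV[R]_n :=
  [set v | forall w, interior v a w = 0].

End Tractors.

(** * Three-forms in dimension seven *)

Section ThreeForms.
Variable R : realType.
Implicit Types (phi : form R 3 7).

Definition coframe (A : 'M[R]_7) (a : 'I_7) : form R 1 7 :=
  fun v => (v ord0 *m A) 0 a.

Definition split_generic phi : Prop :=
  exists2 A : 'M[R]_7, A \in unitmx &
  let e k := coframe A (inord k.-1) in
  phi = (Num.sqrt 6)^-1 *: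
    (- (Num.sqrt 2 *: (e 1%N \wedge e 5%N \wedge e 6%N))
     - e 2%N \wedge e 4%N \wedge e 5%N
     - e 3%N \wedge e 4%N \wedge e 6%N
     + e 1%N \wedge e 4%N \wedge e 7%N
     - Num.sqrt 2 *: (e 2%N \wedge e 3%N \wedge e 7%N)).

(* Coefficient of a 7-form on e^1 /\ ... /\ e^7. *)
Definition top_coef (a : form R 7 7) : R := a (fun i => delta_mx 0 i).

Definition form_matrix phi : 'M[R]_7 :=
  \matrix_(i, j) top_coef
    (interior (delta_mx 0 i) phi \wedge interior (delta_mx 0 j) phi \wedge phi).

Definition generic_form phi : Prop := form_matrix phi \in unitmx.

Definition vol phi : R := get [set v : R | v ^+ 9 = \det (form_matrix phi)].

(* The bilinear form is normalised so that [vol phi] is the volume form it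
   induces (lemma [det_H] below).  This pins the constant in front of
   (X _| phi) /\ (Y _| phi) /\ phi to be 1: a constant k there multiplies the
   determinant by k ^ 7 while leaving [vol phi] unchanged.  In particular the
   constant sqrt 6 is not compatible with this definition of [vol]; it would
   turn H (Phit_ I P) = gt_ I P below into H (Phit_ I P) = sqrt 6 gt_ I P. *)
Definition H phi : 'M[R]_7 := (vol phi)^-1 *: form_matrix phi.

Lemma volE phi : vol phi ^+ 9 = \det (form_matrix phi).
Proof.
rewrite /vol; set d := \det _.
suff : [set v : R | v ^+ 9 = d] (get [set v : R | v ^+ 9 = d]) by [].
apply: (@getPex R [set v : R | v ^+ 9 = d]).
pose r := `|d| `^ (9%:R^-1).
have rE : r ^+ 9 = `|d|.
  by rewrite -powR_mulrn ?powR_ge0// -powRrM mulVf ?pnatr_eq0// powRr1.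
exists (Num.sg d * r) => /=.
rewrite exprMn rE; have [->|d0] := eqVneq d 0; first by rewrite normr0 mulr0.
by rewrite -[9%N]/(2 * 4 + 1)%N exprD exprM sqr_sg d0 expr1n mul1r -numEsg.
Qed.

Lemma det_H phi : generic_form phi -> \det (H phi) = vol phi ^+ 2.
Proof.
rewrite /generic_form unitmxE unitfE -volE expf_eq0 /= => v0.
by rewrite detZ -volE exprVn -[9%N]/(7 + 2)%N exprD mulKf// expf_neq0.
Qed.

End ThreeForms.

(** * Nurowski conformal structures *)

Section Nurowski.
Variable R : realType.
Implicit Types (U : set 'rV[R]_5) (D : 'rV[R]_5 -> set 'rV[R]_5).

(* [Phi] is a parallel tractor 3-form associated to [D]; tractors are those
   of the ambient metric [gt], whose restriction to the metric bundle is the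
   tractor metric. *)
Definition associated_tractor_form U D
    (gt : 'rV[R]_(1 + 5 + 1) -> 'M[R]_(1 + 5 + 1))
    (Phi : 'rV[R]_(1 + 5) -> form R 3 (1 + 5 + 1)) : Prop :=
  [/\ tractor_form U Phi,
      tractor_parallel U gt Phi,
      forall y, metric_bundle U y -> H (Phi y) = gt (y *m bundle_incl R 5)
    & forall y, metric_bundle U y ->
        form_ker (Pi0 Phi y) = bracket_of U D D (rsubmx y)].

(* The metrics belonging to the conformal structure of signature (2, 3) that
   admits a parallel tractor 3-form associated to [D]. *)
Definition nurowski_structure U D : set ('rV[R]_5 -> 'M[R]_5) :=
  [set h | exists c, [/\ conformal_structure 2 3 U c, c h &
     exists g W gt Phi, ambient_metric U c g W gt /\
                        associated_tractor_form U D gt Phi]].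

End Nurowski.

(** * The family of plane fields *)

Section Family.
Variables (R : realType) (J : set R) (I : R -> R).
Implicit Types (u : 'rV[R]_5) (P : 'rV[R]_(1 + 5 + 1)).

Definition ix : 'I_5 := Ordinal (isT : (0 < 5)%N).
Definition iy : 'I_5 := Ordinal (isT : (1 < 5)%N).
Definition ip : 'I_5 := Ordinal (isT : (2 < 5)%N).
Definition iq : 'I_5 := Ordinal (isT : (3 < 5)%N).
Definition iz : 'I_5 := Ordinal (isT : (4 < 5)%N).

(* J is the domain of I. *)
Definition M_ : set 'rV[R]_5 := [set u | J (u 0 ix)].

Definition I_ u : R := I (u 0 ix).
Definition I2_ u : R := derive1n 2 I (u 0 ix).

Definition F_ u : R :=
  - 2^-1 * ((u 0 iq) ^+ 2 + 10 / 3 * I_ u * (u 0 ip) ^+ 2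
            + (1 + I_ u ^+ 2 - I2_ u) * (u 0 iy) ^+ 2).

Local Notation dx := (dcoord (R := R) ix).
Local Notation dy := (dcoord (R := R) iy).
Local Notation dp := (dcoord (R := R) ip).
Local Notation dq := (dcoord (R := R) iq).
Local Notation dz := (dcoord (R := R) iz).

Definition omega1 u : form R 1 5 := dy - u 0 ip *: dx.
Definition omega2 u : form R 1 5 :=
  dz - F_ u *: dx - partial iq F_ u *: (dp - u 0 iq *: dx).
Definition omega3 u : form R 1 5 := dp - u 0 iq *: dx.
Definition omega4 u : form R 1 5 := dq.
Definition omega5 u : form R 1 5 := dx.

Definition D_ u : set 'rV[R]_5 :=
  [set v | [/\ omega1 u (fun=> v) = 0, omega2 u (fun=> v) = 0
             & omega3 u (fun=> v) = 0]].

Definition g_ u : 'M[R]_5 :=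
  - (3 * I_ u) *: sym_prod (omega1 u) (omega1 u)
  + 3 *: sym_prod (omega1 u) (omega4 u)
  - (10 * I_ u * u 0 ip) *: sym_prod (omega1 u) (omega5 u)
  - 3 *: sym_prod (omega2 u) (omega5 u)
  - 2 *: sym_prod (omega3 u) (omega3 u).

Definition dt : form R 1 (1 + 5 + 1) := dcoord (t_index 5).
Definition drho : form R 1 (1 + 5 + 1) := dcoord (rho_index 5).

Definition gt_ P : 'M[R]_(1 + 5 + 1) :=
  let t := t_coord P in let rho := rho_coord P in
  (2 * rho) *: sym_prod dt dt + (2 * t) *: sym_prod dt drho
  + t ^+ 2 *: pull_metric (ambient_proj R 5)
      (fun u => g_ u - (2 / 3 * rho * I_ u) *: sym_prod dx dx) P.

Definition C_ : R := 2 `^ (- (5 / 6)) * 3 `^ (- (1 / 3)).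

Definition Phit_ P : form R 3 (1 + 5 + 1) :=
  let t := t_coord P in let rho := rho_coord P in
  let u := P *m ambient_proj R 5 in
  let Iu := I_ u in let p := u 0 ip in
  let w1 := pull_form (ambient_proj R 5) omega1 P in
  let w2 := pull_form (ambient_proj R 5) omega2 P in
  let w3 := pull_form (ambient_proj R 5) omega3 P in
  let w4 := pull_form (ambient_proj R 5) omega4 P in
  let w5 := pull_form (ambient_proj R 5) omega5 P in
  C_ *: (- (9 * t ^+ 2) *: (dt \wedge w1 \wedge w2)
         - (2 * t ^+ 2) *: (dt \wedge w3 \wedge drho)
         - (3 * t ^+ 3) *: (w1 \wedge w3 \wedge w4)
         + (10 * t ^+ 3 * Iu * p) *: (w1 \wedge w3 \wedge w5)
         - (t ^+ 3 * Iu) *: (w1 \wedge w5 \wedge drho)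
         + (3 * t ^+ 3) *: (w2 \wedge w3 \wedge w5)
         + t ^+ 3 *: (w4 \wedge w5 \wedge drho)
         + rho *: (- (3 * t ^+ 2 * Iu) *: (dt \wedge w1 \wedge w5)
                   + t ^+ 2 *: (dt \wedge w4 \wedge w5))).

(* Restriction of the previous form to the metric bundle {rho = 0}. *)
Definition Phi_ (y : 'rV[R]_(1 + 5)) : form R 3 (1 + 5 + 1) :=
  Phit_ (y *m bundle_incl R 5).

End Family.

(* Main.v *)
Require Import Defs.
From HB Require Import structures.
From mathcomp Require Import all_boot all_order all_algebra perm.
From mathcomp Require Import all_classical all_reals all_analysis.
From mathcomp Require Import ssrZ ring.
From Stdlib Require QArith_base Qreduction.

Set Implicit Arguments.
Unset Strict Implicit.
Unset Printing Implicit Defensive.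

Import Order.TTheory GRing.Theory Num.Theory.
Import numFieldNormedType.Exports.

Local Open Scope classical_set_scope.
Local Open Scope ring_scope.

(** Everything rests on one observation: in the coordinates
    (t, x, y, p, q, z, rho), the coefficients of [gt_], of its inverse and of
    [Phit_] are polynomials with rational coefficients in t, 1/t, the other
    coordinates, and the jets I, I', I'', ... at x.  This ring is stable under
    partial derivatives, so the tensors are smooth, and their Christoffel
    symbols, curvature and covariant derivatives lie in it again.  Each tensor
    identity of the proposition is therefore an identity between explicit
    polynomials, which a normal form decides.  [spoly], [pder] and
    [is_derive_jet_env] set up the ring and its derivations, and [gt_eval] and
    [Phit_eval] place the two tensors in it.  Ricci-flatness ([ricci_gt]) and
    parallelism ([Phit_parallel]) are then computations.

    For H, the wedge products are signed sums over permutations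
    ([wedge_wedgeE], [sum_perm_seq]), and these evaluate to
    (X _| Phit) /\ (Y _| Phit) /\ Phit = 54 C^3 t^6 gt(X, Y)
    ([form_matrix_Phit]).  On the other hand det gt = (81/8) t^12, and
    C^6 = 1/288 turns this into (54 C^3 t^6)^2 ([det_gt]).  Hence
    vol^9 = (54 C^3 t^6)^9, so vol = 54 C^3 t^6 and H(Phit) = gt.

    Put W2 = w2 + (2/9) rho I w5 and W4 = w4 - I w1 - (10/3) I p w5.  Then
    Phit = C (- 9 t^2 dt w1 W2 - 2 t dt w3 d(t rho) - 3 t^3 w1 w3 W4
              + t^2 W4 w5 d(t rho) + 3 t^3 W2 w3 w5)
    is a sum of five decomposable forms with the incidence pattern of the
    split-generic model, and rescaling the seven covectors gives the model
    itself ([split_generic_Phit]).  The same covectors diagonalise the metric: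
    g = 3 w1 W4 - 3 w2 w5 - 2 w3^2 at rho = 0, which has signature (2, 3)
    ([g_signature]).

    For the plane field, [D, D] = ker (w1, w2).  Sections of D are arbitrary
    smooth fields, so one inclusion needs that the derivative of a smooth
    function along a vector is the combination of its partial derivatives
    ([is_derive_smooth], by the mean value theorem); the other inclusion and
    the genericity of D come from explicit brackets ([bracket_D],
    [D_generic]).  Contracting Phit with the Euler field along rho = 0 leaves
    - 9 C t^3 w1 w2 ([Pi0_Phi]), whose kernel is [D, D].  The tractor derivative
    is the Levi-Civita derivative along {rho = 0}, so the restriction Phi of
    Phit is parallel; it is the tractor form associated to D, and g belongs to
    the Nurowski structure ([Phi_associated], [g_nurowski]). *)

(** * Sparse polynomials with rational coefficients *)

Local Notation Q := QArith_base.Q.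
Local Notation Qmake := QArith_base.Qmake.
Local Notation Qnum := QArith_base.Qnum.
Local Notation Qden := QArith_base.Qden.
Local Notation Qplus := QArith_base.Qplus.
Local Notation Qmult := QArith_base.Qmult.
Local Notation Qopp := QArith_base.Qopp.
Local Notation Qred := Qreduction.Qred.
Local Notation Qone := (Qmake (BinNums.Zpos BinNums.xH) BinNums.xH).

Arguments Qreduction.Qred : simpl never.
Arguments QArith_base.Qplus : simpl never.
Arguments QArith_base.Qmult : simpl never.
Arguments QArith_base.Qopp : simpl never.

Lemma Q_comparable : comparable Q.
Proof. by move=> c d; rewrite /decidable; repeat decide equality. Qed.
HB.instance Definition _ := hasDecEq.Build Q (compareP Q_comparable).

(** A list of terms (coefficient, monomial), a monomial being the sorted list of
    its variables repeated with multiplicity. *)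
Definition spoly := seq (Q * seq nat).

(** Variables 0 and 1 stand for t and 1/t, so they cancel. *)
Definition mono_ins (k : nat) (m : seq nat) : seq nat :=
  if (k < 2)%N && ((1 - k)%N \in m) then rem (1 - k)%N m
  else merge leq [:: k] m.

Definition mono_mul (m m' : seq nat) : seq nat := foldr mono_ins m' m.

Fixpoint mono_le (m m' : seq nat) : bool :=
  match m, m' with
  | [::], _ => true
  | _, [::] => false
  | k :: m1, k' :: m1' => (k < k')%N || ((k == k') && mono_le m1 m1')
  end.

Definition pterm (c : Q) (m : seq nat) (p : spoly) : spoly :=
  if Qnum c is BinNums.Z0 then p else (c, m) :: p.

Fixpoint collapse (c : Q) (m : seq nat) (p : spoly) : spoly :=
  match p with
  | [::] => pterm c m [::]
  | (c', m') :: p' =>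
      if m == m' then collapse (Qred (Qplus c c')) m p'
      else pterm c m (collapse c' m' p')
  end.

(** Only the soundness of this normal form is used: a polynomial with normal
    form [::] evaluates to 0. *)
Definition pnorm (p : spoly) : spoly :=
  match sort (fun a b => mono_le a.2 b.2) p with
  | [::] => [::]
  | (c, m) :: p' => collapse c m p'
  end.

Definition pcst (c : Q) : spoly := pterm c [::] [::].
Definition pfrac (n d : nat) : spoly :=
  pcst (Qred (Qmake (BinInt.Z.of_nat n) (BinPos.Pos.of_nat d))).
Definition pnat (n : nat) : spoly := pfrac n 1.
Definition pvar (k : nat) : spoly := [:: (Qone, [:: k])].

(** [catrev] keeps sums and products apart for unification, as both are
    [pnorm] of a list that could otherwise reduce to a concatenation. *)
Definition padd (p q : spoly) : spoly := pnorm (catrev p q).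
Definition psum (s : seq spoly) : spoly := pnorm (flatten s).
Definition pmul (p q : spoly) : spoly :=
  pnorm [seq (Qred (Qmult a.1 b.1), mono_mul a.2 b.2) | a <- p, b <- q].
Definition popp (p : spoly) : spoly := [seq (Qopp a.1, a.2) | a <- p].

Declare Scope spoly_scope.
Delimit Scope spoly_scope with S.
Bind Scope spoly_scope with spoly.
Notation "p + q" := (padd p q) : spoly_scope.
Notation "p * q" := (pmul p q) : spoly_scope.
Notation "- p" := (popp p) : spoly_scope.
Notation "p - q" := (padd p (popp q)) : spoly_scope.

Arguments pfrac : simpl never.
Arguments pvar : simpl never.
Arguments padd : simpl never.
Arguments psum : simpl never.
Arguments pmul : simpl never.
Arguments popp : simpl never.

Section Evaluation.
Variables (R : numFieldType) (env : nat -> R).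

Definition zeval (n : BinNums.Z) : R := (int_of_Z n)%:~R.
Definition qeval (c : Q) : R := zeval (Qnum c) / zeval (BinNums.Zpos (Qden c)).
Definition mono_eval (m : seq nat) : R := \prod_(k <- m) env k.
Definition peval (p : spoly) : R := \sum_(a <- p) qeval a.1 * mono_eval a.2.

Lemma zevalD m n : zeval (BinInt.Z.add m n) = zeval m + zeval n.
Proof. by rewrite /zeval -intrD -rmorphD. Qed.

Lemma zevalM m n : zeval (BinInt.Z.mul m n) = zeval m * zeval n.
Proof. by rewrite /zeval -intrM -rmorphM. Qed.

Lemma zevalN n : zeval (BinInt.Z.opp n) = - zeval n.
Proof. by rewrite /zeval -intrN -rmorphN. Qed.

Lemma zeval_pos d : zeval (BinNums.Zpos d) = (BinPos.Pos.to_nat d)%:R.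
Proof. by []. Qed.

Lemma zeval_neq0 d : zeval (BinNums.Zpos d) != 0.
Proof.
by rewrite zeval_pos pnatr_eq0; case: (Pnat.Pos2Nat.is_succ d) => n ->.
Qed.

Lemma qevalD c d : qeval (Qplus c d) = qeval c + qeval d.
Proof.
case: c d => [a b] [c d]; rewrite /qeval addf_div ?zeval_neq0//.
by rewrite -!zevalM -zevalD.
Qed.

Lemma qevalM c d : qeval (Qmult c d) = qeval c * qeval d.
Proof. by case: c d => [a b] [c d]; rewrite /qeval mulf_div -!zevalM. Qed.

Lemma qevalN c : qeval (Qopp c) = - qeval c.
Proof. by case: c => [a b]; rewrite /qeval zevalN mulNr. Qed.

Lemma qeval_red c : qeval (Qred c) = qeval c.
Proof.
rewrite /qeval; apply/eqP; rewrite eqr_div ?zeval_neq0//; apply/eqP.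
by have := Qreduction.Qred_correct c; rewrite /QArith_base.Qeq -!zevalM => ->.
Qed.

Lemma peval_nil : peval [::] = 0. Proof. exact: big_nil. Qed.

Lemma peval_cons a p : peval (a :: p) = qeval a.1 * mono_eval a.2 + peval p.
Proof. exact: big_cons. Qed.

Lemma peval_cat p q : peval (p ++ q) = peval p + peval q.
Proof. exact: big_cat. Qed.

Lemma peval_term c m p : peval (pterm c m p) = qeval c * mono_eval m + peval p.
Proof.
case: c => [[|a|a] b]; rewrite /pterm /= ?peval_cons//.
by rewrite /qeval /zeval /= !mul0r add0r.
Qed.

Lemma peval_collapse c m p :
  peval (collapse c m p) = qeval c * mono_eval m + peval p.
Proof.
elim: p c m => [|[c' m'] p IH] c m /=; first by rewrite peval_term.
rewrite peval_cons /=; have [<-|_] := eqVneq m m'.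
  by rewrite IH qeval_red qevalD mulrDl addrA.
by rewrite peval_term IH.
Qed.

Lemma peval_norm p : peval (pnorm p) = peval p.
Proof.
rewrite /pnorm; set le := fun a b => _.
have -> : peval p = peval (sort le p).
  by rewrite /peval; apply: perm_big; rewrite perm_sym; apply/permPl/perm_sort.
by case: (sort le p) => [//|[c m] p']; rewrite peval_collapse peval_cons.
Qed.

Lemma pevalD p q : peval (p + q)%S = peval p + peval q.
Proof.
rewrite peval_norm catrevE peval_cat; congr (_ + _).
by apply: perm_big; rewrite perm_rev.
Qed.

Lemma peval_sum s : peval (psum s) = \sum_(p <- s) peval p.
Proof.
rewrite peval_norm; elim: s => [|p s IH]; first by rewrite big_nil peval_nil.
by rewrite /= peval_cat IH big_cons.
Qed.

Lemma pevalN p : peval (- p)%S = - peval p.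
Proof.
rewrite /peval big_map -sumrN; apply: eq_bigr => a _ /=.
by rewrite qevalN mulNr.
Qed.

Lemma peval_cst c : peval (pcst c) = qeval c.
Proof. by rewrite peval_term /mono_eval big_nil mulr1 peval_nil addr0. Qed.

Lemma qeval1 : qeval Qone = 1. Proof. by rewrite /qeval /= divff ?oner_eq0. Qed.

Lemma peval_frac n d : (0 < d)%N -> peval (pfrac n d) = n%:R / d%:R.
Proof.
move=> d0; rewrite peval_cst qeval_red /qeval zeval_pos /zeval /=.
rewrite Pnat.Nat2Pos.id; last by case: d d0.
by case: n => [|n] /=; rewrite ?mul0r// Pnat.SuccNat2Pos.id_succ.
Qed.

Lemma peval_nat n : peval (pnat n) = n%:R.
Proof. by rewrite peval_frac// divr1. Qed.

Lemma peval_var k : peval (pvar k) = env k.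
Proof.
by rewrite peval_cons /mono_eval big_seq1 peval_nil addr0 qeval1 mul1r.
Qed.

Hypothesis env01 : env 0%N * env 1%N = 1.

Lemma mono_eval_ins k m : mono_eval (mono_ins k m) = env k * mono_eval m.
Proof.
rewrite /mono_ins; case: ifP => [/andP[k2 km]|_].
  rewrite /mono_eval [in RHS](perm_big _ (perm_to_rem km)) big_cons mulrA.
  case: k k2 km => [|[|//]] _ _ /=; first by rewrite env01 mul1r.
  by rewrite subnn [env 1%N * _]mulrC env01 mul1r.
have pm : perm_eq (merge leq [:: k] m) ([:: k] ++ m) by apply/permPl/perm_merge.
by rewrite /mono_eval (perm_big _ pm) big_cons.
Qed.

Lemma mono_evalM m m' : mono_eval (mono_mul m m') = mono_eval m * mono_eval m'.
Proof.
elim: m => [|k m IH] /=; first by rewrite /mono_eval big_nil mul1r.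
by rewrite mono_eval_ins IH mulrA /mono_eval big_cons.
Qed.

Lemma pevalM p q : peval (p * q)%S = peval p * peval q.
Proof.
rewrite peval_norm /peval big_allpairs_dep big_distrlr /=.
apply: eq_bigr => a _; apply: eq_bigr => b _.
by rewrite qeval_red qevalM mono_evalM mulrACA.
Qed.

End Evaluation.

Section Derivation.
Variable dv : nat -> spoly.

Fixpoint mono_der (m : seq nat) : spoly :=
  if m is k :: m' then
    (dv k * [:: (Qone, m')] + pvar k * mono_der m')%S
  else [::].

Definition pder (p : spoly) : spoly :=
  psum [seq (pcst a.1 * mono_der a.2)%S | a <- p].

Variables (R : realType) (V : normedModType R) (ev : V -> nat -> R) (x v : V).
Hypothesis ev01 : ev x 0%N * ev x 1%N = 1.
Hypothesis dvP : forall k, is_derive x v (ev^~ k) (peval (ev x) (dv k)).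

Lemma is_derive_mono m :
  is_derive x v (fun y => mono_eval (ev y) m) (peval (ev x) (mono_der m)).
Proof.
elim: m => [|k m IH] /=.
  rewrite peval_nil [X in is_derive _ _ X](_ : _ = cst 1); first exact: is_derive_cst.
  by apply/funext => y; rewrite /mono_eval big_nil.
rewrite [X in is_derive _ _ X](_ : _ = ev^~ k * (fun y => mono_eval (ev y) m)).
  apply: is_derive_eq; rewrite pevalD !pevalM// peval_var peval_cons peval_nil.
  by rewrite qeval1 mul1r addr0 addrC; congr (_ + _); exact: mulrC.
by apply/funext => y; rewrite /mono_eval big_cons.
Qed.

Lemma is_derive_peval p :
  is_derive x v (fun y => peval (ev y) p) (peval (ev x) (pder p)).
Proof.
rewrite /pder peval_sum big_map.
elim: p => [|a p IH].
  rewrite big_nil [X in is_derive _ _ X](_ : _ = cst 0); first exact: is_derive_cst.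
  by apply/funext => y; rewrite peval_nil.
rewrite big_cons pevalM// peval_cst.
rewrite [X in is_derive _ _ X](_ : _ =
  (qeval R a.1 *: (fun y => mono_eval (ev y) a.2)) + (fun y => peval (ev y) p)).
  apply: is_deriveD; apply: is_deriveZ; exact: is_derive_mono.
by apply/funext => y; rewrite peval_cons.
Qed.

End Derivation.

Lemma continuous_peval (R : realType) (V : normedModType R) (ev : V -> nat -> R)
    (x : V) (p : spoly) :
  (forall k, {for x, continuous (ev^~ k)}) ->
  {for x, continuous (fun y => peval (ev y) p)}.
Proof.
move=> evc; rewrite /prop_for /continuous_at; elim: p => [|a p IH].
  rewrite peval_nil; under eq_fun do rewrite peval_nil; exact: cvg_cst.
rewrite peval_cons; under eq_fun do rewrite peval_cons.
apply: cvgD => //; apply: cvgM; first exact: cvg_cst.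
rewrite /mono_eval; elim: (a.2) => [|k m IHm].
  rewrite big_nil; under eq_fun do rewrite big_nil; exact: cvg_cst.
rewrite big_cons; under eq_fun do rewrite big_cons.
by apply: cvgM => //; exact: evc.
Qed.

(** * Smoothness and affine maps *)

(** A directional derivative sees its function on a line only, so precomposing
    with a map that is affine on that line commutes with it, whether or not the
    limit exists. *)
Lemma derive_along_line (R : realType) (V V' : normedModType R) (L : V -> V')
    (F : V' -> R) (x v : V) (w : V') :
  (forall h, L (h *: v + x) = h *: w + L x) ->
  'D_v (F \o L) x = 'D_w F (L x) /\
  (derivable F (L x) w -> derivable (F \o L) x v).
Proof.
move=> Lh; rewrite /derive /derivable.
suff -> : (fun h => h^-1 *: ((F \o L \o shift x) (h *: v) - (F \o L) x)) =
          (fun h => h^-1 *: ((F \o shift (L x)) (h *: w) - F (L x))) by [].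
by apply/funext => h /=; rewrite Lh.
Qed.

Section AffineMaps.
Variables (R : realType) (m n : nat) (b : 'rV[R]_n) (f : 'M[R]_(m, n)).

Definition affine (x : 'rV[R]_m) : 'rV[R]_n := b + x *m f.

Lemma affine_line x v h : affine (h *: v + x) = h *: (v *m f) + affine x.
Proof. by rewrite /affine mulmxDl -scalemxAl addrCA. Qed.

Lemma derive_affine (F : 'rV[R]_n -> R) x v :
  'D_v (F \o affine) x = 'D_(v *m f) F (affine x).
Proof. exact: (derive_along_line F (affine_line x v)).1. Qed.

Lemma derivable_affine (F : 'rV[R]_n -> R) x v :
  derivable F (affine x) (v *m f) -> derivable (F \o affine) x v.
Proof. exact: (derive_along_line F (affine_line x v)).2. Qed.

Lemma continuous_affine : continuous affine.
Proof.
move=> x; apply/(@cvgrPdist_lt _ _ _ (nbhs x) (nbhs_filter x)) => e e0.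
have M0 : 0 < 1 + \sum_i \sum_j `|f i j|.
  by rewrite ltr_pwDl// sumr_ge0// => i _; rewrite sumr_ge0.
near=> y.
rewrite /affine opprD addrACA subrr add0r -mulmxBl.
rewrite [ltLHS]/Num.Def.normr/= mx_normrE.
apply: (@le_lt_trans _ _ (`|x - y| * (1 + \sum_i \sum_j `|f i j|))); last first.
  rewrite -ltr_pdivlMr//; near: y.
  have /cvgrPdist_lt : id y @[y --> x] --> x by exact: cvg_id.
  by apply; exact: divr_gt0.
apply: bigmax_le => [|[i j] _ /=]; first by rewrite mulr_ge0// ltW.
rewrite mxE (le_trans (ler_norm_sum _ _ _))// mulrDr mulr1 mulr_sumr.
rewrite -[leLHS]add0r lerD// ler_sum// => k _.
rewrite normrM ler_pM//; last by rewrite (bigD1 j)//= lerDl sumr_ge0.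
rewrite [leRHS]/Num.Def.normr/= mx_normrE.
exact: (le_bigmax _ (fun ij => `|(x - y) ij.1 ij.2|) (i, k)).
Unshelve. all: by end_near. Qed.

Variable sigma : 'I_m -> 'I_n.
Hypothesis f_delta : forall i, row i f = delta_mx 0 (sigma i).

Lemma delta_affine i : (delta_mx 0 i : 'rV[R]_m) *m f = delta_mx 0 (sigma i).
Proof. by rewrite -rowE. Qed.

Lemma iter_partial_affine s (F : 'rV[R]_n -> R) :
  iter_partial s (F \o affine) = iter_partial (map sigma s) F \o affine.
Proof.
elim: s => [//|i s IH] /=; rewrite IH; apply/funext => x.
by rewrite /partial /= derive_affine delta_affine.
Qed.

(** An affine map that sends coordinate lines to coordinate lines pulls partial
    derivatives back to partial derivatives.  The inclusions of the base and of
    the metric bundle in the ambient space are of this kind. *)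
Lemma smooth_on_affine (W : set 'rV[R]_n) F :
  smooth_on W F -> smooth_on (affine @^-1` W) (F \o affine).
Proof.
move=> Fs s x Wx; have [Fc Fd] := Fs (map sigma s) _ Wx.
rewrite iter_partial_affine; split=> [|i]; last first.
  by apply: derivable_affine; rewrite delta_affine.
by apply: continuous_comp; [exact: continuous_affine | exact: Fc].
Qed.

End AffineMaps.

Section SmoothOn.
Variables (R : realType) (n : nat) (W : set 'rV[R]_n) (W_open : open W).

Lemma near_open x (P : 'rV[R]_n -> Prop) :
  W x -> (forall y, W y -> P y) -> \forall y \near x, P y.
Proof. by move=> Wx WP; apply: filterS WP _; exact: open_nbhs_nbhs. Qed.

Lemma eq_iter_partial (F G : 'rV[R]_n -> R) s :
  (forall x, W x -> F x = G x) ->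
  forall x, W x -> iter_partial s F x = iter_partial s G x.
Proof.
move=> FG; elim: s => [//|i s IH] x Wx /=.
by rewrite /partial; exact: near_eq_derive (near_open Wx IH).
Qed.

Lemma eq_smooth_on (F G : 'rV[R]_n -> R) :
  (forall x, W x -> F x = G x) -> smooth_on W F -> smooth_on W G.
Proof.
move=> FG Fs s x Wx; have [Fc Fd] := Fs s x Wx.
have E y : W y -> iter_partial s F y = iter_partial s G y.
  exact: eq_iter_partial.
split=> [|i]; last exact: near_eq_derivable (near_open Wx E) (Fd i).
rewrite /prop_for /continuous_at -E//.
by apply: cvg_trans Fc; exact: near_eq_cvg (near_open Wx E).
Qed.

Variables (ev : 'rV[R]_n -> nat -> R) (dv : 'I_n -> nat -> spoly).
Hypothesis ev01 : forall x, W x -> ev x 0%N * ev x 1%N = 1.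
Hypothesis ev_cont : forall x k, W x -> {for x, continuous (ev^~ k)}.
Hypothesis dvP : forall x i k, W x ->
  is_derive x (delta_mx 0 i) (ev^~ k) (peval (ev x) (dv i k)).

Lemma iter_partial_peval s p x : W x ->
  iter_partial s (fun y => peval (ev y) p) x =
  peval (ev x) (foldr (fun i => pder (dv i)) p s).
Proof.
elim: s x => [//|i s IH] x Wx /=; rewrite /partial.
rewrite (near_eq_derive _ (near_open Wx IH)).
by have /@derive_val := is_derive_peval (ev01 Wx) (fun k => dvP i k Wx)
  (foldr (fun i => pder (dv i)) p s).
Qed.

(** All iterated partial derivatives of a polynomial in functions with
    polynomial derivatives are again such polynomials, hence continuous and
    derivable. *)
Lemma smooth_on_peval p : smooth_on W (fun x => peval (ev x) p).
Proof.
move=> s x Wx; set q := foldr (fun i => pder (dv i)) p s.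
have E y : W y -> peval (ev y) q = iter_partial s (fun y => peval (ev y) p) y.
  by move=> Wy; rewrite iter_partial_peval.
split=> [|i].
  rewrite /prop_for /continuous_at -E//.
  have C : peval (ev y) q @[y --> x] --> peval (ev x) q.
    by have := continuous_peval (p := q) (fun k => @ev_cont x k Wx).
  apply: cvg_trans C.
  exact: near_eq_cvg (near_open Wx E).
apply: near_eq_derivable (near_open Wx E) _.
by have /@ex_derive := is_derive_peval (ev01 Wx) (fun k => dvP i k Wx) q.
Qed.

End SmoothOn.

(** * Polynomials in the coordinates and the jets of a function *)

(** Values of the variables at the point P = (t, x, y, p, q, z, rho): 0 is t and
    1 is 1/t; 2 to 7 are x, y, p, q, z, rho; 8 + 2j is the j-th derivative of I
    at x; 9 + 2j is the constant [par j]. *)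
Definition jet_env (R : realType) (I : R -> R) (par : nat -> R) (P : 'rV[R]_7)
    (k : nat) : R :=
  match k with
  | 0 => P 0 (inord 0)
  | 1 => (P 0 (inord 0))^-1
  | k'.+2 =>
      if (k' < 6)%N then P 0 (inord k'.+1)
      else if odd k' then par (k' - 6)./2
      else derive1n (k' - 6)./2 I (P 0 (inord 1))
  end.

Definition vt := pvar 0.
Definition vtinv := pvar 1.
Definition vy := pvar 3.
Definition vp := pvar 4.
Definition vq := pvar 5.
Definition vrho := pvar 7.
Definition vjet (j : nat) := pvar (8 + j.*2).
Definition vpar (j : nat) := pvar (9 + j.*2).

(** Derivatives of the variables along the vector with components V. *)
Definition jet_der (V : nat -> spoly) (k : nat) : spoly :=
  match k with
  | 0 => V 0%N
  | 1 => (- (vtinv * vtinv * V 0%N))%S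
  | k'.+2 =>
      if (k' < 6)%N then V k'.+1
      else if odd k' then [::]
      else (pvar (k'.+2).+2 * V 1%N)%S
  end.

Section Jets.
Variables (R : realType) (J : set R) (I : R -> R).
Hypotheses (J_open : open J) (I_smooth : smooth_function J I).

Definition jet_domain : set 'rV[R]_7 :=
  [set P | 0 < P 0 (inord 0) /\ J (P 0 (inord 1))].

Lemma open_jet_domain : open jet_domain.
Proof.
apply: openI.
  apply: (@open_comp _ _ (fun P : 'rV[R]_7 => P 0 (inord 0)) [set y | 0 < y]).
    by move=> P _; exact: coord_continuous.
  exact: open_gt.
apply: (@open_comp _ _ (fun P : 'rV[R]_7 => P 0 (inord 1)) J) => // P _.
exact: coord_continuous.
Qed.

Variable par : nat -> R.
Let env := jet_env I par.

Lemma jet_env01 P : jet_domain P -> env P 0%N * env P 1%N = 1.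
Proof. by case=> t0 _; rewrite /env /= mulfV// gt_eqF. Qed.

Lemma jet_env_jet P j : env P (8 + j.*2)%N = derive1n j I (P 0 (inord 1)).
Proof.
rewrite /env -[(8 + j.*2)%N]/(6 + j.*2).+2 /jet_env ltnNge leq_addr.
by rewrite oddD odd_double addKn doubleK.
Qed.

Lemma jet_env_par P j : env P (9 + j.*2)%N = par j.
Proof.
rewrite /env -[(9 + j.*2)%N]/(6 + j.*2.+1).+2 /jet_env ltnNge leq_addr.
by rewrite oddD (oddS j.*2) odd_double addKn -[_.+1./2]/(uphalf _) uphalf_double.
Qed.

Lemma is_derive_coord n (P v : 'rV[R]_n) i :
  is_derive P v (fun P : 'rV[R]_n => P 0 i) (v 0 i).
Proof.
have Did : derivable (@id 'rV[R]_n) P v by exact: derivable_id.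
apply: DeriveDef; first by have /derivable_mxP := Did; apply.
by have := derive_mx Did; rewrite derive_id => /rowP/(_ i); rewrite mxE.
Qed.

Lemma is_derive_comp_coord n (h : R -> R) (P v : 'rV[R]_n) i :
  derivable h (P 0 i) 1 ->
  is_derive P v (fun P : 'rV[R]_n => h (P 0 i)) (derive1 h (P 0 i) * v 0 i).
Proof.
move=> hd; have hdiff : differentiable h (P 0 i) by apply/derivable1_diffP.
have line c : (c *: v + P) 0 i = c *: v 0 i + P 0 i by rewrite !mxE.
have [D d] := derive_along_line h (L := fun P : 'rV[R]_n => P 0 i) line.
apply: DeriveDef; first by apply: d; exact: diff_derivable.
rewrite [LHS]D deriveE// derive1E deriveE//.
have {1}-> : v 0 i = v 0 i *: (1 : R^o) by rewrite [RHS]mulr1.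
by rewrite linearZ mulrC.
Qed.

Lemma is_derive_jet_env (V : nat -> spoly) (P v : 'rV[R]_7) : jet_domain P ->
  (forall j, (j < 7)%N -> v 0 (inord j) = peval (env P) (V j)) ->
  forall k, is_derive P v (env^~ k) (peval (env P) (jet_der V k)).
Proof.
move=> WP vV [|[|k]] /=.
- by rewrite -vV//; exact: is_derive_coord.
- rewrite pevalN !pevalM ?jet_env01// !peval_var -vV//.
  have [t0 _] := WP; have /lt0r_neq0 t1 := t0.
  have [Cd Cv] := is_derive_coord P v (inord 0).
  apply: DeriveDef; first exact: derivableV.
  by rewrite deriveV// Cv scaleNr -exprVn expr2.
- case: ifP => k6; first by rewrite -vV; [exact: is_derive_coord|].
  case: ifP => [ok|/negbT ek].
    by rewrite peval_nil; exact: is_derive_cst.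
  move: k6 ek => /negbT; rewrite -leqNgt => /subnKC <- ek.
  rewrite pevalM ?jet_env01// peval_var -vV//.
  have -> : env P (6 + (k - 6)).+4 =
      derive1n (k - 6)./2.+1 I (P 0 (inord 1)).
    rewrite /env -[(_ + _).+4]/(6 + (k - 6).+2).+2 /jet_env ltnNge leq_addr.
    by rewrite addKn; move: ek; rewrite !oddD /= !negbK => /negbTE ->.
  rewrite addKn.
  apply: (is_derive_comp_coord (h := derive1n (k - 6)./2 I)).
  by apply: I_smooth; have [] := WP.
Qed.

Lemma continuous_jet_env P k : jet_domain P -> {for P, continuous (env^~ k)}.
Proof.
move=> WP; case: k => [|[|k]].
- exact: coord_continuous.
- have [/lt0r_neq0 t0 _] := WP.
  exact: (cvgV t0 (@coord_continuous _ _ _ 0 (inord 0) P)).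
- rewrite [env^~ _](_ : _ = if (k < 6)%N then fun Q : 'rV[R]_7 => Q 0 (inord k.+1) else
      if odd k then fun=> par (k - 6)./2
      else derive1n (k - 6)./2 I \o (fun Q : 'rV[R]_7 => Q 0 (inord 1))).
    case: ifP => _; first exact: coord_continuous.
    case: ifP => _; first exact: cst_continuous.
    apply: continuous_comp; first exact: coord_continuous.
    apply: differentiable_continuous; apply/derivable1_diffP.
    by apply: I_smooth; have [] := WP.
  by apply/funext => Q; rewrite /env /=; case: ifP => // _; case: ifP.
Qed.

Lemma derive_jet (V : nat -> spoly) (P v : 'rV[R]_7) p : jet_domain P ->
  (forall j, (j < 7)%N -> v 0 (inord j) = peval (env P) (V j)) ->
  is_derive P v (fun P => peval (env P) p) (peval (env P) (pder (jet_der V) p)).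
Proof.
move=> WP vV; apply: is_derive_peval; first exact: jet_env01.
exact: is_derive_jet_env.
Qed.

Definition pdelta (i j : nat) : spoly := if i == j then pnat 1 else [::].

Lemma peval_delta e i j : peval (R := R) e (pdelta i j) = (i == j)%:R.
Proof. by rewrite /pdelta; case: eqP; rewrite ?peval_nat ?peval_nil. Qed.

Definition pd (i : nat) : spoly -> spoly := pder (jet_der (pdelta i)).

Lemma delta_jet P (i : 'I_7) j : (j < 7)%N ->
  (delta_mx 0 i : 'rV[R]_7) 0 (inord j) = peval (env P) (pdelta i j).
Proof.
by move=> j7; rewrite peval_delta mxE eqxx -val_eqE /= inordK// eq_sym.
Qed.

Lemma partial_jet (F : 'rV[R]_7 -> R) p (i : 'I_7) :
  (forall P, jet_domain P -> F P = peval (env P) p) ->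
  forall P, jet_domain P -> partial i F P = peval (env P) (pd i p).
Proof.
move=> Fp P WP; rewrite /partial.
rewrite (near_eq_derive _ (near_open open_jet_domain WP Fp)).
by have /@derive_val := derive_jet p WP (delta_jet P i).
Qed.

Lemma smooth_jet (F : 'rV[R]_7 -> R) p :
  (forall P, jet_domain P -> F P = peval (env P) p) -> smooth_on jet_domain F.
Proof.
move=> Fp; apply: (eq_smooth_on open_jet_domain (fun P WP => esym (Fp P WP))).
apply: (smooth_on_peval open_jet_domain (dv := fun i => jet_der (pdelta i))).
- exact: jet_env01.
- by move=> P k WP; exact: continuous_jet_env.
- by move=> P i k WP; apply: is_derive_jet_env => // j; exact: delta_jet.
Qed.

End Jets.

(** * Sums over permutations and wedge products *)

(** All arrangements of a list with their signs, by choice of the first entry. *)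
Fixpoint sperms (n : nat) (l : seq nat) : seq (bool * seq nat) :=
  if n is n'.+1 then
    flatten [seq [seq (odd k (+) a.1, nth 0%N l k :: a.2)
                 | a <- sperms n' (take k l ++ drop k.+1 l)] | k <- iota 0 n]
  else [:: (false, [::])].

Lemma spermsS n l : sperms n.+1 l =
  flatten [seq [seq (odd k (+) a.1, nth 0%N l k :: a.2)
               | a <- sperms n (take k l ++ drop k.+1 l)] | k <- index_iota 0 n.+1].
Proof. by []. Qed.

(** Every permutation of n + 1 indices is [lift_perm ord0 k t] for a unique image
    k of the first index and permutation t of the others, with sign
    (-1)^k sign(t). *)
Lemma sum_sperms (R : pzRingType) n (l : seq nat) (F : seq nat -> R) :
  size l = n ->
  \sum_(s : 'S_n) (-1) ^+ s * F [seq nth 0%N l (s i) | i <- enum 'I_n] =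
  \sum_(a <- sperms n l) (-1) ^+ a.1 * F a.2.
Proof.
elim: n l F => [|n IH] l F sl.
  rewrite (big_pred1 (1%g : 'S_0)) => [|s]; last by apply/esym/eqP/permP => -[].
  rewrite odd_perm1 /= big_seq1; congr (_ * F _).
  by apply: size0nil; rewrite size_map size_enum_ord.
have [||f' fK f'K] := @inj_card_bij ('I_n.+1 * 'S_n)%type 'S_n.+1
    (fun kt => lift_perm ord0 kt.1 kt.2); last first.
- rewrite (reindex (fun kt : 'I_n.+1 * 'S_n => lift_perm ord0 kt.1 kt.2));
    last by exists f' => ? _; [exact: fK | exact: f'K].
  rewrite -(pair_bigA _ (fun k t => (-1) ^+ lift_perm ord0 k t *
    F [seq nth 0%N l (lift_perm ord0 k t i) | i <- enum 'I_n.+1])).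
  rewrite spermsS big_flatten big_map big_mkord.
  apply: eq_bigr => k _; rewrite big_map.
  set l' := take k l ++ drop k.+1 l.
  have kl : (k < size l)%N by rewrite sl.
  have sl' : size l' = n.
    rewrite size_cat size_takel ?(ltnW kl)// size_drop sl subSS subnKC//.
    by rewrite -ltnS.
  rewrite (eq_bigr (fun t : 'S_n => (-1) ^+ t * ((-1) ^+ odd k *
      F (nth 0%N l k :: [seq nth 0%N l' (t i) | i <- enum 'I_n])))).
    rewrite (IH l' (fun s => (-1) ^+ odd k * F (nth 0%N l k :: s)))//=.
    apply: eq_bigr => a _; rewrite signr_addb mulrA; congr (_ * _).
    by rewrite -!signr_addb addbC.
  move=> t _; rewrite odd_lift_perm /= mulrA -signr_addb addbC; congr (_ * F _).
  rewrite enum_ordSl /= lift_perm_id -map_comp; congr (_ :: _).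
  apply: eq_map => i /=; rewrite lift_perm_lift /=.
  rewrite /l' nth_cat size_takel ?(ltnW kl)// /bump.
  case: ltnP => ik; first by rewrite nth_take.
  by rewrite nth_drop addSn subnKC.
- by rewrite card_prod card_ord !card_Sn.
- move=> [k t] [k' t'] /= /permP E; have := E ord0; rewrite !lift_perm_id => ->.
  congr (_, _); apply/permP => i; have := E (lift ord0 i).
  have := E ord0; rewrite !lift_perm_id => ->.
  by rewrite !lift_perm_lift => /lift_inj.
Qed.

Section BlockPermutation.
Variables (k m : nat) (r : 'S_k).

Definition block_fun (x : 'I_(k + m)) : 'I_(k + m) :=
  match fintype.split x with inl i => lshift m (r i) | inr j => rshift k j end.

Lemma block_fun_inj : injective block_fun.
Proof.
move=> x y; rewrite /block_fun.
case: (split_ordP x) => i ->; case: (split_ordP y) => j -> E.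
- by move/lshift_inj/perm_inj: E => ->.
- by move/eqP: E; rewrite eq_lrshift.
- by move/eqP: E; rewrite eq_rlshift.
- by move/rshift_inj: E => ->.
Qed.

Definition block_perm : 'S_(k + m) := perm block_fun_inj.

Lemma block_perml i : block_perm (lshift m i) = lshift m (r i).
Proof. by rewrite permE /block_fun (unsplitK (inl i)). Qed.

Lemma block_permr j : block_perm (rshift k j) = rshift k j.
Proof. by rewrite permE /block_fun (unsplitK (inr j)). Qed.

(** The matrix of a permutation acting on the first block is block diagonal. *)
Lemma sign_block_perm (R : comNzRingType) : (-1) ^+ block_perm = (-1) ^+ r :> R.
Proof.
rewrite -!det_perm -[RHS]mulr1 -(det1 R m) -(det_ublock _ 0); congr (\det _).
apply/matrixP => i j.
case: (split_ordP i) => i' ->; case: (split_ordP j) => j' ->;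
  rewrite ?(block_mxEul, block_mxEur, block_mxEdl, block_mxEdr) !mxE.
- by rewrite block_perml eq_lshift.
- by rewrite block_perml eq_lrshift.
- by rewrite block_permr eq_rlshift.
- by rewrite block_permr eq_rshift.
Qed.

End BlockPermutation.

Section Wedge.
Variables (R : realType) (n : nat).

(** The antisymmetrisation in the inner product is absorbed by the outer one: each
    permutation of the first k + l indices extends to a permutation of all of
    them, by which the outer sum can be reindexed. *)
Lemma wedge_wedgeE k l m (a : Defs.form R k n) (b : Defs.form R l n)
    (c : Defs.form R m n) v :
  (a \wedge b \wedge c) v = (k`! * l`! * m`!)%:R^-1 *
  \sum_(s : 'S_(k + l + m)) (-1) ^+ s *
    (a (fun i => v (s (lshift m (lshift l i)))) *
     b (fun i => v (s (lshift m (rshift k i)))) *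
     c (fun i => v (s (rshift (k + l) i)))).
Proof.
pose G (s : 'S_(k + l + m)) : R := (-1) ^+ s *
    (a (fun i => v (s (lshift m (lshift l i)))) *
     b (fun i => v (s (lshift m (rshift k i)))) *
     c (fun i => v (s (rshift (k + l) i)))).
have kl0 : (k`! * l`!)%:R != 0 :> R by rewrite pnatr_eq0 -lt0n muln_gt0 !fact_gt0.
have K0 : ((k + l)`!)%:R != 0 :> R by rewrite pnatr_eq0 -lt0n fact_gt0.
have m0 : (m`!)%:R != 0 :> R by rewrite pnatr_eq0 -lt0n fact_gt0.
rewrite /wedge -/G.
rewrite (eq_bigr (fun s : 'S_(k + l + m) => (k`! * l`!)%:R^-1 *
   \sum_(r : 'S_(k + l)) G (block_perm m r * s)%g)); last first.
  move=> s _; rewrite [(-1) ^+ s * _]mulrCA -!mulrA; congr (_ * _).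
  rewrite mulr_suml mulr_sumr; apply: eq_bigr => r _; rewrite /G.
  rewrite odd_permM signr_addb sign_block_perm !mulrA.
  rewrite [(-1) ^+ s * (-1) ^+ r]mulrC; congr (_ * _ * _ * _).
  - by congr a; apply/funext => i; rewrite permM block_perml.
  - by congr b; apply/funext => i; rewrite permM block_perml.
  - by congr c; apply/funext => i; rewrite permM block_permr.
rewrite -mulr_sumr exchange_big /=.
rewrite (eq_bigr (fun=> \sum_s G s)) => [|r _]; last first.
  by rewrite [RHS](reindex_inj (mulgI (block_perm m r))).
rewrite sumr_const card_Sn -(mulr_natl (\sum_s G s)) !natrM !invfM !mulrA; congr (_ * _).
rewrite natrM in kl0; field.
by move: kl0; rewrite mulf_eq0 negb_or => /andP[-> ->]; rewrite K0 m0.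
Qed.

Lemma form1E (a : Defs.form R 1 n) v : a v = a (fun=> v ord0).
Proof. by congr a; apply/funext => i; rewrite ord1. Qed.

Lemma sum_perm_seq k (F : seq nat -> R) :
  \sum_(s : 'S_k) (-1) ^+ s * F [seq (s i : nat) | i <- enum 'I_k] =
  \sum_(a <- sperms k (iota 0 k)) (-1) ^+ a.1 * F a.2.
Proof.
rewrite -sum_sperms ?size_iota//; apply: eq_bigr => s _; congr (_ * F _).
by apply: eq_map => i; rewrite nth_iota.
Qed.

Lemma nth_perm_seq k (s : 'S_k) (i : 'I_k) :
  nth 0%N [seq (s j : nat) | j <- enum 'I_k] i = s i.
Proof.
rewrite (nth_map i) ?size_enum_ord//; congr (nat_of_ord (s _)).
by apply/val_inj; rewrite /= nth_enum_ord.
Qed.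

Lemma wedge11E (a b : Defs.form R 1 n) v :
  (a \wedge b) v =
  a (fun=> v ord0) * b (fun=> v (inord 1)) - a (fun=> v (inord 1)) * b (fun=> v ord0).
Proof.
pose F s := a (fun=> v (inord (nth 0%N s 0))) * b (fun=> v (inord (nth 0%N s 1))).
have E := sum_perm_seq 2 F.
rewrite /wedge -[(1 + 1)%N]/2%N invr1 mul1r.
rewrite (eq_bigr (fun s : 'S_2 => (-1) ^+ s * F [seq (s i : nat) | i <- enum 'I_2])).
  rewrite E !big_cons big_nil /= /F /=.
  have -> : inord 0 = ord0 :> 'I_2 by apply/val_inj; rewrite /= inordK.
  by rewrite expr0 expr1 mul1r mulN1r addr0.
move=> s _; rewrite /F (nth_perm_seq s (@Ordinal 2 0 isT)).
rewrite (nth_perm_seq s (@Ordinal 2 1 isT)) !inord_val -mulrA.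
by congr (_ * (a _ * b _)); apply/funext => i; congr (v (s _));
  apply: ord_inj; rewrite /= ord1.
Qed.

Lemma wedge111E (a b c : Defs.form R 1 n) v :
  let e (f : Defs.form R 1 n) i := f (fun=> v (inord i)) in
  (a \wedge b \wedge c) v =
    e a 0%N * e b 1%N * e c 2%N - e a 0%N * e b 2%N * e c 1%N
  - e a 1%N * e b 0%N * e c 2%N + e a 1%N * e b 2%N * e c 0%N
  + e a 2%N * e b 0%N * e c 1%N - e a 2%N * e b 1%N * e c 0%N.
Proof.
move=> e; pose F s := e a (nth 0%N s 0) * e b (nth 0%N s 1) * e c (nth 0%N s 2).
rewrite wedge_wedgeE invr1 mul1r -[(1 + 1 + 1)%N]/3%N.
rewrite (eq_bigr (fun s : 'S_3 => (-1) ^+ s * F [seq (s i : nat) | i <- enum 'I_3])).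
  rewrite (sum_perm_seq 3 F) !big_cons big_nil /= /F /=.
  by rewrite !expr0 !expr1 !mul1r !mulN1r addr0 !addrA.
move=> s _; rewrite /F /e.
rewrite (nth_perm_seq s (@Ordinal 3 0 isT)) (nth_perm_seq s (@Ordinal 3 1 isT)).
rewrite (nth_perm_seq s (@Ordinal 3 2 isT)) !inord_val.
by congr (_ * (a _ * b _ * c _)); apply/funext => i; congr (v (s _));
  apply: ord_inj; rewrite /= ord1.
Qed.

End Wedge.

(** * The tensors of the family as polynomials *)

(** Tables, so that each entry of an indexed family is computed only once. *)
Definition memo1 (f : nat -> spoly) : nat -> spoly :=
  let T := [seq f i | i <- iota 0 7] in fun i => nth [::] T i.
Definition memo2 (f : nat -> nat -> spoly) : nat -> nat -> spoly :=
  let T := [seq memo1 (f i) | i <- iota 0 7] in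
  fun i => nth (fun=> [::]) T i.
Definition memo3 (f : nat -> nat -> nat -> spoly) : nat -> nat -> nat -> spoly :=
  let T := [seq memo2 (f i) | i <- iota 0 7] in
  fun i => nth (fun _ _ => [::]) T i.

Arguments memo1 : simpl never.
Arguments memo2 : simpl never.
Arguments memo3 : simpl never.

Definition psum7 (f : nat -> spoly) : spoly := psum [seq f k | k <- iota 0 7].

Section PolynomialTensors.
Local Open Scope spoly_scope.

(** Covectors and vectors are given by their components; the indices 0 to 6 are
    the coordinates t, x, y, p, q, z, rho. *)
Definition poly_F : spoly :=
  - pfrac 1 2 * (vq * vq + pfrac 10 3 * vjet 0 * (vp * vp)
                 + (pnat 1 + vjet 0 * vjet 0 - vjet 2) * (vy * vy)).
Definition poly_omega1 := memo1 (fun k => pdelta 2 k - vp * pdelta 1 k).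
Definition poly_omega3 := memo1 (fun k => pdelta 3 k - vq * pdelta 1 k).
Definition poly_omega2 := memo1 (fun k =>
  pdelta 5 k - poly_F * pdelta 1 k + vq * poly_omega3 k).
Definition poly_omega4 := pdelta 4.
Definition poly_omega5 := pdelta 1.
Definition poly_dt := pdelta 0.
Definition poly_drho := pdelta 6.

Definition poly_sym_prod (a b : nat -> spoly) (i j : nat) : spoly :=
  pfrac 1 2 * (a i * b j + b i * a j).

Definition poly_g := memo2 (fun i j =>
  - (pnat 3 * vjet 0) * poly_sym_prod poly_omega1 poly_omega1 i j
  + pnat 3 * poly_sym_prod poly_omega1 poly_omega4 i j
  - pnat 10 * vjet 0 * vp * poly_sym_prod poly_omega1 poly_omega5 i j
  - pnat 3 * poly_sym_prod poly_omega2 poly_omega5 i j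
  - pnat 2 * poly_sym_prod poly_omega3 poly_omega3 i j).

Definition poly_gt := memo2 (fun i j =>
  pnat 2 * vrho * poly_sym_prod poly_dt poly_dt i j
  + pnat 2 * vt * poly_sym_prod poly_dt poly_drho i j
  + vt * vt * (poly_g i j
      - pfrac 2 3 * vrho * vjet 0 * poly_sym_prod poly_omega5 poly_omega5 i j)).

(** The fields [frame1] to [frame5] are dual to w1, ..., w5. *)
Definition frame1 := pdelta 2.
Definition frame2 := pdelta 5.
Definition frame3 := memo1 (fun k => pdelta 3 k - vq * pdelta 5 k).
Definition frame4 := pdelta 4.
Definition frame5 := memo1 (fun k =>
  pdelta 1 k + vp * pdelta 2 k + vq * pdelta 3 k + poly_F * pdelta 5 k).

(** The fields [null1], [frame4], [frame2], [null5] and [frame3] are dual to w1,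
    w4 - I w1 - (10/3) I p w5, w2 + (2/9) rho I w5, w5 and w3; the first four
    are null for the ambient metric. *)
Definition null1 := memo1 (fun k => frame1 k + vjet 0 * frame4 k).
Definition null5 := memo1 (fun k => frame5 k + pfrac 10 3 * vjet 0 * vp * frame4 k
                        - pfrac 2 9 * vrho * vjet 0 * frame2 k).

(** The inverse of 2 rho dt^2 + 2 t dt drho + t^2 (3 w1 W4 - 3 W2 w5 - 2 w3^2),
    the form that [gt_] takes with W2 = w2 + (2/9) rho I w5 and
    W4 = w4 - I w1 - (10/3) I p w5. *)
Definition poly_gt_inv := memo2 (fun i j =>
  pnat 2 * vtinv * poly_sym_prod (pdelta 0) (pdelta 6) i j
  - pnat 2 * vrho * vtinv * vtinv * poly_sym_prod (pdelta 6) (pdelta 6) i j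
  + vtinv * vtinv * (pfrac 4 3 * poly_sym_prod null1 frame4 i j
                     - pfrac 4 3 * poly_sym_prod frame2 null5 i j
                     - pfrac 1 2 * poly_sym_prod frame3 frame3 i j)).

Definition poly_dgt := memo3 (fun l i j => pd l (poly_gt i j)).

Definition poly_christoffel := memo3 (fun k i j => pfrac 1 2 * psum7 (fun l =>
  poly_gt_inv k l * (poly_dgt i j l + poly_dgt j i l - poly_dgt l i j))).

Definition poly_riemann (l i j k : nat) : spoly :=
  pd i (poly_christoffel l j k) - pd j (poly_christoffel l i k)
  + psum7 (fun m => poly_christoffel l i m * poly_christoffel m j k
                      - poly_christoffel l j m * poly_christoffel m i k).

Definition poly_ricci (j k : nat) : spoly := psum7 (fun i => poly_riemann i i j k).

Definition poly_apply (c w : nat -> spoly) : spoly := psum7 (fun k => w k * c k).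

Definition poly_wedge (a b c : nat -> spoly) (u : nat -> nat -> spoly) : spoly :=
  let a0 := poly_apply a (u 0%N) in let a1 := poly_apply a (u 1%N) in
  let a2 := poly_apply a (u 2%N) in
  let b0 := poly_apply b (u 0%N) in let b1 := poly_apply b (u 1%N) in
  let b2 := poly_apply b (u 2%N) in
  let c0 := poly_apply c (u 0%N) in let c1 := poly_apply c (u 1%N) in
  let c2 := poly_apply c (u 2%N) in
  a0 * b1 * c2 - a0 * b2 * c1 - a1 * b0 * c2 + a1 * b2 * c0 + a2 * b0 * c1
  - a2 * b1 * c0.

Definition poly_Phit (u : nat -> nat -> spoly) : spoly :=
  let t2 := vt * vt in let t3 := vt * vt * vt in
  vpar 0 * (- (pnat 9 * t2) * poly_wedge poly_dt poly_omega1 poly_omega2 u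
    - pnat 2 * t2 * poly_wedge poly_dt poly_omega3 poly_drho u
    - pnat 3 * t3 * poly_wedge poly_omega1 poly_omega3 poly_omega4 u
    + pnat 10 * t3 * vjet 0 * vp * poly_wedge poly_omega1 poly_omega3 poly_omega5 u
    - t3 * vjet 0 * poly_wedge poly_omega1 poly_omega5 poly_drho u
    + pnat 3 * t3 * poly_wedge poly_omega2 poly_omega3 poly_omega5 u
    + t3 * poly_wedge poly_omega4 poly_omega5 poly_drho u
    + vrho * (- (pnat 3 * t2 * vjet 0) * poly_wedge poly_dt poly_omega1 poly_omega5 u
              + t2 * poly_wedge poly_dt poly_omega4 poly_omega5 u)).

(** The direction of differentiation and the three arguments of the form are
    independent parameters, so that a single polynomial expresses parallelism. *)
Definition dir_var (k : nat) : spoly := vpar k.+1.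
Definition arg_var (a k : nat) : spoly := vpar (8 + 7 * a + k).
Definition poly_levi_civita (w : nat -> spoly) := memo1 (fun k =>
  psum7 (fun i => psum7 (fun j => poly_christoffel k i j * dir_var i * w j))).

Definition poly_cov_deriv : spoly :=
  pder (jet_der dir_var) (poly_Phit arg_var)
  - psum [seq poly_Phit (fun b =>
             if b == a then poly_levi_civita (arg_var a) else arg_var b)
         | a <- iota 0 3].

Definition poly_Phit_comp := memo3 (fun a b c =>
  poly_Phit (fun m => pdelta (nth 0%N [:: a; b; c] m))).

Definition signed (b : bool) (p : spoly) := if b then - p else p.

Definition poly_form_matrix (i j : nat) : spoly :=
  pfrac 1 24 * psum [seq signed a.1 (poly_Phit_comp i (nth 0%N a.2 0) (nth 0%N a.2 1)
      * poly_Phit_comp j (nth 0%N a.2 2) (nth 0%N a.2 3)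
      * poly_Phit_comp (nth 0%N a.2 4) (nth 0%N a.2 5) (nth 0%N a.2 6))
    | a <- sperms 7 (iota 0 7)].

Definition poly_det_gt : spoly := psum [seq signed a.1
  (foldr (fun i p => poly_gt i (nth 0%N a.2 i) * p) (pnat 1) (iota 0 7))
    | a <- sperms 7 (iota 0 7)].

End PolynomialTensors.

(** * Coordinates on the ambient space *)

Definition all7 (f : nat -> bool) : bool := all f (iota 0 7).
Definition pzero (p : spoly) : bool := if p is [::] then true else false.

Lemma all7P (f : nat -> bool) : all7 f -> forall i : 'I_7, f i.
Proof. by move=> /allP fT i; apply: fT; rewrite mem_iota (ltn_ord i). Qed.

Lemma memo1E f i : (i < 7)%N -> memo1 f i = f i.
Proof. by move=> i7; rewrite /memo1 (nth_map 0%N) ?size_iota// nth_iota. Qed.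

Lemma memo2E f i j : (i < 7)%N -> (j < 7)%N -> memo2 f i j = f i j.
Proof.
by move=> i7 j7; rewrite /memo2 (nth_map 0%N) ?size_iota// nth_iota// memo1E.
Qed.

Lemma memo3E f i j k : (i < 7)%N -> (j < 7)%N -> (k < 7)%N ->
  memo3 f i j k = f i j k.
Proof.
by move=> i7 j7 k7; rewrite /memo3 (nth_map 0%N) ?size_iota// nth_iota// memo2E.
Qed.

Lemma sum_iota7 (V : nmodType) (F : nat -> V) :
  \sum_(k <- iota 0 7) F k = \sum_(k < 7) F k.
Proof. by rewrite -[iota 0 7]/(index_iota 0 7) big_mkord. Qed.

Lemma peval_psum_iota (R : numFieldType) (e : nat -> R) n (F : nat -> spoly) :
  peval e (psum [seq F k | k <- iota 0 n]) = \sum_(k < n) peval e (F k).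
Proof. by rewrite peval_sum big_map -{1}[n]subn0 big_mkord. Qed.

Section FormLemmas.
Variables (R : realType) (m n : nat).

Definition linear_form k (a : Defs.form R 1 k) := forall c (x y : 'rV[R]_k),
  a (fun=> c *: x + y) = c * a (fun=> x) + a (fun=> y).

Lemma linear_formE k (a : Defs.form R 1 k) v : linear_form a ->
  a v = \sum_i v ord0 0 i * a (fun=> delta_mx 0 i).
Proof.
move=> al; have a0 : a (fun=> 0) = 0.
  have := al 1 0 0; rewrite scaler0 addr0 mul1r => /eqP.
  by rewrite -subr_eq0 opprD addNKr oppr_eq0 => /eqP.
rewrite form1E {1}(row_sum_delta (v ord0)).
elim/big_ind2: _ => // [x1 x2 y1 y2 <- <-|i _].
  by have := al 1 x2 y2; rewrite scale1r mul1r.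
by have := al (v ord0 0 i) (delta_mx 0 i) 0; rewrite !addr0 a0 addr0.
Qed.

(** Gram matrices pull back as the bilinear forms that they represent. *)
Lemma mulmx_sym_prod (f : 'M[R]_(m, n)) (a b : Defs.form R 1 n) :
  linear_form a -> linear_form b ->
  f *m sym_prod a b *m f^T =
  sym_prod (fun v => a (fun i => v i *m f)) (fun v => b (fun i => v i *m f)).
Proof.
move=> al bl; apply/matrixP => i j; rewrite !mxE.
have E (c : Defs.form R 1 n) k : linear_form c ->
    c (fun=> delta_mx 0 k *m f) = \sum_l f k l * c (fun=> delta_mx 0 l).
  move=> cl; rewrite (linear_formE _ cl); apply: eq_bigr => l _.
  by rewrite -rowE mxE.
rewrite !E// !big_distrlr /= -!big_split /= mulr_sumr.
rewrite (eq_bigr (fun l => \sum_k f i k * sym_prod a b k l * f j l)); last first.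
  by move=> l _; rewrite mxE mulr_suml !mxE.
rewrite exchange_big /=; apply: eq_bigr => k _.
rewrite -big_split /= mulr_sumr; apply: eq_bigr => l _.
rewrite mxE; ring.
Qed.

End FormLemmas.

Section Coordinates.
Variable R : realType.

Lemma ambient_projE (v : 'rV[R]_7) (k : 'I_5) :
  (v *m ambient_proj R 5) 0 k = v 0 (inord k.+1).
Proof.
rewrite /ambient_proj /bundle_proj -[v in LHS](@hsubmxK _ 1 (1 + 5) 1).
rewrite (@mul_row_col _ 1 (1 + 5) 1 5) mulmx0 addr0.
rewrite -[lsubmx _](@hsubmxK _ 1 1 5) (@mul_row_col _ 1 1 5 5) mulmx0 add0r mulmx1 !mxE.
congr (v 0 _); apply: val_inj; rewrite /= inordK//.
by have := ltn_ord k; rewrite !ltnS => /leqW.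
Qed.

Lemma t_coordE (P : 'rV[R]_7) : t_coord (n := 5) P = P 0 (inord 0).
Proof. by rewrite /t_coord !mxE; congr (P 0 _); apply: val_inj; rewrite /= inordK. Qed.

Lemma rho_coordE (P : 'rV[R]_7) : rho_coord (n := 5) P = P 0 (inord 6).
Proof. by rewrite /rho_coord !mxE; congr (P 0 _); apply: val_inj; rewrite /= inordK. Qed.

Lemma ambient_jet_domain (J : set R) : ambient_space (M_ J) = jet_domain J.
Proof.
apply/funext => P; rewrite /jet_domain /mkset -(t_coordE P).
have -> : P 0 (inord 1) = rsubmx (lsubmx (P : 'rV[R]_(1 + 5 + 1))) 0 ix.
  by rewrite !mxE; congr (P 0 _); apply: val_inj; rewrite /= inordK.
by [].
Qed.

Lemma omega1E (u : 'rV[R]_5) v :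
  omega1 u v = v ord0 0 iy - u 0 ip * v ord0 0 ix.
Proof. by []. Qed.

Lemma omega3E (u : 'rV[R]_5) v :
  omega3 u v = v ord0 0 ip - u 0 iq * v ord0 0 ix.
Proof. by []. Qed.

Lemma omega2E I (u : 'rV[R]_5) v :
  omega2 I u v = v ord0 0 iz - F_ I u * v ord0 0 ix
                 - partial iq (F_ I) u * omega3 u v.
Proof. by []. Qed.

Lemma omega1_linear u : linear_form (omega1 (R := R) u).
Proof. by move=> c x y; rewrite !omega1E !mxE; ring. Qed.

Lemma omega3_linear u : linear_form (omega3 (R := R) u).
Proof. by move=> c x y; rewrite !omega3E !mxE; ring. Qed.

Lemma omega2_linear I u : linear_form (omega2 (R := R) I u).
Proof. by move=> c x y; rewrite !omega2E !omega3E !mxE; ring. Qed.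

Lemma dcoord_linear n (i : 'I_n) : linear_form (dcoord (R := R) i).
Proof. by move=> c x y; rewrite /dcoord !mxE. Qed.

End Coordinates.

(** * Metric, Christoffel symbols and Ricci curvature *)

Section MatrixEntries.
Variables (V : pzRingType) (m n : nat).

Lemma mxaddE (A B : 'M[V]_(m, n)) i j : (A + B) i j = A i j + B i j.
Proof. exact: mxE. Qed.

Lemma mxoppE (A : 'M[V]_(m, n)) i j : (- A) i j = - A i j.
Proof. exact: mxE. Qed.

Lemma mxscaleE c (A : 'M[V]_(m, n)) i j : (c *: A) i j = c * A i j.
Proof. exact: mxE. Qed.

Definition mxopE := (mxaddE, mxoppE, mxscaleE).

End MatrixEntries.

Section Slice.
Variable R : realType.

Lemma bundle_inclE (y : 'rV[R]_(1 + 5)) (i : 'I_7) :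
  (y *m bundle_incl R 5) 0 i = if unlift ord_max i is Some j then y 0 j else 0.
Proof.
rewrite /bundle_incl mul_mx_row mulmx1 mulmx0.
case: (split_ordP (i : 'I_(1 + 5 + 1))) => j ->.
  rewrite row_mxEl; have -> : lshift 1 j = lift ord_max j :> 'I_7.
    by apply: ord_inj; rewrite lift_max.
  by rewrite liftK.
rewrite row_mxEr mxE; have -> : rshift (1 + 5) j = ord_max :> 'I_7.
  by apply: ord_inj; rewrite /= ord1.
by rewrite unlift_none.
Qed.

Lemma bundle_incl_inord (y : 'rV[R]_(1 + 5)) k :
  (y *m bundle_incl R 5) 0 (inord k : 'I_7) =
  if (k < 6)%N then y 0 (inord k) else (y *m bundle_incl R 5) 0 (inord k).
Proof.
case: ifP => // k6; rewrite bundle_inclE.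
have -> : inord k = lift ord_max (inord k : 'I_6) :> 'I_7.
  by apply: ord_inj; rewrite lift_max !inordK// ltnW.
by rewrite liftK.
Qed.

Lemma bundle_incl_rho (y : 'rV[R]_(1 + 5)) :
  (y *m bundle_incl R 5) 0 (inord 6 : 'I_7) = 0.
Proof.
rewrite bundle_inclE (_ : inord 6 = ord_max) ?unlift_none//.
by apply: ord_inj; rewrite inordK.
Qed.

Definition slice_base : 'rV[R]_7 :=
  row_mx (1%:M : 'M[R]_1) (0 : 'rV[R]_5) *m bundle_incl R 5.
Definition slice_mx : 'M[R]_(5, 7) :=
  row_mx (0 : 'M[R]_(5, 1)) 1%:M *m bundle_incl R 5.

(** The embedding u |-> (1, u, 0) of the base, through which polynomials on the
    ambient space also describe tensors on the base. *)
Definition slice : 'rV[R]_5 -> 'rV[R]_7 := affine slice_base slice_mx.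

Lemma sliceE u : slice u = row_mx 1%:M u *m bundle_incl R 5.
Proof.
rewrite /slice /affine /slice_base /slice_mx mulmxA -mulmxDl.
by rewrite mul_mx_row mulmx0 mulmx1 add_row_mx add0r addr0.
Qed.

Lemma row_mx_inord0 n (a : 'M[R]_1) (u : 'rV[R]_n) : row_mx a u 0 (inord 0) = a 0 0.
Proof.
have -> : inord 0 = lshift n 0 :> 'I_(1 + n) by apply: ord_inj; rewrite inordK.
by rewrite row_mxEl.
Qed.

Lemma row_mx_inordS n (a : 'M[R]_1) (u : 'rV[R]_n.+1) k : (k < n.+1)%N ->
  row_mx a u 0 (inord k.+1) = u 0 (inord k).
Proof.
move=> kn.
have -> : inord k.+1 = rshift 1 (inord k : 'I_n.+1) :> 'I_(1 + n.+1).
  by apply: ord_inj; rewrite /= !inordK.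
by rewrite row_mxEr.
Qed.

Lemma slice_t u : slice u 0 (inord 0) = 1.
Proof. by rewrite sliceE bundle_incl_inord row_mx_inord0 mxE. Qed.

Lemma slice_coord u k : (k < 5)%N -> slice u 0 (inord k.+1) = u 0 (inord k).
Proof.
by move=> k5; rewrite sliceE bundle_incl_inord ltnS k5 row_mx_inordS.
Qed.

Lemma slice_proj u : slice u *m ambient_proj R 5 = u.
Proof.
apply/rowP => k; rewrite ambient_projE slice_coord ?inord_val//.
Qed.

Lemma slice_mx_t (v : 'rV[R]_5) : (v *m slice_mx) 0 (inord 0) = 0.
Proof.
rewrite /slice_mx mulmxA [v *m row_mx _ _]mul_mx_row mulmx0 mulmx1 bundle_incl_inord.
by rewrite row_mx_inord0 mxE.
Qed.

Lemma slice_mx_coord (v : 'rV[R]_5) k : (k < 5)%N ->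
  (v *m slice_mx) 0 (inord k.+1) = v 0 (inord k).
Proof.
move=> k5; rewrite /slice_mx mulmxA [v *m row_mx _ _]mul_mx_row mulmx0 mulmx1.
rewrite bundle_incl_inord.
by rewrite ltnS k5 row_mx_inordS.
Qed.

Lemma slice_mx_rho (v : 'rV[R]_5) : (v *m slice_mx) 0 (inord 6) = 0.
Proof. by rewrite /slice_mx mulmxA bundle_incl_rho. Qed.

Lemma row_slice_mx i : row i slice_mx = delta_mx 0 (inord i.+1).
Proof.
rewrite rowE; apply/rowP => k; rewrite -[k]inord_val [RHS]mxE eqxx /=.
have i7 : (i.+1 < 7)%N by rewrite ltnS (ltn_trans (ltn_ord i)).
have [k0|k0] := eqVneq (k : nat) 0%N.
  by rewrite k0 slice_mx_t -val_eqE /= !inordK.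
have [k6|k6] := eqVneq (k : nat) 6%N.
  by rewrite k6 slice_mx_rho -val_eqE /= !inordK// eqSS (gtn_eqF (ltn_ord i)).
have k5 : (k.-1 < 5)%N.
  by rewrite -ltnS prednK ?lt0n// ltn_neqAle k6 -ltnS ltn_ord.
rewrite -(prednK (n := k)) ?lt0n// slice_mx_coord// mxE eqxx /= -!val_eqE /=.
by rewrite !inordK// ltnS ltnW.
Qed.

Lemma slice_domain J u : M_ J u -> jet_domain J (slice u).
Proof.
move=> Ju; split; first by rewrite slice_t.
by rewrite slice_coord// (_ : inord 0 = ix)//; apply: ord_inj; rewrite inordK.
Qed.

Lemma inord5 : ((inord 0 = ix) * (inord 1 = iy) * (inord 2 = ip) * (inord 3 = iq)
  * (inord 4 = iz))%type.
Proof. by do !split; apply: ord_inj; rewrite inordK. Qed.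

End Slice.

Section Evaluate.
Variables (R : realType) (J : set R) (I : R -> R).
Hypotheses (J_open : open J) (I_smooth : smooth_function J I).
Variable par : nat -> R.
Local Notation env := (jet_env I par).
Local Notation dom := (jet_domain J).

Lemma peval_psum7 e f : peval (R := R) e (psum7 f) = \sum_(k <- iota 0 7) peval e (f k).
Proof. by rewrite peval_sum big_map. Qed.

Lemma pzeroP e p : pzero p -> peval (R := R) e p = 0.
Proof. by case: p => // _; rewrite peval_nil. Qed.

Lemma pzeroBP e p q : pzero (p - q)%S -> peval (R := R) e p = peval e q.
Proof. by move=> /(pzeroP e)/eqP; rewrite pevalD pevalN subr_eq0 => /eqP. Qed.

Section AtPoint.
Variables (P : 'rV[R]_7) (e01 : env P 0%N * env P 1%N = 1).

Definition pevalE := (pevalD, pevalN, pevalM e01, peval_var, peval_nat,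
  peval_delta, peval_psum7, peval_nil).

Lemma F_eval : F_ I (P *m ambient_proj R 5) = peval (env P) poly_F.
Proof.
rewrite /F_ /poly_F !pevalE !peval_frac// /vjet !(jet_env_jet _ _ P) /I_ /I2_.
rewrite !ambient_projE /=.
by field.
Qed.

(** [a] is the covector at P whose components are the values of [c]. *)
Definition covec (a : Defs.form R 1 7) (c : nat -> spoly) : Prop :=
  forall v, a v = \sum_(k <- iota 0 7) v ord0 0 (inord k) * peval (env P) (c k).

Lemma covec_dcoord (i : 'I_7) : covec (dcoord i) (pdelta i).
Proof.
move=> v; rewrite sum_iota7 (bigD1 i)//= peval_delta eqxx mulr1 inord_val.
rewrite big1 ?addr0// => k ki; rewrite peval_delta -val_eqE /= in ki *.
by rewrite eq_sym (negbTE ki) mulr0.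
Qed.

Lemma covec_dt : covec (dt (R := R)) poly_dt.
Proof. exact: (covec_dcoord (t_index 5)). Qed.

Lemma covec_drho : covec (drho (R := R)) poly_drho.
Proof. exact: (covec_dcoord (rho_index 5)). Qed.

Local Notation pullP w := (pull_form (ambient_proj R 5) w P).

Lemma covec_omega1 : covec (pullP (@omega1 R)) poly_omega1.
Proof.
move=> v; rewrite /pull_form omega1E !ambient_projE /poly_omega1 !big_cons big_nil.
by rewrite !memo1E// !pevalE /=; ring.
Qed.

Lemma covec_omega3 : covec (pullP (@omega3 R)) poly_omega3.
Proof.
move=> v; rewrite /pull_form omega3E !ambient_projE /poly_omega3 !big_cons big_nil.
by rewrite !memo1E// !pevalE /=; ring.
Qed.

Lemma covec_omega4 : covec (pullP (@omega4 R)) poly_omega4.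
Proof.
move=> v; rewrite /pull_form /omega4 /dcoord ambient_projE !big_cons big_nil.
by rewrite /poly_omega4 !pevalE /=; ring.
Qed.

Lemma covec_omega5 : covec (pullP (@omega5 R)) poly_omega5.
Proof.
move=> v; rewrite /pull_form /omega5 /dcoord ambient_projE !big_cons big_nil.
by rewrite /poly_omega5 !pevalE /=; ring.
Qed.

End AtPoint.

Lemma partial_F u : M_ J u -> partial iq (F_ I) u = - u 0 iq.
Proof.
move=> Ju; pose G (P : 'rV[R]_7) := F_ I (P *m ambient_proj R 5).
have -> : F_ I = G \o @slice R.
  by apply/funext => w; rewrite /G /= slice_proj.
rewrite /partial derive_affine.
rewrite -rowE row_slice_mx -[(nat_of_ord iq).+1]/4%N.
have E Q : dom Q -> G Q = peval (env Q) poly_F.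
  by move=> WQ; rewrite /G F_eval//; exact: jet_env01 WQ.
have Du := slice_domain Ju.
have := partial_jet J_open I_smooth (inord 4) E Du; rewrite /partial => ->.
rewrite inordK//; transitivity (peval (env (slice u)) (- vq)%S).
  by apply: pzeroBP; vm_compute.
by rewrite pevalN peval_var /= slice_coord// inord5.
Qed.

Section OnDomain.
Variables (P : 'rV[R]_7) (WP : dom P).
Let e01 : env P 0%N * env P 1%N = 1 := jet_env01 I par WP.
Local Notation pullP w := (pull_form (ambient_proj R 5) w P).

Lemma covec_omega2 : covec P (pullP (omega2 I)) poly_omega2.
Proof.
have JP : M_ J (P *m ambient_proj R 5).
  by rewrite /M_ /mkset ambient_projE; have [] := WP.
move=> v; rewrite /pull_form omega2E partial_F// omega3E F_eval//.
rewrite !ambient_projE /poly_omega2 /poly_omega3 !big_cons big_nil.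
by rewrite !memo1E// !(pevalE e01) /=; ring.
Qed.

Lemma sym_prod_eval a b c d (i j : 'I_7) : covec P a c -> covec P b d ->
  sym_prod a b i j = peval (env P) (poly_sym_prod c d i j).
Proof.
move=> ac bd; have E f g k : covec P f g -> f (fun=> delta_mx 0 k) = peval (env P) (g k).
  move=> ->; rewrite sum_iota7 (bigD1 k)//= inord_val mxE !eqxx mul1r.
  rewrite big1 ?addr0// => l lk; rewrite inord_val mxE eqxx (negbTE lk).
  by rewrite mul0r.
rewrite mxE !(E _ _ _ ac) !(E _ _ _ bd) /poly_sym_prod !(pevalE e01) peval_frac// mul1r.
by rewrite [X in _ + X]mulrC.
Qed.

Lemma pull_g_eval (i j : 'I_7) :
  pull_metric (ambient_proj R 5) (g_ I) P i j = peval (env P) (poly_g i j).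
Proof.
rewrite /pull_metric /g_ !(mulmxDr, mulmxDl, mulmxBr, mulmxBl, mulmxN, mulNmx).
rewrite -!scalemxAr -!scalemxAl !mulmx_sym_prod//;
  try by [exact: omega1_linear|exact: omega2_linear|exact: omega3_linear
         |exact: dcoord_linear].
have o1 := covec_omega1 e01; have o2 := covec_omega2; have o3 := covec_omega3 e01.
have o4 := @covec_omega4 P; have o5 := @covec_omega5 P.
have S a b c d ac bd := @sym_prod_eval a b c d i j ac bd.
rewrite !mxopE (S _ _ _ _ o1 o1) (S _ _ _ _ o1 o4) (S _ _ _ _ o1 o5).
rewrite (S _ _ _ _ o2 o5) (S _ _ _ _ o3 o3) /poly_g memo2E ?ltn_ord//.
rewrite !(pevalE e01).
rewrite /vjet jet_env_jet /I_ !ambient_projE /=.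
by rewrite !mulNr.
Qed.

Lemma gt_eval (i j : 'I_7) : gt_ I P i j = peval (env P) (poly_gt i j).
Proof.
have pg := pull_g_eval i j.
have o5 := @covec_omega5 P; have ot := @covec_dt P; have or := @covec_drho P.
have S a b c d ac bd := @sym_prod_eval a b c d i j ac bd.
rewrite /gt_ !mxopE t_coordE rho_coordE (S _ _ _ _ ot ot) (S _ _ _ _ ot or).
have -> : pull_metric (ambient_proj R 5) (fun u => g_ I u -
    (2 / 3 * P 0 (inord 6) * I_ I u) *: sym_prod (dcoord ix) (dcoord ix)) P =
  pull_metric (ambient_proj R 5) (g_ I) P - (2 / 3 * P 0 (inord 6) *
    I (P 0 (inord 1))) *: sym_prod (pullP (@omega5 R)) (pullP (@omega5 R)).
  rewrite /pull_metric mulmxBr mulmxBl -scalemxAr -scalemxAl mulmx_sym_prod;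
    try exact: dcoord_linear.
  by rewrite /I_ ambient_projE.
rewrite !mxopE pg (S _ _ _ _ o5 o5) /poly_gt memo2E ?ltn_ord//.
by rewrite !(pevalE e01) !peval_frac// /vjet jet_env_jet /=.
Qed.

Lemma gt_sym : (gt_ I P)^T = gt_ I P.
Proof.
apply/matrixP => i j; rewrite mxE !gt_eval; apply: pzeroBP.
suff: all7 (fun i => all7 (fun j => pzero (poly_gt j i - poly_gt i j)%S)).
  by move=> /all7P/(_ i)/all7P/(_ j).
by vm_compute.
Qed.

Definition gt_inv : 'M[R]_7 := \matrix_(i, j) peval (env P) (poly_gt_inv i j).

Lemma gt_invP : gt_ I P *m gt_inv = 1%:M.
Proof.
apply/matrixP => i j; rewrite !mxE.
transitivity (peval (env P) (pdelta i j)); last by rewrite peval_delta.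
transitivity (peval (env P) (psum7 (fun k => poly_gt i k * poly_gt_inv k j)%S)).
  rewrite peval_psum7 sum_iota7; apply: eq_bigr => k _.
  by rewrite gt_eval mxE (pevalM e01).
apply: pzeroBP.
suff: all7 (fun i => all7 (fun j =>
    pzero (psum7 (fun k => poly_gt i k * poly_gt_inv k j) - pdelta i j)%S)).
  by move=> /all7P/(_ i)/all7P/(_ j).
by vm_compute.
Qed.

Lemma gt_unit : gt_ I P \in unitmx.
Proof. by have [] := mulmx1_unit gt_invP. Qed.

Lemma invmx_gt : invmx (gt_ I P) = gt_inv.
Proof. by rewrite -[LHS]mulmx1 -gt_invP mulKmx// gt_unit. Qed.

End OnDomain.

Lemma christoffel_eval (k i j : 'I_7) P : dom P ->
  christoffel (gt_ I) k i j P = peval (env P) (poly_christoffel k i j).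
Proof.
move=> WP; have e01 := jet_env01 I par WP.
have D (l a b : 'I_7) :
    partial l (fun Q => gt_ I Q a b) P = peval (env P) (poly_dgt l a b).
  rewrite /poly_dgt memo3E ?ltn_ord//.
  by apply: (partial_jet J_open I_smooth) => // Q WQ; exact: gt_eval.
rewrite /christoffel /poly_christoffel memo3E ?ltn_ord// (pevalM e01) peval_frac// mul1r.
congr (_ * _); rewrite peval_psum7 sum_iota7; apply: eq_bigr => l _.
by rewrite !D (invmx_gt WP) mxE !(pevalE e01).
Qed.

Lemma riemann_eval (l i j k : 'I_7) P : dom P ->
  riemann (gt_ I) l i j k P = peval (env P) (poly_riemann l i j k).
Proof.
move=> WP; have e01 := jet_env01 I par WP.
rewrite /riemann /poly_riemann (pevalD _ (pd i _ - _)%S) (pevalD _ (pd i _)) pevalN.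
have C a b c := christoffel_eval a b c.
rewrite !(partial_jet J_open I_smooth _ (C _ _ _))//; congr (_ + _).
rewrite peval_psum7 sum_iota7; apply: eq_bigr => m _.
by rewrite !christoffel_eval// !(pevalE e01).
Qed.

Lemma ricci_gt P : dom P -> ricci (gt_ I) P = 0.
Proof.
move=> WP; apply/matrixP => j k; rewrite !mxE.
transitivity (peval (env P) (poly_ricci j k)).
  rewrite peval_psum7 sum_iota7; apply: eq_bigr => i _.
  exact: riemann_eval.
apply: pzeroP; suff: all7 (fun j => all7 (fun k => pzero (poly_ricci j k))).
  by move=> /all7P/(_ j)/all7P/(_ k).
by vm_compute.
Qed.

End Evaluate.

(** * The three-form *)

Section AltForms.
Variables (R : realType) (n : nat).

Lemma altformD k (a b : Defs.form R k n) : altform a -> altform b -> altform (a + b).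
Proof.
move=> [a1 a2] [b1 b2]; split=> [v i c x y|v i j ij vij]; rewrite !fctE.
  by rewrite a1 b1; ring.
by rewrite (a2 _ _ _ ij vij) (b2 _ _ _ ij vij) addr0.
Qed.

Lemma altformZ k c (a : Defs.form R k n) : altform a -> altform (c *: a).
Proof.
move=> [a1 a2]; split=> [v i d x y|v i j ij vij]; rewrite !fctE /=.
  by rewrite a1; rewrite /GRing.scale /=; ring.
by rewrite (a2 _ _ _ ij vij) /GRing.scale /= mulr0.
Qed.

Lemma altformN k (a : Defs.form R k n) : altform a -> altform (- a).
Proof. by move=> ?; rewrite -scaleN1r; apply: altformZ. Qed.

Lemma altform_wedge111 (a b c : Defs.form R 1 n) :
  linear_form a -> linear_form b -> linear_form c -> altform (a \wedge b \wedge c).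
Proof.
move=> al bl cl.
pose f (j : 'I_3) := if j == 0%N :> nat then a else if j == 1%N :> nat then b else c.
have fl j : linear_form (f j) by rewrite /f; case: ifP => // _; case: ifP.
pose M (v : 'I_3 -> 'rV[R]_n) : 'M[R]_3 := \matrix_(i, j) f j (fun=> v i).
have E (v : 'I_3 -> 'rV[R]_n) : (a \wedge b \wedge c) v = \det (M v).
  rewrite wedge_wedgeE invr1 mul1r -det_tr /determinant; apply: eq_bigr => s _.
  congr (_ * _); rewrite !big_ord_recl big_ord0 mulr1 !mxE /f /= mulrA.
  by congr (a _ * b _ * c _); apply/funext => i; congr (v (s _));
    apply: ord_inj; rewrite /= ord1.
split=> [v i d x y|v i j ij vij]; rewrite !E.
  rewrite -[X in _ = _ + X]mul1r; apply: (determinant_multilinear (i0 := i)).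
  - by apply/rowP => j; rewrite !mxE /= eqxx fl mul1r.
  - by apply/matrixP => k j; rewrite !mxE /= eq_sym (negbTE (neq_lift _ _)).
  - by apply/matrixP => k j; rewrite !mxE /= eq_sym (negbTE (neq_lift _ _)).
by apply: (determinant_alternate ij) => k; rewrite !mxE vij.
Qed.

End AltForms.

Section ThreeForm.
Variables (R : realType) (J : set R) (I : R -> R).
Hypotheses (J_open : open J) (I_smooth : smooth_function J I).
Local Notation dom := (jet_domain J).

Lemma pull_linear (f : 'M[R]_(7, 5)) (a : 'rV[R]_5 -> Defs.form R 1 5) P :
  linear_form (a (P *m f)) -> linear_form (pull_form f a P).
Proof.
by move=> al c x y; rewrite /pull_form -al; congr (a _ _); apply/funext => i;
  rewrite mulmxDl -scalemxAl.
Qed.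

Lemma altform_Phit P : altform (Phit_ I P).
Proof.
have lt := dcoord_linear (R := R) (t_index 5).
have lr := dcoord_linear (R := R) (rho_index 5).
have l1 := pull_linear (omega1_linear (P *m ambient_proj R 5)).
have l2 := pull_linear (omega2_linear I (P *m ambient_proj R 5)).
have l3 := pull_linear (omega3_linear (P *m ambient_proj R 5)).
have l4 := pull_linear (a := @omega4 R) (P := P) (f := ambient_proj R 5)
    (@dcoord_linear R _ iq).
have l5 := pull_linear (a := @omega5 R) (P := P) (f := ambient_proj R 5)
    (@dcoord_linear R _ ix).
rewrite /Phit_; apply: altformZ.
by do !(apply: altform_wedge111 || apply: altformD || apply: altformN ||
  apply: altformZ).
Qed.

Section Evaluation.
Variables (par : nat -> R) (P : 'rV[R]_7).
Hypotheses (par0 : par 0%N = C_ R) (WP : dom P).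
Local Notation env := (jet_env I par).
Let e01 : env P 0%N * env P 1%N = 1 := jet_env01 I par WP.

(** Vectors too may have polynomial components: this covers coordinate vectors,
    parameters, and Levi-Civita derivatives. *)
Lemma poly_apply_eval (a : Defs.form R 1 7) c w (v : 'rV[R]_7) : covec I par P a c ->
  (forall k, (k < 7)%N -> v 0 (inord k) = peval (env P) (w k)) ->
  a (fun=> v) = peval (env P) (poly_apply c w).
Proof.
move=> -> vw; rewrite peval_psum7; apply: eq_big_seq => k.
by rewrite mem_iota => k7; rewrite vw// (pevalM e01).
Qed.

Lemma poly_wedge_eval (a b c : Defs.form R 1 7) sa sb sc u (w : 'I_3 -> 'rV[R]_7) :
  covec I par P a sa -> covec I par P b sb -> covec I par P c sc ->
  (forall m k, (m < 3)%N -> (k < 7)%N ->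
     w (inord m) 0 (inord k) = peval (env P) (u m k)) ->
  (a \wedge b \wedge c) w = peval (env P) (poly_wedge sa sb sc u).
Proof.
move=> ca cb cc wu; rewrite wedge111E /poly_wedge; cbv zeta.
rewrite !(pevalD, pevalN, pevalM e01).
have S f sf m : (m < 3)%N -> covec I par P f sf ->
    f (fun=> w (inord m)) = peval (env P) (poly_apply sf (u m)).
  by move=> m3 cf; apply: (poly_apply_eval cf) => k k7; rewrite wu.
by rewrite !(S _ _ _ _ ca)// !(S _ _ _ _ cb)// !(S _ _ _ _ cc).
Qed.

Lemma Phit_eval u (w : 'I_3 -> 'rV[R]_7) :
  (forall m k, (m < 3)%N -> (k < 7)%N ->
     w (inord m) 0 (inord k) = peval (env P) (u m k)) ->
  Phit_ I P w = peval (env P) (poly_Phit u).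
Proof.
move=> wu.
have o1 := covec_omega1 e01; have o2 := covec_omega2 J_open I_smooth par WP.
have o3 := covec_omega3 e01; have o4 := @covec_omega4 _ I par P.
have o5 := @covec_omega5 _ I par P; have ot := @covec_dt _ I par P.
have or := @covec_drho _ I par P.
rewrite /Phit_ !fctE t_coordE rho_coordE.
rewrite (poly_wedge_eval ot o1 o2 wu) (poly_wedge_eval ot o3 or wu).
rewrite (poly_wedge_eval o1 o3 o4 wu) (poly_wedge_eval o1 o3 o5 wu).
rewrite (poly_wedge_eval o1 o5 or wu) (poly_wedge_eval o2 o3 o5 wu).
rewrite (poly_wedge_eval o4 o5 or wu) (poly_wedge_eval ot o1 o5 wu).
rewrite (poly_wedge_eval ot o4 o5 wu).
rewrite /poly_Phit; move: poly_wedge => S.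
rewrite !(pevalD, pevalN, pevalM e01, peval_nat, peval_var) /vjet /vpar.
rewrite jet_env_jet jet_env_par par0 /I_ !ambient_projE /=.
rewrite /GRing.scale /=; ring.
Qed.

End Evaluation.
End ThreeForm.

(** * Parallelism and the induced metric *)

Section Parallel.
Variables (R : realType) (J : set R) (I : R -> R).
Hypotheses (J_open : open J) (I_smooth : smooth_function J I).
Local Notation dom := (jet_domain J).

(** [poly_cov_deriv] is the covariant derivative for an arbitrary direction and
    arbitrary constant arguments, and its normal form is zero. *)
Lemma Phit_parallel : parallel_form (gt_ I) dom (Phit_ I).
Proof.
move=> P v w WP; rewrite /cov_deriv.
pose par k : R := if k == 0%N then C_ R else if (k < 8)%N then v 0 (inord k.-1)
  else w (inord ((k - 8) %/ 7)) 0 (inord ((k - 8) %% 7)).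
have par0 : par 0%N = C_ R by [].
have argE Q m k : (m < 3)%N -> (k < 7)%N ->
    w (inord m) 0 (inord k) = peval (jet_env I par Q) (arg_var m k).
  move=> m3 k7; rewrite peval_var jet_env_par /par -(addnA 8 (7 * m)%N k) addKn /= mulnC.
  by rewrite divnMDl// divn_small// addn0 modnMDl modn_small.
have dirE Q k : (k < 7)%N -> v 0 (inord k) = peval (jet_env I par Q) (dir_var k).
  by move=> k7; rewrite peval_var jet_env_par /par /= ltnS k7.
have e01 := jet_env01 I par WP.
have E Q : dom Q -> Phit_ I Q w = peval (jet_env I par Q) (poly_Phit arg_var).
  by move=> WQ; apply: (Phit_eval J_open) => // m k; exact: argE.
have -> : 'D_v (fun Q => Phit_ I Q w) P =
    peval (jet_env I par P) (pder (jet_der dir_var) (poly_Phit arg_var)).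
  rewrite (near_eq_derive _ (near_open (open_jet_domain J_open) WP E)).
  by have /@derive_val := derive_jet I_smooth (poly_Phit arg_var) WP (dirE P).
rewrite (eq_bigr (fun a : 'I_3 => peval (jet_env I par P)
    (poly_Phit (fun b =>
       if b == a :> nat then poly_levi_civita (arg_var a) else arg_var b)))).
  rewrite -(peval_psum_iota _ 3 (fun a =>
    poly_Phit (fun b => if b == a then poly_levi_civita (arg_var a) else arg_var b))).
  by rewrite -pevalN -pevalD; apply: (@pzeroP _ _ poly_cov_deriv); vm_compute.
move=> a _; apply: (Phit_eval J_open) => // m k m3 k7 /=.
rewrite -val_eqE /= inordK//; case: eqP => [ma|_]; last exact: argE.
rewrite mxE /poly_levi_civita memo1E// peval_psum7 sum_iota7; apply: eq_bigr => i _.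
rewrite peval_psum7 sum_iota7; apply: eq_bigr => j _.
rewrite !(pevalM e01) (christoffel_eval J_open I_smooth par)// inordK//.
rewrite -(dirE P)// -(argE P a j)// !inord_val.
by [].
Qed.

Lemma signed_eval (e : nat -> R) b p : peval e (signed b p) = (-1) ^+ b * peval e p.
Proof. by case: b; rewrite /= ?pevalN ?expr1 ?mulN1r ?expr0 ?mul1r. Qed.

Lemma C_gt0 : 0 < C_ R.
Proof. by rewrite mulr_gt0// powR_gt0. Qed.

(** This is the value for which det gt is the square of the volume. *)
Lemma C_expr6 : C_ R ^+ 6 = 288^-1.
Proof.
rewrite /C_ exprMn -!powR_mulrn ?powR_ge0// -!powRrM.
have -> : - (5 / 6) * 6%:R = - 5%:R :> R by field.
have -> : - (1 / 3) * 6%:R = - 2%:R :> R by field.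
by rewrite !powRN !powR_mulrn//; field.
Qed.

Section AtPoint.
Variables (P : 'rV[R]_7) (WP : dom P).
Let par : nat -> R := fun=> C_ R.
Local Notation env := (jet_env I par P).
Let e01 : env 0%N * env 1%N = 1 := jet_env01 I par WP.

Lemma Phit_comp (a b c : 'I_7) (w : 'I_3 -> 'rV[R]_7) :
  w (inord 0) = delta_mx 0 a -> w (inord 1) = delta_mx 0 b ->
  w (inord 2) = delta_mx 0 c -> Phit_ I P w = peval env (poly_Phit_comp a b c).
Proof.
move=> wa wb wc; rewrite /poly_Phit_comp memo3E ?ltn_ord//.
apply: (Phit_eval J_open) => // m k m3 k7.
case: m m3 => [|[|[|//]]] _ /=; rewrite ?(wa, wb, wc) peval_delta mxE eqxx /=;
  by rewrite -val_eqE /= inordK// eq_sym.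
Qed.

(** The volume of Phit, which is also the factor of proportionality between its
    form matrix and the metric. *)
Definition volume_factor : R := 54 * C_ R ^+ 3 * P 0 (inord 0) ^+ 6.

(** Each entry is a signed sum over the 5040 arrangements of the seven coordinate
    vectors, of products of three components of Phit. *)
Lemma form_matrix_Phit : form_matrix (Phit_ I P) = volume_factor *: gt_ I P.
Proof.
apply/matrixP => i j; rewrite [LHS]mxE mxscaleE (gt_eval J_open I_smooth par WP).
transitivity (peval env (poly_form_matrix i j)); last first.
  transitivity (peval env (pnat 54 * vpar 0 * vpar 0 * vpar 0
      * vt * vt * vt * vt * vt * vt * poly_gt i j)%S); last first.
    rewrite !(pevalD, pevalN, pevalM e01, peval_nat, peval_var) jet_env_par.
    by rewrite /= /par /volume_factor; ring.
  apply: pzeroBP; suff: all7 (fun i => all7 (fun j => pzero (poly_form_matrix i j -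
      pnat 54 * vpar 0 * vpar 0 * vpar 0 * vt * vt * vt * vt * vt * vt
      * poly_gt i j)%S)) by move=> /all7P/(_ i)/all7P/(_ j).
  by vm_compute.
pose F (l : seq nat) : R :=
  peval env (poly_Phit_comp i (nth 0%N l 0) (nth 0%N l 1)) *
  peval env (poly_Phit_comp j (nth 0%N l 2) (nth 0%N l 3)) *
  peval env (poly_Phit_comp (nth 0%N l 4) (nth 0%N l 5) (nth 0%N l 6)).
rewrite /poly_form_matrix (pevalM e01) peval_frac// mul1r peval_sum big_map.
rewrite /top_coef wedge_wedgeE; congr (_ * _).
transitivity (\sum_(a <- sperms 7 (iota 0 7)) (-1) ^+ a.1 * F a.2); last first.
  by apply: eq_bigr => a _; rewrite signed_eval !(pevalM e01).
rewrite -sum_perm_seq; apply: eq_bigr => s _; congr (_ * _).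
have N k (k7 : (k < 7)%N) := nth_perm_seq s (Ordinal k7).
rewrite /F (N 0%N isT) (N 1%N isT) (N 2%N isT) (N 3%N isT) (N 4%N isT).
rewrite (N 5%N isT) (N 6%N isT).
have i0 : inord 0 = ord0 :> 'I_3 by apply: ord_inj; rewrite inordK.
have i1 : inord 1 = lift ord0 (0 : 'I_2) :> 'I_3 by apply: ord_inj; rewrite inordK.
have i2 : inord 2 = lift ord0 (1 : 'I_2) :> 'I_3 by apply: ord_inj; rewrite inordK.
congr (_ * _ * _); apply: Phit_comp; rewrite ?(i0, unlift_none)// ?(i1, i2) ?liftK;
  by congr (delta_mx 0 (s _)); exact: ord_inj.
Qed.

Lemma det_gt : \det (gt_ I P) = volume_factor ^+ 2.
Proof.
transitivity (peval env poly_det_gt).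
  rewrite peval_sum big_map.
  pose F (l : seq nat) : R := \prod_(i <- iota 0 7) peval env (poly_gt i (nth 0%N l i)).
  transitivity (\sum_(a <- sperms 7 (iota 0 7)) (-1) ^+ a.1 * F a.2).
    rewrite -sum_perm_seq; apply: eq_bigr => s _; congr (_ * _).
    rewrite /F -[iota 0 7]/(index_iota 0 7) big_mkord; apply: eq_bigr => i _.
    by rewrite nth_perm_seq (gt_eval J_open I_smooth par WP).
  apply: eq_bigr => a _; rewrite signed_eval; congr (_ * _); rewrite /F.
  elim: (iota 0 7) => [|k l IH]; first by rewrite big_nil peval_nat.
  by rewrite big_cons /= (pevalM e01) IH.
transitivity (peval env (pfrac 81 8 * (vt * vt * vt * vt * vt * vt
                                        * (vt * vt * vt * vt * vt * vt)))%S).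
  by apply: pzeroBP; vm_compute.
rewrite !(pevalM e01) peval_frac// peval_var /= /volume_factor.
transitivity (2916 * C_ R ^+ 6 * P 0 (inord 0) ^+ 12); last by ring.
by rewrite C_expr6; field.
Qed.

Lemma volume_factor_gt0 : 0 < volume_factor.
Proof.
have [t0 _] := WP.
by rewrite /volume_factor !mulr_gt0// exprn_gt0// C_gt0.
Qed.

(** Both sides have the same ninth power, and x |-> x^9 is injective. *)
Lemma vol_Phit : vol (Phit_ I P) = volume_factor.
Proof.
have k0 := volume_factor_gt0.
have E : vol (Phit_ I P) ^+ 9 = volume_factor ^+ 9.
  by rewrite volE form_matrix_Phit detZ det_gt -exprD.
have v0 : 0 < vol (Phit_ I P).
  by rewrite -(@exprn_odd_gt0 _ 9)// E exprn_gt0.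
by apply/eqP; rewrite -(@eqrXn2 _ 9) ?ltW// E.
Qed.

Lemma H_Phit : H (Phit_ I P) = gt_ I P.
Proof.
rewrite /H vol_Phit form_matrix_Phit scalerA mulVf ?scale1r//.
by rewrite gt_eqF// volume_factor_gt0.
Qed.

End AtPoint.
End Parallel.

(** * The normal form of the three-form *)

Section SplitGeneric.
Variables (R : realType) (J : set R) (I : R -> R).
Hypotheses (J_open : open J) (I_smooth : smooth_function J I).
Variables (P : 'rV[R]_7) (WP : jet_domain J P).
Let par : nat -> R := fun=> 0.
Local Notation env := (jet_env I par P).
Let e01 : env 0%N * env 1%N = 1 := jet_env01 I par WP.

(** The covectors W2, d(t rho), W4, w3, dt, w1, w5, ordered so that the five terms
    of Phit involve the index sets 156, 245, 346, 147 and 237 of the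
    split-generic model. *)
Definition adapted_coframe (a : nat) : nat -> spoly :=
  nth (fun=> [::])
    [:: memo1 (fun k => poly_omega2 k + pfrac 2 9 * vjet 0 * vrho * poly_omega5 k)%S;
        memo1 (fun k => vrho * poly_dt k + vt * poly_drho k)%S;
        memo1 (fun k => poly_omega4 k - vjet 0 * poly_omega1 k
          - pfrac 10 3 * vjet 0 * vp * poly_omega5 k)%S;
        poly_omega3; poly_dt; poly_omega1; poly_omega5] a.

(** The frame dual to [adapted_coframe]. *)
Definition adapted_frame (a : nat) : nat -> spoly :=
  nth (fun=> [::])
    [:: frame2; memo1 (fun k => vtinv * pdelta 6 k)%S; frame4; frame3;
        memo1 (fun k => pdelta 0 k - vtinv * vrho * pdelta 6 k)%S; null1; null5] a.

Definition adapted_mx : 'M[R]_7 := \matrix_(i, a) peval env (adapted_coframe a i).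

Lemma adapted_mx_unit : adapted_mx \in unitmx.
Proof.
pose B : 'M[R]_7 := \matrix_(a, i) peval env (adapted_frame a i).
have /mulmx1_unit[] // : B *m adapted_mx = 1%:M.
apply/matrixP => i j; rewrite !mxE -(peval_delta env).
transitivity (peval env (psum7 (fun k =>
    adapted_frame i k * adapted_coframe j k)%S)).
  rewrite peval_psum7 sum_iota7; apply: eq_bigr => k _.
  by rewrite !mxE (pevalM e01).
apply: pzeroBP; suff: all7 (fun i => all7 (fun j => pzero (psum7 (fun k =>
    adapted_frame i k * adapted_coframe j k) - pdelta i j)%S)).
  by move=> /all7P/(_ i)/all7P/(_ j).
by vm_compute.
Qed.

Lemma split_generic_Phit : split_generic (Phit_ I P).
Proof.
have [t0 _] := WP; have C0 := C_gt0 R.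
pose t := P 0 (inord 0); pose C := C_ R.
pose s := Num.sqrt (6 : R); pose r := Num.sqrt (2 : R).
have s0 : s != 0 by rewrite gt_eqF// sqrtr_gt0.
have r0 : r != 0 by rewrite gt_eqF// sqrtr_gt0.
have tn0 : t != 0 by rewrite gt_eqF.
have Cn0 : C != 0 by rewrite gt_eqF.
(* The five products of scale factors prescribed by the model determine the
   cube of the factor - mu t of w3. *)
pose mu := (2 * C * s * r ^+ 2) `^ 3^-1.
have k0 : 0 < 2 * C * s * r ^+ 2.
  by rewrite !mulr_gt0// ?exprn_gt0// sqrtr_gt0.
have mu3 : mu ^+ 3 = 2 * C * s * r ^+ 2.
  by rewrite -powR_mulrn ?powR_ge0// -powRrM mulVf ?powRr1// ltW.
have mu0 : mu != 0 by rewrite gt_eqF// powR_gt0.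
pose la := 9 * C * t ^+ 2 * s / r.
pose ld := 2 * C * s / mu.
pose lh := 3 * C * t ^+ 2 * s / mu.
pose ll := - (mu * t).
pose lb := - (r / (3 * mu)).
have E1 : s^-1 * r * la = 9 * C * t ^+ 2 by rewrite /la; field; rewrite s0 r0.
have E2 : s^-1 * (ld * ll) = - (2 * C * t) by rewrite /ld /ll; field; rewrite s0 mu0.
have E3 : s^-1 * (lh * ll) = - (3 * C * t ^+ 3).
  by rewrite /lh /ll; field; rewrite s0 mu0.
have E4 : s^-1 * (la * ll * lb) = 3 * C * t ^+ 3.
  by rewrite /la /ll /lb; field; rewrite s0 r0 mu0.
have E5 : s^-1 * r * (ld * lh * lb) = - (C * t ^+ 2).
  transitivity (- (2 * C ^+ 2 * t ^+ 2 * s * r ^+ 2 / mu ^+ 3)).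
    by rewrite /ld /lh /lb; field; rewrite s0 mu0.
  by rewrite mu3; field; rewrite Cn0 s0 r0.
pose D : 'rV[R]_7 := \row_a nth 0 [:: la; ld; lh; ll; 1; 1; lb] a.
exists (adapted_mx *m diag_mx D).
  rewrite unitmx_mul adapted_mx_unit unitmxE det_diag unitfE /=.
  apply/prodf_neq0 => a _; rewrite mxE.
  case: a => -[|[|[|[|[|[|[|//]]]]]]] _ /=; rewrite ?oner_eq0// ?oppr_eq0;
    by rewrite ?(mulf_neq0, invr_neq0, expf_neq0, pnatr_eq0).
cbv zeta; apply/funext => w.
set A := adapted_mx *m _.
have cE a v : (a < 7)%N -> coframe A (inord a) (fun=> v) =
    D 0 (inord a) * \sum_(k <- iota 0 7)
      v 0 (inord k) * peval env (adapted_coframe a k).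
  move=> a7; rewrite /coframe /A mulmxA mul_mx_diag [LHS]mxE mulrC; congr (_ * _).
  rewrite mxE sum_iota7; apply: eq_bigr => k _.
  by rewrite mxE inordK// inord_val.
have o1 := covec_omega1 e01; have o2 := covec_omega2 J_open I_smooth par WP.
have o3 := covec_omega3 e01; have o4 := @covec_omega4 _ I par P.
have o5 := @covec_omega5 _ I par P; have ot := @covec_dt _ I par P.
have or := @covec_drho _ I par P.
pose Iu := I (P 0 (inord 1)); pose p := P 0 (inord 3); pose rho := P 0 (inord 6).
pose w1 v := pull_form (ambient_proj R 5) (@omega1 R) P (fun=> v).
pose w2 v := pull_form (ambient_proj R 5) (omega2 I) P (fun=> v).
pose w3 v := pull_form (ambient_proj R 5) (@omega3 R) P (fun=> v).
pose w4 v := pull_form (ambient_proj R 5) (@omega4 R) P (fun=> v).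
pose w5 v := pull_form (ambient_proj R 5) (@omega5 R) P (fun=> v).
pose wt v := dt (R := R) (fun=> v); pose wr v := drho (R := R) (fun=> v).
have DE a : (a < 7)%N -> D 0 (inord a) = nth 0 [:: la; ld; lh; ll; 1; 1; lb] a.
  by move=> a7; rewrite mxE inordK.
have c1 v : coframe A (inord 0) (fun=> v) = la * (w2 v + 2 / 9 * Iu * rho * w5 v).
  rewrite cE// DE//; congr (_ * _); rewrite /w2 o2 /w5 o5 mulr_sumr -big_split.
  apply: eq_big_seq => k; rewrite mem_iota => k7; rewrite /adapted_coframe /= memo1E//.
  rewrite !(pevalD, pevalN, pevalM e01, peval_var) peval_frac// /vjet jet_env_jet.
  by rewrite /Iu /rho /=; ring.
have c2 v : coframe A (inord 1) (fun=> v) = ld * (rho * wt v + t * wr v).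
  rewrite cE// DE//; congr (_ * _); rewrite /wt ot /wr or !mulr_sumr -big_split.
  apply: eq_big_seq => k; rewrite mem_iota => k7; rewrite /adapted_coframe /= memo1E//.
  rewrite !(pevalD, pevalN, pevalM e01, peval_var).
  by rewrite /t /rho /=; ring.
have c3 v : coframe A (inord 2) (fun=> v) =
    lh * (w4 v - Iu * w1 v - 10 / 3 * Iu * p * w5 v).
  rewrite cE// DE//; congr (_ * _); rewrite /w4 o4 /w1 o1 /w5 o5 !mulr_sumr.
  rewrite -!sumrN -!big_split.
  apply: eq_big_seq => k; rewrite mem_iota => k7; rewrite /adapted_coframe /= memo1E//.
  rewrite !(pevalD, pevalN, pevalM e01, peval_var) peval_frac// /vjet jet_env_jet.
  by rewrite /Iu /p /=; ring.
have c4 v : coframe A (inord 3) (fun=> v) = ll * w3 v by rewrite cE// DE// /w3 o3.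
have c5 v : coframe A (inord 4) (fun=> v) = wt v.
  by rewrite cE// DE// mul1r /wt ot.
have c6 v : coframe A (inord 5) (fun=> v) = w1 v.
  by rewrite cE// DE// mul1r /w1 o1.
have c7 v : coframe A (inord 6) (fun=> v) = lb * w5 v by rewrite cE// DE// /w5 o5.
rewrite /Phit_ !fctE t_coordE rho_coordE !wedge111E /=.
rewrite !c1 !c2 !c3 !c4 !c5 !c6 !c7 -/(w1 _) -/(w2 _) -/(w3 _).
rewrite -!/(w1 _) -!/(w2 _) -!/(w3 _) -!/(w4 _) -!/(w5 _) -!/(wt _) -!/(wr _).
rewrite -[Num.sqrt 6]/s -[Num.sqrt 2]/r /I_ !ambient_projE -!/t -/Iu -/p -!/rho -/C.
move: (w (inord 0)) (w (inord 1)) (w (inord 2)) => v0 v1 v2.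
pose T (f g h : 'rV[R]_7 -> R) :=
  f v0 * g v1 * h v2 - f v0 * g v2 * h v1 - f v1 * g v0 * h v2
  + f v1 * g v2 * h v0 + f v2 * g v0 * h v1 - f v2 * g v1 * h v0.
pose W2 v := w2 v + 2 / 9 * Iu * rho * w5 v.
pose Wr v := rho * wt v + t * wr v.
pose W4 v := w4 v - Iu * w1 v - 10 / 3 * Iu * p * w5 v.
clearbody la ld lh ll lb s r.
(* The five terms of the model, each reordered as in the normal form of Phit. *)
transitivity (- (s^-1 * r * la) * T W2 wt w1 - s^-1 * (ld * ll) * T Wr w3 wt
  - s^-1 * (lh * ll) * T W4 w3 w1 + s^-1 * (la * ll * lb) * T W2 w3 w5
  - s^-1 * r * (ld * lh * lb) * T Wr W4 w5); last first.
  by rewrite /T /W2 /Wr /W4 /GRing.scale /=; ring.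
rewrite E1 E2 E3 E4 E5 /T /W2 /Wr /W4 /GRing.scale /=.
by field.
Qed.

End SplitGeneric.

(** * Directional derivatives of smooth functions *)

Section ContinuousPartials.
Variables (R : realType) (n : nat).

(** The mean value theorem on the segment from 0 to b, for b of either sign. *)
Lemma mean_value_zero (phi dphi : R -> R) (b : R) :
  (forall s : R, `|s| <= `|b| -> is_derive s 1 phi (dphi s)) ->
  exists2 s, `|s| <= `|b| & phi b - phi 0 = dphi s * b.
Proof.
move=> D.
have cont (x y : R) : (forall s, s \in `[x, y]%R -> `|s| <= `|b|) ->
    {within `[x, y], continuous phi}.
  move=> xy; apply: derivable_within_continuous => s /xy sb.
  by have [] := D _ sb.
case: (lerP 0 b) => b0.
  have sub s : s \in `[0, b]%R -> `|s| <= `|b|.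
    by rewrite in_itv /= => /andP[s0 sb]; rewrite !ger0_norm.
  have [|s sI] := @MVT_segment R phi dphi 0 b b0 _ (cont _ _ sub).
    by move=> s sI; apply: D; apply: sub; apply: subset_itv_oo_cc sI.
  by rewrite subr0 => E; exists s => //; exact: sub.
have sub s : s \in `[b, 0]%R -> `|s| <= `|b|.
  by rewrite in_itv /= => /andP[sb s0]; rewrite !ler0_norm ?lerN2// ltW.
have [|s sI] := @MVT_segment R phi dphi b 0 (ltW b0) _ (cont _ _ sub).
  by move=> s sI; apply: D; apply: sub; apply: subset_itv_oo_cc sI.
rewrite sub0r mulrN => E; exists s; first exact: sub.
by rewrite -(opprK (dphi s * b)) -E opprB.
Qed.

Variables (W : set 'rV[R]_n) (f : 'rV[R]_n -> R).
Hypotheses (W_open : open W) (f_smooth : smooth_on W f).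

(** In f(x + h(c e_i + w)) - f(x), the increment in the direction e_i is, by the
    mean value theorem, h c times the partial derivative of f at a point that
    tends to x with h. *)
Lemma is_derive_add_coord x w df c i : W x -> is_derive x w f df ->
  is_derive x (c *: delta_mx 0 i + w) f (c * partial i f x + df).
Proof.
move=> Wx [wd wdf]; set e := delta_mx 0 i.
have pd y : W y -> is_derive y e f (partial i f y).
  by move=> Wy; have [_ yd] := f_smooth [::] Wy; exact: DeriveDef (yd i) _.
suff C : h^-1 *: ((f \o shift x) (h *: (c *: e + w)) - f x) @[h --> 0^'] -->
    c * partial i f x + df.
  by apply: DeriveDef; [apply/cvg_ex; eexists; exact: C|exact: cvg_lim C].
have C2 : h^-1 *: ((f \o shift x) (h *: w) - f x) @[h --> 0^'] --> df.
  by rewrite -wdf; exact: wd.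
suff C1 : h^-1 *: (f (h *: (c *: e + w) + x) - f (h *: w + x)) @[h --> 0^'] -->
    c * partial i f x.
  apply: cvg_trans (cvgD C1 C2); apply: near_eq_cvg; near=> h.
  by rewrite !fctE /= -scalerDr addrA subrK.
have pc : partial i f y @[y --> x] --> partial i f x.
  by have [] := f_smooth [:: i] Wx.
apply/cvgrPdist_lt => eps eps0.
have eps' : 0 < eps / (`|c| + 1) by rewrite divr_gt0// ltr_wpDl.
have /nbhs_ballP[d /= d0 dW] : \forall y \near x,
    W y /\ `|partial i f x - partial i f y| < eps / (`|c| + 1).
  near=> y; split; near: y; first exact: open_nbhs_nbhs.
  by move/cvgrPdist_lt: pc; apply.
pose K := `|w| + `|c| * `|e| + 1.
have K0 : 0 < K by rewrite ltr_wpDl// addr_ge0// mulr_ge0.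
near=> h.
have h0 : h != 0 by near: h; exact: nbhs_dnbhs_neq.
have hd : `|h| < d / K by near: h; apply: dnbhs0_lt; exact: divr_gt0.
have near_x s : `|s| <= `|h * c| -> ball x d (s *: e + (h *: w + x)).
  move=> shc; rewrite -ball_normE /= addrA opprD addrCA subrr addr0 normrN.
  apply: le_lt_trans (ler_normD _ _) _; rewrite !normrZ.
  apply: (@le_lt_trans _ _ (`|h| * (`|w| + `|c| * `|e|))).
    rewrite mulrDr addrC lerD2l mulrA -normrM.
    exact: ler_wpM2r.
  apply: (@le_lt_trans _ _ (`|h| * K)); first by rewrite ler_wpM2l// lerDl.
  by rewrite -ltr_pdivlMr.
pose L (s : R) := s *: e + (h *: w + x).
have [|s sb E] := @mean_value_zero (f \o L) (fun s => partial i f (L s)) (h * c).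
  move=> s sb; have [Ws _] := dW _ (near_x _ sb); have [pdd pdE] := pd _ Ws.
  have line r : L (r *: 1 + s) = r *: e + L s.
    by rewrite /L [r *: 1]mulr1 scalerDl -addrA.
  have [D1 D2] := derive_along_line f line.
  by apply: DeriveDef; [exact: D2 | rewrite D1].
have -> : h^-1 *: (f (h *: (c *: e + w) + x) - f (h *: w + x)) =
    c * partial i f (L s).
  have -> : f (h *: (c *: e + w) + x) - f (h *: w + x) = (f \o L) (h * c) - (f \o L) 0.
    by rewrite /= /L scale0r add0r scalerDr scalerA addrA.
  by rewrite E /GRing.scale /= mulrCA mulKf// mulrC.
have [_ ps] := dW _ (near_x _ sb).
rewrite -mulrBr normrM; apply: (@le_lt_trans _ _ (`|c| * (eps / (`|c| + 1)))).
  by rewrite ler_wpM2l// ltW.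
rewrite mulrCA gtr_pMr// ltr_pdivrMr ?ltr_wpDl//.
by rewrite mul1r ltrDl.
Unshelve. all: by end_near. Qed.

(** Partial derivatives give the derivative along a vector once they are
    continuous; the vector is built up one coordinate at a time. *)
Lemma is_derive_smooth x v : W x ->
  is_derive x v f (\sum_i v 0 i * partial i f x).
Proof.
move=> Wx; rewrite {1}(row_sum_delta v).
elim: (index_enum _) => [|i s IH]; last first.
  by rewrite !big_cons; exact: is_derive_add_coord.
by rewrite !big_nil; exact: is_derive0.
Qed.

End ContinuousPartials.

(** * The metric on the base *)

(** Restricting a bilinear form to coordinate vectors selects entries. *)
Lemma sandwich_delta (R : realType) m n (S : 'M[R]_(m, n)) (sigma : 'I_m -> 'I_n)
    (X : 'M[R]_n) : (forall i, row i S = delta_mx 0 (sigma i)) ->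
  forall i j, (S *m X *m S^T) i j = X (sigma i) (sigma j).
Proof.
move=> Sd i j.
have E p (Y : 'M[R]_(n, p)) k : row k (S *m Y) = row (sigma k) Y.
  by rewrite row_mul Sd -rowE.
have rE p (Y : 'M[R]_(m, p)) k l : Y k l = row k Y 0 l by rewrite mxE.
rewrite -mulmxA rE E mxE -[X in X *m S^T]trmxK -trmx_mul mxE rE E.
by rewrite mxE mxE.
Qed.

Section OnTheBase.
Variables (R : realType) (J : set R) (I : R -> R).
Hypotheses (J_open : open J) (I_smooth : smooth_function J I).
Local Notation dom := (jet_domain J).
Local Notation M := (M_ J).

Lemma slice_mx_proj : slice_mx R *m ambient_proj R 5 = 1%:M.
Proof.
apply/row_matrixP => i; rewrite row_mul row_slice_mx; apply/rowP => k.
rewrite ambient_projE row1 !mxE !eqxx /= -!val_eqE /= !inordK//.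
by rewrite ltnS (leq_trans (ltn_ord _)).
by rewrite ltnS (leq_trans (ltn_ord _)).
Qed.

Lemma M_slice u : M u <-> dom (slice u).
Proof.
split; first exact: slice_domain.
by case=> _; rewrite slice_coord// inord5.
Qed.

Lemma open_M : open M.
Proof.
apply: (@open_comp _ _ (fun u : 'rV[R]_5 => u 0 ix) J) => // u _.
exact: coord_continuous.
Qed.

Section Evaluated.
Variable par : nat -> R.
Local Notation env u := (jet_env I par (slice u)).

Lemma env_slice01 u : env u 0%N * env u 1%N = 1.
Proof. by rewrite /= slice_t invr1 mulr1. Qed.

Lemma smooth_slice F p : (forall u, M u -> F u = peval (env u) p) -> smooth_on M F.
Proof.
move=> Fp; apply: (eq_smooth_on open_M (fun u Mu => esym (Fp u Mu))).
have S := smooth_jet J_open I_smooth (par := par) (p := p) (fun P _ => erefl).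
have := smooth_on_affine (f := slice_mx R) (b := slice_base R) (@row_slice_mx R) S.
rewrite (_ : affine _ _ @^-1` _ = M)//.
by apply/seteqP; split => u /M_slice.
Qed.

Lemma derive_slice p V u v : M u ->
  (forall j, (j < 7)%N -> (v *m slice_mx R) 0 (inord j) = peval (env u) (V j)) ->
  'D_v (fun u => peval (env u) p) u = peval (env u) (pder (jet_der V) p).
Proof.
move=> /slice_domain Wu vV.
have := derive_affine (slice_base R) (slice_mx R) (fun P => peval (jet_env I par P) p) u v.
by have /@derive_val <- := derive_jet I_smooth p Wu vV.
Qed.

Lemma g_eval u (i j : 'I_5) : M u -> g_ I u i j = peval (env u) (poly_g i.+1 j.+1).
Proof.
move=> /slice_domain Wu.
have := pull_g_eval J_open I_smooth par Wu (inord i.+1) (inord j.+1).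
have i7 (k : 'I_5) : (k.+1 < 7)%N by rewrite ltnS (ltn_trans (ltn_ord k)).
rewrite !inordK// => <-.
rewrite -(sandwich_delta _ (@row_slice_mx R)) /pull_metric slice_proj.
rewrite !mulmxA slice_mx_proj mul1mx -!mulmxA -trmx_mul slice_mx_proj.
by rewrite trmx1 mulmx1.
Qed.

End Evaluated.

(** Since g = 3 w1 W4 - 3 w2 w5 - 2 w3^2, the sums and differences of dual null
    vectors, together with the dual of w3, are orthogonal.  On the base the dual
    of w5 is [null5] at rho = 0. *)
Definition diag_frame (a : nat) : nat -> spoly :=
  let null5_base := memo1 (fun k => frame5 k + pfrac 10 3 * vjet 0 * vp * frame4 k)%S in
  nth (fun=> [::])
    [:: memo1 (fun k => null1 k + frame4 k)%S;
        memo1 (fun k => frame2 k - null5_base k)%S;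
        memo1 (fun k => null1 k - frame4 k)%S;
        memo1 (fun k => frame2 k + null5_base k)%S; frame3] a.

Definition diag_value (a : nat) : spoly :=
  nth [::] [:: pnat 3; pnat 3; - pnat 3; - pnat 3; - pnat 2]%S a.

(** The orthogonal frame only needs normalising; invertibility of the frame and
    of g itself can be read off from the resulting identity A g A^T = diag. *)
Lemma g_signature u : M u -> has_signature 2 3 (g_ I u) /\
  (g_ I u)^T = g_ I u /\ g_ I u \in unitmx.
Proof.
move=> Mu; pose par : nat -> R := fun=> 0.
have e01 := env_slice01 par u; set e := jet_env I par (slice u) in e01 *.
pose X : 'M[R]_5 := \matrix_(a, i) peval e (diag_frame a i.+1).
pose d : 'rV[R]_5 := \row_a peval e (diag_value a).
have XgX : X *m g_ I u *m X^T = diag_mx d.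
  apply/matrixP => a b.
  transitivity (peval e (psum [seq psum [seq diag_frame a i.+1 * poly_g i.+1 j.+1
      * diag_frame b j.+1 | i <- iota 0 5] | j <- iota 0 5])%S).
    rewrite mxE peval_psum_iota; apply: eq_bigr => j _.
    rewrite peval_psum_iota [(X *m _) _ _]mxE mulr_suml.
    apply: eq_bigr => i _; rewrite !(pevalM e01) (g_eval par)//.
    by rewrite !mxE.
  transitivity (peval e (if a == b :> nat then diag_value a else [::])).
    apply: pzeroBP.
    suff: all (fun a => all (fun b => pzero (psum [seq psum [seq
        diag_frame a i.+1 * poly_g i.+1 j.+1 * diag_frame b j.+1 | i <- iota 0 5]
        | j <- iota 0 5] - (if a == b then diag_value a else [::]))%S)
        (iota 0 5)) (iota 0 5).
      move=> /allP/(_ (a : nat)); rewrite mem_iota ltn_ord => /(_ isT)/allP.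
      by move=> /(_ (b : nat)); rewrite mem_iota ltn_ord; apply.
    by vm_compute.
  rewrite !mxE -val_eqE /=; case: eqP => _; rewrite ?mulr1n//.
  by rewrite peval_nil.
pose eps : 'rV[R]_5 := \row_i (if (i < 2)%N then 1 else -1).
pose s : 'rV[R]_5 := \row_i (Num.sqrt `|d 0 i|)^-1.
pose A := diag_mx s *m X.
have AgA : A *m g_ I u *m A^T = diag_mx eps.
  rewrite /A trmx_mul tr_diag_mx -!mulmxA (mulmxA X) (mulmxA (X *m _)) XgX.
  rewrite !mulmx_diag; apply/matrixP => a b; rewrite !mxE -val_eqE /=.
  case: eqP => [_|]; rewrite ?mulr0n// !mulr1n.
  have E (x : R) : 0 < x -> (Num.sqrt `|x|)^-1 * (x / Num.sqrt `|x|) = 1.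
    move=> x0; rewrite mulrCA -invfM -expr2 sqr_sqrtr// gtr0_norm// divff//.
    by rewrite gt_eqF.
  have EN (x : R) : 0 < x -> (Num.sqrt `|- x|)^-1 * (- x / Num.sqrt `|- x|) = -1.
    by move=> x0; rewrite normrN mulNr mulrN E.
  case: a => -[|[|[|[|[|//]]]]] _ /=; rewrite ?pevalN peval_nat;
    by [rewrite E|rewrite EN].
have A1 : A *m (g_ I u *m A^T *m diag_mx eps) = 1%:M.
  rewrite !mulmxA AgA mulmx_diag; apply/matrixP => a b; rewrite !mxE.
  by case: ifP; rewrite ?mulr1// mulrNN mulr1.
have [Au _] := mulmx1_unit A1.
have [gu _] : g_ I u \in unitmx /\ A^T *m diag_mx eps *m A \in unitmx.
  by apply: mulmx1_unit; rewrite 2!(mulmxA (g_ I u)); exact: mulmx1C A1.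
split; last first.
  split=> //; apply/matrixP => a b; rewrite mxE !(g_eval par)//.
  apply: pzeroBP.
  suff: all (fun a => all (fun b => pzero (poly_g b.+1 a.+1 - poly_g a.+1 b.+1)%S)
      (iota 0 5)) (iota 0 5).
    move=> /allP/(_ (a : nat)); rewrite mem_iota ltn_ord => /(_ isT)/allP.
    by move=> /(_ (b : nat)); rewrite mem_iota ltn_ord; apply.
  by vm_compute.
by split=> //; exists A.
Qed.

Lemma smooth_g i j : smooth_on M (fun u => g_ I u i j).
Proof.
apply: (smooth_slice (par := fun=> 0) (p := poly_g i.+1 j.+1)) => u Mu.
exact: g_eval.
Qed.

Lemma g_conformal_structure : conformal_structure 2 3 M (conformal_class M (g_ I)).
Proof.
exists (g_ I); split=> // [|u /g_signature[]//].
split=> [i j|u /g_signature[_ []]//]; exact: smooth_g.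
Qed.

(** Vector fields with polynomial components; the components with index 0 and 6,
    those along t and rho, are left out. *)
Definition poly_field (s : nat -> spoly) (u : 'rV[R]_5) : 'rV[R]_5 :=
  \row_i peval (jet_env I (fun=> 0) (slice u)) (s i.+1).

Definition poly_tangent (s : nat -> spoly) : bool := pzero (s 0%N) && pzero (s 6).

Definition poly_bracket (s s' : nat -> spoly) (k : nat) : spoly :=
  (pder (jet_der s) (s' k) - pder (jet_der s') (s k))%S.

Lemma smooth_poly_field s : smooth_vector_field M (poly_field s).
Proof.
move=> i; apply: (smooth_slice (par := fun=> 0) (p := s i.+1)) => u Mu.
by rewrite mxE.
Qed.

Lemma poly_field_slice s u : poly_tangent s -> forall j, (j < 7)%N ->
  (poly_field s u *m slice_mx R) 0 (inord j) = peval (jet_env I (fun=> 0) (slice u)) (s j).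
Proof.
move=> /andP[s0 s6] [|j] j7; first by rewrite slice_mx_t pzeroP.
have [->|j5] := eqVneq j 5%N; first by rewrite slice_mx_rho pzeroP.
have {}j5 : (j < 5)%N by rewrite ltn_neqAle j5 -ltnS.
by rewrite slice_mx_coord// mxE inordK.
Qed.

Lemma lie_bracket_poly_field s s' u : poly_tangent s -> poly_tangent s' -> M u ->
  lie_bracket (poly_field s) (poly_field s') u = poly_field (poly_bracket s s') u.
Proof.
move=> Ts Ts' Mu; apply/rowP => i; rewrite !mxE pevalD pevalN.
have D a b : poly_tangent a -> 'D_(poly_field a u) (fun y => poly_field b y 0 i) u =
    peval (jet_env I (fun=> 0) (slice u)) (pder (jet_der a) (b i.+1)).
  move=> Ta; rewrite (_ : (fun y => poly_field b y 0 i) =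
      (fun y => peval (jet_env I (fun=> 0) (slice y)) (b i.+1))).
    exact: derive_slice (poly_field_slice u Ta).
  by apply/funext => y; rewrite mxE.
by rewrite !D.
Qed.

End OnTheBase.

(** * The plane field and its brackets *)

Section PlaneField.
Variables (R : realType) (J : set R) (I : R -> R).
Hypotheses (J_open : open J) (I_smooth : smooth_function J I).
Local Notation M := (M_ J).
Local Notation env u := (jet_env I (fun=> 0) (slice u)).

Definition derived_plane (u : 'rV[R]_5) : set 'rV[R]_5 :=
  [set v | omega1 u (fun=> v) = 0 /\ omega2 I u (fun=> v) = 0].

Definition horizontal (u : 'rV[R]_5) : 'rV[R]_5 :=
  delta_mx 0 ix + u 0 ip *: delta_mx 0 iy + u 0 iq *: delta_mx 0 ip
  - (2^-1 * ((u 0 iq) ^+ 2 + 10 / 3 * I (u 0 ix) * (u 0 ip) ^+ 2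
      + (1 + I (u 0 ix) ^+ 2 - derive1n 2 I (u 0 ix)) * (u 0 iy) ^+ 2))
    *: delta_mx 0 iz.

Lemma horizontalE u : horizontal u =
  delta_mx 0 ix + u 0 ip *: delta_mx 0 iy + u 0 iq *: delta_mx 0 ip
  + F_ I u *: delta_mx 0 iz.
Proof. by rewrite /horizontal /F_ /I_ /I2_ -scaleNr mulNr. Qed.

Lemma row5P (v w : 'rV[R]_5) : v 0 ix = w 0 ix -> v 0 iy = w 0 iy ->
  v 0 ip = w 0 ip -> v 0 iq = w 0 iq -> v 0 iz = w 0 iz -> v = w.
Proof.
move=> ex ey ep eq ez; apply/rowP => -[[|[|[|[|[|//]]]]] k5].
- by rewrite (_ : Ordinal k5 = ix)//; exact: val_inj.
- by rewrite (_ : Ordinal k5 = iy)//; exact: val_inj.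
- by rewrite (_ : Ordinal k5 = ip)//; exact: val_inj.
- by rewrite (_ : Ordinal k5 = iq)//; exact: val_inj.
- by rewrite (_ : Ordinal k5 = iz)//; exact: val_inj.
Qed.

Lemma D_P u v : M u -> D_ I u v <->
  [/\ v 0 iy = u 0 ip * v 0 ix, v 0 ip = u 0 iq * v 0 ix
    & v 0 iz = F_ I u * v 0 ix].
Proof.
move=> Mu; rewrite /D_ /= omega2E omega1E omega3E (partial_F J_open I_smooth (fun=> 0) Mu).
split=> [[/eqP + + /eqP]|[-> -> ->]]; last by split; ring.
rewrite !subr_eq0 => /eqP e1 + /eqP e3; rewrite e3 subrr mulr0 subr0.
by move=> /eqP; rewrite subr_eq0 => /eqP.
Qed.

(** A vector in D is determined by its components along q and x. *)
Lemma D_span u : M u -> D_ I u = plane_span (fun=> delta_mx 0 iq) horizontal u.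
Proof.
move=> Mu; apply/seteqP; split=> v.
  move=> /(D_P _ Mu)[ey ep ez]; apply/submxP.
  exists (row_mx (v 0 iq)%:M (v 0 ix)%:M).
  rewrite mul_row_col !mul_scalar_mx horizontalE.
  by apply: row5P; rewrite !mxE /= ?(ey, ep, ez); ring.
move=> /submxP[c ->]; apply/(D_P _ Mu).
rewrite -[c]hsubmxK mul_row_col [lsubmx c]mx11_scalar [rsubmx c]mx11_scalar.
rewrite !mul_scalar_mx horizontalE; move: (lsubmx c 0 0) (rsubmx c 0 0) => a b.
by split; rewrite !mxE /=; ring.
Qed.

Lemma poly_field_frame4 u : poly_field I frame4 u = delta_mx 0 iq.
Proof. by apply: row5P; rewrite !mxE peval_delta. Qed.

Lemma poly_field_frame5 u : poly_field I frame5 u = horizontal u.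
Proof.
have e01 := env_slice01 I (fun=> 0) u.
have E : peval (env u) poly_F = F_ I u by rewrite -(F_eval e01) slice_proj.
rewrite horizontalE; apply: row5P; rewrite !mxE /frame5 !memo1E//; move: poly_F E => S E;
  by rewrite !(pevalE e01) ?E /= ?slice_coord// ?inord5; ring.
Qed.

Lemma D_plane_field : plane_field M (D_ I).
Proof.
move=> u Mu; exists M, (fun=> delta_mx 0 iq), horizontal; split=> //.
- exact: open_M.
- split; last first.
    by rewrite (_ : horizontal = poly_field I frame5); [exact: smooth_poly_field|
      apply/funext => w; rewrite poly_field_frame5].
  rewrite (_ : (fun=> _) = poly_field I frame4); first exact: smooth_poly_field.
  by apply/funext => w; rewrite poly_field_frame4.
- move=> w Mw; split; last exact: D_span.
  apply/row_freeP.
  exists (row_mx (delta_mx 0 iq : 'rV[R]_5)^T (delta_mx 0 ix : 'rV[R]_5)^T).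
  rewrite mul_col_row [in RHS]scalar_mx_block; congr block_mx;
    apply/matrixP => i j; rewrite !ord1 mxE (bigD1 iq)//= (bigD1 ix)//=
    big1 ?horizontalE ?mxE /= ?mulr0 ?mulr1 ?mul0r ?addr0 ?add0r//.
  all: move=> k /andP[/negbTE kq /negbTE kx].
  all: by rewrite !mxE ?kq ?kx ?andbF ?mulr0 ?mul0r.
Qed.

(** A section of D is X^x (d_x + p d_y + q d_p + F d_z) + X^q d_q.  The Leibniz
    rule then expresses the components of a bracket, and as dF/dq = - q the
    terms outside ker (w1, w2) cancel. *)
Lemma lie_bracket_D X Y u : section_of M (D_ I) X -> section_of M (D_ I) Y ->
  M u -> derived_plane u (lie_bracket X Y u).
Proof.
move=> [sX DX] [sY DY] Mu.
have coord i v : is_derive u v (fun w : 'rV[R]_5 => w 0 i) (v 0 i).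
  exact: is_derive_coord.
have smF : smooth_on M (F_ I).
  apply: (smooth_slice J_open I_smooth (par := fun=> 0) (p := poly_F)) => w Mw.
  by rewrite -(F_eval (env_slice01 I (fun=> 0) w)) slice_proj.
have oM := open_M J_open.
have dF v : is_derive u v (F_ I) (\sum_i v 0 i * partial i (F_ I) u).
  exact: (is_derive_smooth oM smF v Mu).
have dZ (Z : 'rV[R]_5 -> 'rV[R]_5) v i : smooth_vector_field M Z ->
    is_derive u v (fun w => Z w 0 i) ('D_v (fun w => Z w 0 i) u).
  by move=> sZ; apply: DeriveDef => //; have [] := is_derive_smooth oM (sZ i) v Mu.
have prodD (Z : 'rV[R]_5 -> 'rV[R]_5) (f : 'rV[R]_5 -> R) v df i :
    smooth_vector_field M Z -> is_derive u v f df ->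
    (forall w, M w -> Z w 0 i = f w * Z w 0 ix) ->
    'D_v (fun w => Z w 0 i) u = f u * 'D_v (fun w => Z w 0 ix) u + Z u 0 ix * df.
  move=> sZ fd E; rewrite (near_eq_derive _ (near_open oM Mu E)).
  by have /@derive_val := is_deriveM fd (dZ Z v ix sZ).
have ZE Z : section_of M (D_ I) Z -> (forall w, M w -> Z w 0 iy = w 0 ip * Z w 0 ix) /\
    (forall w, M w -> Z w 0 ip = w 0 iq * Z w 0 ix) /\
    (forall w, M w -> Z w 0 iz = F_ I w * Z w 0 ix).
  by move=> [_ DZ]; do !split; move=> w Mw; have /(D_P _ Mw)[] := DZ _ Mw.
have [Xy [Xp Xz]] := ZE X (conj sX DX); have [Yy [Yp Yz]] := ZE Y (conj sY DY).
rewrite /derived_plane /= omega2E omega1E omega3E.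
rewrite (partial_F J_open I_smooth (fun=> 0) Mu) !mxE.
rewrite (prodD _ _ _ _ _ sY (coord ip _) Yy) (prodD _ _ _ _ _ sX (coord ip _) Xy).
rewrite (prodD _ _ _ _ _ sY (coord iq _) Yp) (prodD _ _ _ _ _ sX (coord iq _) Xp).
rewrite (prodD _ _ _ _ _ sY (dF _) Yz) (prodD _ _ _ _ _ sX (dF _) Xz).
have sum5 (F : 'I_5 -> R) : \sum_i F i = F ix + F iy + F ip + F iq + F iz.
  rewrite !big_ord_recl big_ord0 addr0 !addrA.
  by congr (F _ + F _ + F _ + F _ + F _); exact: val_inj.
rewrite !sum5 (partial_F J_open I_smooth (fun=> 0) Mu).
rewrite (Xy _ Mu) (Yy _ Mu) (Xp _ Mu) (Yp _ Mu) (Xz _ Mu) (Yz _ Mu).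
move: ('D_(X u) _ u) ('D_(Y u) _ u) (X u 0 ix) (Y u 0 ix) (X u 0 iq) (Y u 0 iq).
move: (partial ix _ _) (partial iy _ _) (partial ip _ _) (partial iz _ _) (F_ I u).
move: (u 0 ip) (u 0 iq) => p q F Fx Fy Fp Fz dXb dYb a a' b b'.
by split; ring.
Qed.

Lemma derived_plane_sum u k (A : 'M[R]_(k, 5)) v :
  (forall i, derived_plane u (row i A)) -> (v <= A)%MS -> derived_plane u v.
Proof.
move=> Ai /submxP[c ->].
have L (a : Defs.form R 1 5) : linear_form a ->
    (forall i, a (fun=> row i A) = 0) -> a (fun=> c *m A) = 0.
  move=> al a0; have a00 : a (fun=> 0) = 0.
    by rewrite (linear_formE _ al) big1// => i _; rewrite mxE mul0r.
  rewrite mulmx_sum_row; elim/big_ind: _ => // [x y x0 y0|i _].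
    by have := al 1 x y; rewrite scale1r => ->; rewrite x0 y0 mulr0 addr0.
  by have := al (c 0 i) (row i A) 0; rewrite addr0 => ->; rewrite a0 a00 mulr0 addr0.
split; apply: L => [|i]; [exact: omega1_linear| |exact: omega2_linear|];
  by have [] := Ai i.
Qed.

(** A combination of brackets is listed as triples (coefficient, X, Y). *)
Lemma bracket_span (D E : 'rV[R]_5 -> set 'rV[R]_5) u (v : 'rV[R]_5)
    (l : seq (R * ('rV[R]_5 -> 'rV[R]_5) * ('rV[R]_5 -> 'rV[R]_5))) p0 :
  (forall a, (a < size l)%N ->
     section_of M D (nth p0 l a).1.2 /\ section_of M E (nth p0 l a).2) ->
  v = \sum_(p <- l) p.1.1 *: lie_bracket p.1.2 p.2 u -> bracket_of M D E u v.
Proof.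
move=> DE ->; pose q (a : 'I_(size l)) := nth p0 l a.
exists (size l), (\matrix_a lie_bracket (q a).1.2 (q a).2 u); split.
  move=> a; have [Dp Ep] := DE a (ltn_ord a).
  by exists (q a).1.2, (q a).2; split; rewrite ?rowK.
apply/submxP; exists (\row_a (q a).1.1); rewrite mulmx_sum_row.
rewrite (big_nth p0) big_mkord; apply: eq_bigr => a _.
by rewrite mxE rowK.
Qed.

Definition poly_in_D (s : nat -> spoly) : bool :=
  [&& pzero (s 2 - vp * s 1)%S, pzero (s 3 - vq * s 1)%S
    & pzero (s 5 - poly_F * s 1)%S].

Definition poly_in_derived (s : nat -> spoly) : bool :=
  pzero (s 2 - vp * s 1)%S && pzero (s 5 - poly_F * s 1 + vq * (s 3 - vq * s 1))%S.

Lemma poly_field_entry s u k : poly_field I s u 0 k = peval (env u) (s k.+1).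
Proof. by rewrite mxE. Qed.

Lemma poly_field_section_D s : poly_in_D s -> section_of M (D_ I) (poly_field I s).
Proof.
move=> /and3P[h2 h3 h5]; split; first exact: smooth_poly_field.
move=> u Mu; apply/(D_P _ Mu); rewrite !poly_field_entry /=.
have e01 := env_slice01 I (fun=> 0) u.
have EF : peval (env u) poly_F = F_ I u by rewrite -(F_eval e01) slice_proj.
rewrite (pzeroBP _ h2) (pzeroBP _ h3) (pzeroBP _ h5); move: poly_F EF => S EF.
by rewrite !(pevalM e01) EF !peval_var /= !slice_coord// !inord5.
Qed.

Lemma poly_field_derived s u : M u -> poly_in_derived s ->
  derived_plane u (poly_field I s u).
Proof.
move=> Mu /andP[h2 h5].
have e01 := env_slice01 I (fun=> 0) u.
rewrite /derived_plane /= omega2E omega1E omega3E.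
rewrite (partial_F J_open I_smooth (fun=> 0) Mu) !poly_field_entry /=.
have EF : peval (env u) poly_F = F_ I u by rewrite -(F_eval e01) slice_proj.
have := pzeroP (env u) h5; rewrite (pzeroBP _ h2); move: poly_F EF => S EF.
rewrite !(pevalD, pevalN, pevalM e01) EF !peval_var /= !slice_coord// !inord5 => E.
by split; [ring|rewrite -[RHS]E; ring].
Qed.

Definition poly_field_eq (s s' : nat -> spoly) : bool :=
  all (fun k => pzero (s k.+1 - s' k.+1)%S) (iota 0 5).

Lemma poly_field_ext s s' u : poly_field_eq s s' -> poly_field I s u = poly_field I s' u.
Proof.
move=> /allP E; apply/rowP => k; rewrite !poly_field_entry; apply: pzeroBP.
by apply: E; rewrite mem_iota ltn_ord.
Qed.

Definition q_frame4 := memo1 (fun k => vq * frame4 k)%S.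
Definition q_frame5 := memo1 (fun k => vq * frame5 k)%S.
(** The bracket [E, d_p - q d_z], which is - d_y modulo d_z. *)
Definition bracket53 := memo1 (fun k =>
  - pdelta 2 k + poly_bracket frame5 frame3 5 * pdelta 5 k)%S.

Lemma bracket_poly_field s s' r u : poly_tangent s -> poly_tangent s' -> M u ->
  poly_field_eq (poly_bracket s s') r ->
  lie_bracket (poly_field I s) (poly_field I s') u = poly_field I r u.
Proof.
by move=> Ts Ts' Mu E; rewrite (lie_bracket_poly_field I_smooth)// (poly_field_ext _ E).
Qed.

Lemma poly_field_frame3 u :
  poly_field I frame3 u = delta_mx 0 ip - u 0 iq *: delta_mx 0 iz.
Proof.
have e01 := env_slice01 I (fun=> 0) u.
by apply: row5P; rewrite !mxE /frame3 memo1E// !(pevalE e01) /= ?slice_coord// ?inord5;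
  ring.
Qed.

Lemma poly_field_frame5q3 u :
  poly_field I (fun k => frame5 k + vq * frame3 k)%S u =
  horizontal u + u 0 iq *: poly_field I frame3 u.
Proof.
rewrite -poly_field_frame5; apply/rowP => k.
rewrite !mxE pevalD (pevalM (env_slice01 I (fun=> 0) u)) peval_var /=.
by rewrite slice_coord// inord5.
Qed.

(** With E = d_x + p d_y + q d_p + F d_z, the brackets [d_q, q d_q] = d_q,
    [d_q, q E] = E + q (d_p - q d_z) and [d_q, E] = d_p - q d_z span
    ker (w1, w2). *)
Lemma bracket_D u : M u -> bracket_of M (D_ I) (D_ I) u = derived_plane u.
Proof.
move=> Mu; apply/seteqP; split=> v.
  move=> [k [A [AXY vA]]]; apply: derived_plane_sum vA => i.
  by have [X [Y [DX DY ->]]] := AXY i; exact: lie_bracket_D.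
have e01 := env_slice01 I (fun=> 0) u.
rewrite /derived_plane /= omega2E omega1E omega3E.
rewrite (partial_F J_open I_smooth (fun=> 0) Mu) => -[v1 v2].
have S4 : section_of M (D_ I) (poly_field I frame4).
  by apply: poly_field_section_D; vm_compute.
apply: (@bracket_span _ _ _ _
  [:: (v 0 iq, poly_field I frame4, poly_field I q_frame4);
    (v 0 ix, poly_field I frame4, poly_field I q_frame5);
    (v 0 ip - 2 * u 0 iq * v 0 ix, poly_field I frame4, poly_field I frame5)]
  (0, poly_field I frame4, poly_field I frame4)).
  by case=> [|[|[|//]]] _; split=> //=; apply: poly_field_section_D; vm_compute.
rewrite !big_cons big_nil /=.
rewrite (bracket_poly_field (r := frame4))//; [|by vm_compute..].
rewrite (bracket_poly_field (r := fun k => frame5 k + vq * frame3 k)%S)//;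
  [|by vm_compute..].
rewrite (bracket_poly_field (r := frame3))//; [|by vm_compute..].
rewrite poly_field_frame5q3 poly_field_frame4 poly_field_frame3 horizontalE.
apply: row5P; rewrite !mxE /=; try ring.
- by move/eqP: v1; rewrite subr_eq0 => /eqP ->; ring.
- by apply/eqP; rewrite -subr_eq0 -[X in _ == X]v2; apply/eqP; ring.
Qed.

Lemma poly_field_section_derived s : poly_in_derived s ->
  section_of M (bracket_of M (D_ I) (D_ I)) (poly_field I s).
Proof.
move=> sd; split; first exact: smooth_poly_field.
by move=> u Mu; rewrite bracket_D//; exact: poly_field_derived.
Qed.

(** Besides the brackets that give [D, D], [d_q, d_p - q d_z] = - d_z and
    [E, d_p - q d_z] = - d_y modulo d_z. *)
Lemma D_generic : generic_plane_field M (D_ I).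
Proof.
split; first exact: D_plane_field.
move=> u Mu; apply/seteqP; split=> // v _.
have e01 := env_slice01 I (fun=> 0) u.
pose k := peval (env u) (poly_bracket frame5 frame3 5).
pose c3 := v 0 ip - 2 * u 0 iq * v 0 ix.
pose c5 := u 0 ip * v 0 ix - v 0 iy.
have S4 : section_of M (D_ I) (poly_field I frame4).
  by apply: poly_field_section_D; vm_compute.
have S5 : section_of M (D_ I) (poly_field I frame5).
  by apply: poly_field_section_D; vm_compute.
apply: (@bracket_span _ _ _ _
  [:: (v 0 iq, poly_field I frame4, poly_field I q_frame4);
    (v 0 ix, poly_field I frame4, poly_field I q_frame5);
    (c3, poly_field I frame4, poly_field I frame5);
    ((F_ I u - u 0 iq ^+ 2) * v 0 ix - u 0 iq * c3 + k * c5 - v 0 iz,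
      poly_field I frame4, poly_field I frame3);
    (c5, poly_field I frame5, poly_field I frame3)]
  (0, poly_field I frame4, poly_field I frame4)).
  by case=> [|[|[|[|[|//]]]]] _; split=> //=; apply: poly_field_section_derived;
    vm_compute.
rewrite !big_cons big_nil /=.
rewrite (bracket_poly_field (r := frame4))//; [|by vm_compute..].
rewrite (bracket_poly_field (r := fun k => frame5 k + vq * frame3 k)%S)//;
  [|by vm_compute..].
rewrite (bracket_poly_field (r := frame3))//; [|by vm_compute..].
rewrite (bracket_poly_field (r := fun k => - pdelta 5 k)%S)//; [|by vm_compute..].
rewrite (bracket_poly_field (r := bracket53))//; [|by vm_compute..].
have E4 : poly_field I (fun k => - pdelta 5 k)%S u = - delta_mx 0 iz.
  by apply: row5P; rewrite !mxE !(pevalE e01) /=.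
have E5 : poly_field I bracket53 u = - delta_mx 0 iy + k *: delta_mx 0 iz.
  rewrite /k /bracket53; move: (poly_bracket frame5 frame3 5) => K; apply: row5P;
    rewrite !mxE memo1E// !(pevalE e01) /=; ring.
rewrite poly_field_frame5q3 E4 E5 poly_field_frame3 poly_field_frame4 horizontalE.
clearbody k.
by apply: row5P; rewrite !mxE /= /c3 /c5; ring.
Qed.

End PlaneField.

(** * The ambient metric and the tractor three-form *)

Section Dilations.
Variable R : realType.
Implicit Types (P : 'rV[R]_(1 + 5 + 1)) (y : 'rV[R]_(1 + 5)).

Lemma bundle_incl_proj : bundle_incl R 5 *m ambient_proj R 5 = bundle_proj R 5.
Proof. by rewrite /bundle_incl /ambient_proj mul_row_col mul1mx mul0mx addr0. Qed.

Lemma bundle_projE y : y *m bundle_proj R 5 = rsubmx y.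
Proof. by rewrite -[y in LHS]hsubmxK mul_row_col mulmx0 mulmx1 add0r. Qed.

Lemma ambient_dil_proj s : ambient_dil 5 s *m ambient_proj R 5 = ambient_proj R 5.
Proof.
rewrite /ambient_dil /ambient_proj mul_block_col !mul0mx mul1mx !addr0.
by rewrite /bundle_dil /bundle_proj mul_block_col !mul0mx mulmx0 mul1mx !add0r.
Qed.

Lemma ambient_dilE P s : P *m ambient_dil 5 s =
  row_mx (row_mx (s *: lsubmx (lsubmx P)) (rsubmx (lsubmx P))) (rsubmx P).
Proof.
rewrite -[P in LHS]hsubmxK -[lsubmx P in LHS]hsubmxK /ambient_dil /bundle_dil.
by rewrite !mul_row_block !mulmx0 !mulmx1 mul_mx_scalar !addr0 !add0r.
Qed.

Lemma t_coord_dil P s : t_coord (P *m ambient_dil 5 s) = s * t_coord P.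
Proof. by rewrite /t_coord ambient_dilE !row_mxKl mxE. Qed.

Lemma rho_coord_dil P s : rho_coord (P *m ambient_dil 5 s) = rho_coord P.
Proof. by rewrite /rho_coord ambient_dilE row_mxKr. Qed.

Lemma proj_dil P s : P *m ambient_dil 5 s *m ambient_proj R 5 = P *m ambient_proj R 5.
Proof. by rewrite -mulmxA ambient_dil_proj. Qed.

Lemma t_coord_incl y : t_coord (y *m bundle_incl R 5) = lsubmx y 0 0.
Proof. by rewrite /t_coord /bundle_incl mul_mx_row mulmx1 row_mxKl. Qed.

Lemma rho_coord_incl y : rho_coord (y *m bundle_incl R 5) = 0.
Proof. by rewrite /rho_coord /bundle_incl mul_mx_row mulmx0 row_mxKr mxE. Qed.

Lemma ambient_spaceE J P : ambient_space (M_ J) P =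
  (0 < t_coord P /\ M_ J (P *m ambient_proj R 5)).
Proof.
rewrite /ambient_space /metric_bundle /mkset /ambient_proj.
rewrite -[P in (P *m _)]hsubmxK mul_row_col mulmx0 addr0.
by rewrite bundle_projE.
Qed.

Lemma ambient_space_incl J y : metric_bundle (M_ J) y ->
  ambient_space (M_ J) (y *m bundle_incl R 5).
Proof.
by rewrite ambient_spaceE t_coord_incl -mulmxA bundle_incl_proj bundle_projE.
Qed.

Lemma ambient_space_dil J P s : 0 < s -> ambient_space (M_ J) P ->
  ambient_space (M_ J) (P *m ambient_dil 5 s).
Proof.
move=> s0; rewrite !ambient_spaceE t_coord_dil proj_dil => -[t0 MP].
by split=> //; exact: mulr_gt0.
Qed.

Lemma linear_form0 n (a : Defs.form R 1 n) : linear_form a -> a (fun=> 0) = 0.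
Proof. by move=> al; rewrite (linear_formE _ al) big1// => i _; rewrite mxE mul0r. Qed.

Lemma dtE (v : 'I_1 -> 'rV[R]_(1 + 5 + 1)) : dt v = t_coord (v ord0).
Proof. by rewrite /dt /dcoord /t_coord !mxE. Qed.

Lemma drhoE (v : 'I_1 -> 'rV[R]_(1 + 5 + 1)) : drho v = rho_coord (v ord0).
Proof. by rewrite /drho /dcoord /rho_coord !mxE. Qed.

End Dilations.

Section Ambient.
Variables (R : realType) (J : set R) (I : R -> R).
Hypotheses (J_open : open J) (I_smooth : smooth_function J I).
Local Notation M := (M_ J).
Local Notation W := (ambient_space (M_ J)).
Implicit Types (P : 'rV[R]_(1 + 5 + 1)) (y : 'rV[R]_(1 + 5)).

Lemma ambient_space_jet P : W P -> jet_domain J P.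
Proof. by rewrite ambient_jet_domain. Qed.

Lemma pull_pull m n k (f : 'M[R]_(m, n)) (h : 'M[R]_(n, k)) g x :
  pull_metric f (pull_metric h g) x = pull_metric (f *m h) g x.
Proof. by rewrite /pull_metric trmx_mul !mulmxA. Qed.

(** At rho = 0 only the term t^2 g survives, because drho vanishes on the metric
    bundle. *)
Lemma gt_pull_bundle y : pull_metric (bundle_incl R 5) (gt_ I) y =
  (lsubmx y 0 0) ^+ 2 *: pull_metric (bundle_proj R 5) (g_ I) y.
Proof.
rewrite {1}/pull_metric /gt_ rho_coord_incl t_coord_incl mulr0 scale0r add0r.
rewrite mulmxDr mulmxDl -!scalemxAr -!scalemxAl mulmx_sym_prod;
  try exact: dcoord_linear.
rewrite (_ : sym_prod _ _ = 0) ?scaler0 ?add0r; last first.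
  apply/matrixP => i j; rewrite !mxE !drhoE !rho_coord_incl.
  by rewrite !mulr0 mul0r addr0 mulr0.
rewrite [bundle_incl R 5 *m _ *m _](pull_pull (bundle_incl R 5) (ambient_proj R 5)
  (fun u => g_ I u - _ *: _)) bundle_incl_proj.
by rewrite /pull_metric mulr0 mul0r scale0r subr0.
Qed.

Lemma gt_dil s P : pull_metric (ambient_dil 5 s) (gt_ I) P = s ^+ 2 *: gt_ I P.
Proof.
rewrite {1}/pull_metric {1}/gt_ rho_coord_dil t_coord_dil.
rewrite !(mulmxDr, mulmxDl) -!scalemxAr -!scalemxAl !mulmx_sym_prod;
  try exact: dcoord_linear.
rewrite [ambient_dil 5 s *m _ *m _](pull_pull (ambient_dil 5 s)
  (ambient_proj R 5) (fun u => g_ I u - _ *: _)) ambient_dil_proj /gt_.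
rewrite !scalerDr !scalerA.
have E (v : 'I_1 -> 'rV[R]_(1 + 5 + 1)) :
    dt (fun i => v i *m ambient_dil 5 s) = s * dt v.
  by rewrite !dtE t_coord_dil.
have E' (v : 'I_1 -> 'rV[R]_(1 + 5 + 1)) :
    drho (fun i => v i *m ambient_dil 5 s) = drho v.
  by rewrite !drhoE rho_coord_dil.
congr (_ + _ + _).
- by apply/matrixP => i j; rewrite !mxE !E; ring.
- by apply/matrixP => i j; rewrite !mxE !E !E'; ring.
- by rewrite exprMn.
Qed.

Lemma gt_metric_on : metric_on W (gt_ I).
Proof.
rewrite ambient_jet_domain; split=> [i j|P WP].
  apply: (smooth_jet J_open I_smooth (par := fun=> 0) (p := poly_gt i j)) => P WP.
  exact: (gt_eval J_open I_smooth).
split; first exact: (gt_sym J_open I_smooth (fun=> 0)).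
exact: (gt_unit J_open I_smooth (fun=> 0)).
Qed.

(** Dilation orbits are affinely parametrised lines in the direction d_t, and the
    Christoffel symbols with both lower indices t vanish. *)
Lemma dilation_geodesic P : W P ->
  geodesic (gt_ I) [set s | 0 < s] (fun s => P *m ambient_dil 5 s).
Proof.
move=> WP s k s0; cbv zeta.
pose c r i := (P *m ambient_dil 5 r) 0 i.
have cE i : exists a b, (fun r => c r i) = (fun r => r * a + b) /\
    a = t_coord P * (i == t_index 5)%:R.
  case: (split_ordP i) => i' ->; last first.
    exists 0, (c 0 (rshift _ i')); split.
      by apply/funext => r; rewrite /c !ambient_dilE !row_mxEr mulr0 add0r.
    by rewrite /t_index eq_rlshift mulr0.
  case: (split_ordP i') => j ->; last first.
    exists 0, (c 0 (lshift _ (rshift _ j))); split.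
      by apply/funext => r; rewrite /c !ambient_dilE !row_mxEl !row_mxEr mulr0 add0r.
    by rewrite /t_index eq_lshift eq_rlshift mulr0.
  exists (t_coord P), 0; split; last by rewrite ord1 eqxx mulr1.
  by apply/funext => r; rewrite /c ambient_dilE !row_mxEl mxE ord1 addr0.
have c1 i : derive1 (fun r => c r i) = fun=> t_coord P * (i == t_index 5)%:R.
  have [a [b [-> <-]]] := cE i; apply/funext => r.
  rewrite derive1E; have /@derive_val : is_derive r 1 (fun r => r * a + b) (a + 0).
    apply: is_deriveD; apply: is_derive_eq.
    by rewrite /GRing.scale /= mulr1 mulr0 add0r.
  by rewrite addr0.
set c' := \row_i _.
(* The velocity is a constant multiple of d_t. *)
have c'E i : c' 0 i = t_coord P * (i == t_index 5)%:R by rewrite mxE c1.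
rewrite derive1nS derive1n1 (c1 k) derive1_cst add0r mxE.
have WPs := ambient_space_jet (ambient_space_dil s0 WP).
rewrite big1// => i _; rewrite big1// => j _; rewrite !c'E.
have [->|it] := eqVneq i (t_index 5); last by rewrite !mulr0 mul0r.
have [->|jt] := eqVneq j (t_index 5); last by rewrite !mulr0.
rewrite (christoffel_eval J_open I_smooth (fun=> 0))//= pzeroP ?mul0r//.
suff: all7 (fun k => pzero (poly_christoffel k 0 0)) by move=> /all7P/(_ k).
by vm_compute.
Qed.

Lemma ricci_flat_gt : ricci_flat (gt_ I) W.
Proof.
move=> P /ambient_space_jet WP.
exact: (ricci_gt J_open I_smooth (fun=> 0)).
Qed.

Lemma gt_ambient_metric (c : set ('rV[R]_5 -> 'M[R]_5)) : c (g_ I) ->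
  ambient_metric M c (g_ I) W (gt_ I).
Proof.
move=> cg; have oW : open W by rewrite ambient_jet_domain; exact: open_jet_domain.
split=> //; split; split=> //.
- exact: ambient_space_incl.
- by move=> s P; exact: ambient_space_dil.
- exact: gt_metric_on.
- by move=> y _; exact: gt_pull_bundle.
- by move=> s P _ _; exact: gt_dil.
- exact: dilation_geodesic.
- move=> y i j l My; have Wy := ambient_space_incl My.
  rewrite (eq_iter_partial oW l (G := cst 0) _ Wy) => [|P WP]; last first.
    by rewrite ricci_flat_gt// mxE.
  have -> : iter_partial l (cst 0) = cst 0 :> ('rV[R]_(1 + 5 + 1) -> R).
    elim: l => [//|k l IH] /=; rewrite IH; apply/funext => Q.
    by rewrite /partial derive_cst.
  by [].
Qed.

Lemma Phit_differential_form : differential_form W (Phit_ I).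
Proof.
split=> [P _|w]; first exact: altform_Phit.
pose par k : R := if k == 0%N then C_ R else
  w (inord ((k - 8) %/ 7)) 0 (inord ((k - 8) %% 7)).
rewrite ambient_jet_domain.
apply: (smooth_jet J_open I_smooth (par := par) (p := poly_Phit arg_var)) => P WP.
apply: (Phit_eval J_open) => // m k m3 k7.
rewrite peval_var jet_env_par /par -(addnA 8 (7 * m)%N k) addKn /= mulnC.
by rewrite divnMDl// divn_small// addn0 modnMDl modn_small.
Qed.

Lemma Phit_parallel_ambient : parallel_form (gt_ I) W (Phit_ I).
Proof. by rewrite ambient_jet_domain; exact: Phit_parallel. Qed.

Lemma bundle_affine y : affine 0 (bundle_incl R 5) y = y *m bundle_incl R 5.
Proof. exact: add0r. Qed.

Lemma pull_form_linear0 (a : 'rV[R]_5 -> Defs.form R 1 5) P v :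
  linear_form (a (P *m ambient_proj R 5)) -> v *m ambient_proj R 5 = 0 ->
  pull_form (ambient_proj R 5) a P (fun=> v) = 0.
Proof. by move=> al v0; rewrite /pull_form v0 linear_form0. Qed.

(** Each term of Phit has degree 3 in t and dt together. *)
Lemma Phit_dil s P (w : 'I_3 -> 'rV[R]_(1 + 5 + 1)) :
  Phit_ I (P *m ambient_dil 5 s) (fun i => w i *m ambient_dil 5 s) =
  s ^+ 3 * Phit_ I P w.
Proof.
rewrite /Phit_ !fctE t_coord_dil rho_coord_dil proj_dil !wedge111E.
rewrite !dtE !drhoE !t_coord_dil !rho_coord_dil.
have E (a : 'rV[R]_5 -> Defs.form R 1 5) v :
    pull_form (ambient_proj R 5) a (P *m ambient_dil 5 s)
      (fun=> v *m ambient_dil 5 s) =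
    pull_form (ambient_proj R 5) a P (fun=> v).
  by rewrite /pull_form !proj_dil.
rewrite !E /GRing.scale /=.
move: (pull_form _ (@omega1 R) P) (pull_form _ (omega2 I) P) => o1 o2.
move: (pull_form _ (@omega3 R) P) (pull_form _ (@omega4 R) P) => o3 o4.
move: (pull_form _ (@omega5 R) P) => o5.
ring.
Qed.

Lemma euler_proj y : euler y *m ambient_proj R 5 = 0.
Proof.
by rewrite /euler /ambient_proj /bundle_proj !mul_row_col !mulmx0 mul0mx !addr0.
Qed.

Lemma row0_incl_proj (v : 'rV[R]_5) :
  (row_mx 0 v : 'rV[R]_(1 + 5)) *m bundle_incl R 5 *m ambient_proj R 5 = v.
Proof. by rewrite -mulmxA bundle_incl_proj bundle_projE row_mxKr. Qed.

(** Contraction with t d_t leaves the terms containing dt; of these,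
    dt /\ w3 /\ drho vanishes on lifts tangent to the metric bundle and the
    others, except dt /\ w1 /\ w2, carry the factor rho. *)
Lemma Pi0_Phi y v : Pi0 (Phi_ I) y v =
  - (9 * C_ R * lsubmx y 0 0 ^+ 3) *
  (omega1 (rsubmx y) \wedge omega2 I (rsubmx y)) v.
Proof.
rewrite /Pi0 /Defs.interior /Phi_ wedge11E.
set w := (X in Phit_ I _ X).
have w0 : w (inord 0) = euler y.
  by rewrite /w (_ : inord 0 = ord0) ?unlift_none//; apply: ord_inj; rewrite inordK.
have w1 : w (inord 1) = row_mx 0 (v ord0) *m bundle_incl R 5.
  by rewrite /w (_ : inord 1 = lift ord0 ord0) ?liftK//; apply: ord_inj; rewrite inordK.
have w2 : w (inord 2) = row_mx 0 (v (inord 1)) *m bundle_incl R 5.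
  rewrite /w (_ : inord 2 = lift ord0 (inord 1)) ?liftK//; apply: ord_inj.
  by rewrite lift0 !inordK.
have te : t_coord (euler y) = lsubmx y 0 0 by rewrite /t_coord /euler !row_mxKl.
have re : rho_coord (euler y) = 0 by rewrite /rho_coord /euler row_mxKr mxE.
have tr (a : 'rV[R]_5) : t_coord (row_mx 0 a *m bundle_incl R 5) = 0.
  by rewrite t_coord_incl row_mxKl mxE.
rewrite /Phit_ !fctE t_coord_incl rho_coord_incl !wedge111E.
rewrite !w0 !w1 !w2 !dtE !drhoE te re !tr !rho_coord_incl.
have pe (a : 'rV[R]_5 -> Defs.form R 1 5) : (forall u, linear_form (a u)) ->
    pull_form (ambient_proj R 5) a (y *m bundle_incl R 5) (fun=> euler y) = 0.
  by move=> al; apply: pull_form_linear0 => //; exact: euler_proj.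
have pr (a : 'rV[R]_5 -> Defs.form R 1 5) (b : 'rV[R]_5) :
    pull_form (ambient_proj R 5) a (y *m bundle_incl R 5)
      (fun=> row_mx 0 b *m bundle_incl R 5) = a (rsubmx y) (fun=> b).
  by rewrite /pull_form row0_incl_proj -mulmxA bundle_incl_proj bundle_projE.
rewrite !pr (pe _ (@omega1_linear R)) (pe _ (omega2_linear I)).
rewrite (pe _ (@omega3_linear R)) (pe _ (fun=> @dcoord_linear R _ iq)).
rewrite (pe _ (fun=> @dcoord_linear R _ ix)) /GRing.scale /=.
ring.
Qed.

(** A nonzero multiple of w1 /\ w2 has kernel ker (w1, w2), as its contractions
    with d_y and d_z show. *)
Lemma Phi_kernel y : metric_bundle M y ->
  form_ker (Pi0 (Phi_ I) y) = bracket_of M (D_ I) (D_ I) (rsubmx y).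
Proof.
move=> [t0 My]; rewrite bracket_D//; set u := rsubmx y.
have c0 : - (9 * C_ R * lsubmx y 0 0 ^+ 3) != 0.
  by rewrite oppr_eq0 !mulf_neq0 ?expf_neq0 ?pnatr_eq0 ?gt_eqF ?C_gt0.
have iE v (w : 'I_1 -> 'rV[R]_5) : Defs.interior v (Pi0 (Phi_ I) y) w =
    - (9 * C_ R * lsubmx y 0 0 ^+ 3) *
    (omega1 u (fun=> v) * omega2 I u (fun=> w ord0) -
     omega1 u (fun=> w ord0) * omega2 I u (fun=> v)).
  rewrite /Defs.interior Pi0_Phi wedge11E unlift_none; congr (_ * _).
  by rewrite (_ : inord 1 = lift ord0 ord0) ?liftK//; apply: ord_inj; rewrite inordK.
apply/seteqP; split=> v.
  move=> vK.
  have E w : omega1 u (fun=> v) * omega2 I u (fun=> w) =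
      omega1 u (fun=> w) * omega2 I u (fun=> v).
    have /eqP := vK (fun=> w); rewrite iE mulf_eq0 (negbTE c0) /= subr_eq0.
    by move/eqP.
  (* The vectors d_z and d_y are dual to w2 and w1. *)
  have z1 : omega1 u (fun=> delta_mx 0 iz) = 0 by rewrite omega1E !mxE /=; ring.
  have z2 : omega2 I u (fun=> delta_mx 0 iz) = 1.
    by rewrite omega2E omega3E !mxE /=; ring.
  have y1 : omega1 u (fun=> delta_mx 0 iy) = 1 by rewrite omega1E !mxE /=; ring.
  have y2 : omega2 I u (fun=> delta_mx 0 iy) = 0.
    by rewrite omega2E omega3E !mxE /=; ring.
  split; first by have := E (delta_mx 0 iz); rewrite z1 z2 mulr1 mul0r.
  by have := E (delta_mx 0 iy); rewrite y1 y2 mulr0 mul1r => <-.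
by move=> [v1 v2] w; rewrite iE v1 v2 mul0r mulr0 subr0 mulr0.
Qed.

(** Along the metric bundle the tractor derivative in a direction v is the
    Levi-Civita derivative of Phit in the direction of the image of v, since
    only derivatives of Phit tangent to the bundle occur. *)
Lemma Phi_associated : associated_tractor_form M (D_ I) (gt_ I) (Phi_ I).
Proof.
split.
- split=> [y _|w|s y w s0 My]; first exact: altform_Phit.
    have [_ S] := Phit_differential_form.
    have sigma i : row i (bundle_incl R 5) = delta_mx 0 (lshift 1 i).
      rewrite rowE /bundle_incl mul_mx_row mulmx1 mulmx0; apply/rowP => j.
      case: (split_ordP j) => k ->; rewrite ?(row_mxEl, row_mxEr) !mxE eqxx /=.
        by rewrite eq_lshift.
      by rewrite eq_rlshift.
    have := smooth_on_affine (b := 0) sigma (S w).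
    rewrite (_ : affine _ _ @^-1` _ = metric_bundle M); last first.
      apply/funext => y; rewrite /preimage /mkset bundle_affine ambient_spaceE.
      by rewrite t_coord_incl -mulmxA bundle_incl_proj bundle_projE.
    rewrite (_ : _ \o _ = fun y => Phi_ I y w)//.
    by apply/funext => y; rewrite /= bundle_affine.
  have E : y *m bundle_dil 5 s *m bundle_incl R 5 =
      y *m bundle_incl R 5 *m ambient_dil 5 s.
    rewrite -!mulmxA; congr (_ *m _).
    rewrite /bundle_incl /ambient_dil mul_mx_row mulmx1 mulmx0 mul_row_block.
    by rewrite !mul1mx !mul0mx !addr0.
  by rewrite /Phi_ E Phit_dil.
- move=> X Xbar sX XX y w My.
  have := Phit_parallel_ambient (Xbar y *m bundle_incl R 5) w (ambient_space_incl My).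
  rewrite /cov_deriv /tractor_deriv.
  have := derive_affine 0 (bundle_incl R 5) (fun P => Phit_ I P w) y (Xbar y).
  rewrite bundle_affine => <-.
  have -> : (fun P => Phit_ I P w) \o affine 0 (bundle_incl R 5) =
      (fun z => Phi_ I z w) by apply/funext => z; rewrite /= bundle_affine.
  by [].
- move=> y My; apply: (H_Phit J_open I_smooth).
  exact/ambient_space_jet/ambient_space_incl.
- exact: Phi_kernel.
Qed.

Lemma g_conformal_class : conformal_class M (g_ I) (g_ I).
Proof.
exists (fun=> 1) => [|u Mu]; last by rewrite scale1r.
apply: (smooth_slice J_open I_smooth (par := fun=> 0) (p := pnat 1)) => u _.
by rewrite peval_nat.
Qed.

Lemma g_nurowski : nurowski_structure M (D_ I) (g_ I).
Proof.
exists (conformal_class M (g_ I)); split.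
- exact: g_conformal_structure.
- exact: g_conformal_class.
- exists (g_ I), W, (gt_ I), (Phi_ I); split; last exact: Phi_associated.
  by apply: gt_ambient_metric; exact: g_conformal_class.
Qed.

End Ambient.

Theorem proposition27 (R : realType) (J : set R) (I : R -> R)
    (J_open : open J) (J_connected : connected J)
    (I_smooth : smooth_function J I) :
  let c_ := nurowski_structure (M_ J) (D_ I) in
  (* (1) *)
  [/\ generic_plane_field (M_ J) (D_ I),
      forall u, M_ J u -> D_ I u =
        plane_span (fun=> delta_mx 0 iq)
          (fun u => delta_mx 0 ix + u 0 ip *: delta_mx 0 iy
             + u 0 iq *: delta_mx 0 ip
             - (2^-1 * ((u 0 iq) ^+ 2
                 + 10 / 3 * I (u 0 ix) * (u 0 ip) ^+ 2
                 + (1 + I (u 0 ix) ^+ 2 - derive1n 2 I (u 0 ix))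
                   * (u 0 iy) ^+ 2)) *: delta_mx 0 iz) u
    & c_ (g_ I)] /\
  (* (2) *)
  (ambient_metric (M_ J) c_ (g_ I) (ambient_space (M_ J)) (gt_ I) /\
   ricci_flat (gt_ I) (ambient_space (M_ J))) /\
  (* (3) *)
  [/\ differential_form (ambient_space (M_ J)) (Phit_ I),
      parallel_form (gt_ I) (ambient_space (M_ J)) (Phit_ I),
      forall P, ambient_space (M_ J) P -> H (Phit_ I P) = gt_ I P
    & forall P, ambient_space (M_ J) P -> split_generic (Phit_ I P)] /\
  (* (4) *)
  (associated_tractor_form (M_ J) (D_ I) (gt_ I) (Phi_ I) /\
   forall u, M_ J u ->
     trivialization (Pi0 (Phi_ I)) u =
     - (9 * C_ R) *: (omega1 u \wedge omega2 I u)).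
Proof.
move=> c_; split; [|split; [|split]].
- split; [exact: D_generic|exact: (D_span J_open I_smooth)|exact: g_nurowski].
- split; [|exact: ricci_flat_gt].
  by apply: gt_ambient_metric => //; exact: g_nurowski.
- split; [exact: Phit_differential_form|exact: Phit_parallel_ambient| |].
    by move=> P /ambient_space_jet WP; exact: (H_Phit J_open I_smooth).
  by move=> P /ambient_space_jet WP; exact: (split_generic_Phit J_open I_smooth).
- split; [exact: Phi_associated|move=> u Mu; apply/funext => v].
  rewrite /trivialization Pi0_Phi row_mxKl row_mxKr mxE expr1n mulr1.
  by [].
Qed.
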